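(* Let $\Lambda$ be a finite $k$-graph without sources or sinks such that the numbers $\{\ln\rho(A_i):1\le i\le k\}$ are rationally independent. Suppose that $D$ is a nontrivial strongly connected component which is hereditary but not forwards hereditary, that $\Lambda_D$ is coordinatewise irreducible, and that $$\rho(A_{D,i})=\rho(A_i)>\rho(A_{C,i})\quad\text{for all }1\le i\le k\text{ and all }C\in\mathcal{C}\setminus\{D\}.$$ Let $\alpha^r$ be the preferred dynamics on $\mathcal{T}C^*(\Lambda)$, let $q_D:\mathcal{T}C^*(\Lambda)\to\mathcal{T}C^*(\Lambda\backslash D)$ be the quotient map, and let $\psi$ be the KMS$_1$ state of $(\mathcal{T}C^*(\Lambda),\alpha^r)$ satisfying $$\psi(t_\mu t_\nu^* )=\delta_{\mu,\nu}\Big(\prod_{i=1}^k\rho(A_i)^{-d(\mu)_i}\Big)b^{-1}z_{s(\mu)}\quad\text{for }\mu,\nu\in\Lambda,$$ where the vector $z$ and $b=\|z\|_1$ are as defined in the context. Then every KMS$_1$ state of $(\mathcal{T}C^*(\Lambda),\alpha^r)$ is a convex combination of $\psi$ and a state $\phi\circ q_D$ lifted from a KMS$_1$ state $\phi$ of $(\mathcal{T}C^*(\Lambda\backslash D),\alpha^r)$.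
   Context: A $k$-graph is a countable category $\Lambda$ with a functor $d:\Lambda\to\mathbb{N}^k$ such that whenever $d(\lambda)=n+p$ there are unique $\mu,\nu\in\Lambda$ with $d(\mu)=n$, $d(\nu)=p$ and $\lambda=\mu\nu$. Write $\Lambda^n=d^{-1}(n)$; $\Lambda^0$ is identified with the set of objects (vertices), $r,s:\Lambda\to\Lambda^0$ are the codomain and domain maps, and $\lambda\mu$ is defined when $s(\lambda)=r(\mu)$. For sets (or elements) $X,Y\subset\Lambda^0$, $X\Lambda^nY=\{\lambda\in\Lambda^n:r(\lambda)\in X,\ s(\lambda)\in Y\}$ and $X\Lambda Y=\bigcup_nX\Lambda^nY$. Let $e_1,\dots,e_k$ be the usual basis of $\mathbb{N}^k$. $\Lambda$ is finite if every $\Lambda^n$ is finite; it has no sources or sinks if $v\Lambda^n\ne\emptyset$ and $\Lambda^nv\neq\emptyset$ for all $v\in\Lambda^0$, $n\in\mathbb{N}^k$. The vertex matrices are $A_i(v,w)=|v\Lambda^{e_i}w|$ ($v,w\in\Lambda^0$), and $\rho$ denotes spectral radius. Real numbers $x_1,\dots,x_n$ are rationally independent if $\sum c_ix_i=0$ with $c_i\in\mathbb{Z}$ forces all $c_i=0$. Write $v\le w$ if $v\Lambda w\neq\emptyset$; strongly connected components are the classes of the equivalence relation $v\le w\le v$; a component $\{v\}$ with $v\Lambda v=\{v\}$ is trivial, and $\mathcal{C}$ is the set of nontrivial components. A set $H\subset\Lambda^0$ is hereditary if $v\in H$, $v\le w$ imply $w\in H$, and forwards hereditary if $w\in H$, $v\le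 w$ imply $v\in H$. For a component $C$, $\Lambda_C:=C\Lambda C$ is a $k$-graph with vertex matrices $A_{C,i}=(A_i(v,w))_{v,w\in C}$; it is coordinatewise irreducible if every $A_{C,i}$ is irreducible (a matrix $A$ is irreducible if for all $(v,w)$ there is $m$ with $A^m(v,w)\ne0$). For $\mu,\nu\in\Lambda$ with $r(\mu)=r(\nu)$, $\Lambda^{\min}(\mu,\nu)=\{(\eta,\zeta):\mu\eta=\nu\zeta,\ d(\mu\eta)=d(\mu)\vee d(\nu)\}$; it is empty if $r(\mu)\neq r(\nu)$. $\mathcal{T}C^*(\Lambda)$ is the $C^*$-algebra generated by a universal family of partial isometries $\{t_\lambda:\lambda\in\Lambda\}$ such that: the $q_v:=t_v$ ($v\in\Lambda^0$) are mutually orthogonal projections; $t_\lambda t_\mu=t_{\lambda\mu}$ if $s(\lambda)=r(\mu)$; $t_\lambda^*t_\lambda=q_{s(\lambda)}$; $q_v\ge\sum_{\lambda\in v\Lambda^n}t_\lambda t_\lambda^*$ for all $v,n$ (empty sums are $0$); and $t_\mu^*t_\nu=\sum_{(\eta,\zeta)\in\Lambda^{\min}(\mu,\nu)}t_\eta t_\zeta^*$. For $r\in(0,\infty)^k$ the dynamics $\alpha^r$ on $\mathcal{T}C^*(\Lambda)$ is $\alpha^r_t(t_\lambda)=e^{it\,r\cdot d(\lambda)}t_\lambda$. The preferred dynamics is $\alpha^r$ with $r_i=\ln\rho(A_i)$ for all $i$; speaking of it presupposes $r\in(0,\infty)^k$, i.e. $\rho(A_i)>1$ for all $i$. A state $\phi$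 is a KMS$_\beta$ state ($\beta\in(0,\infty)$) of $(A,\alpha)$ if $\phi(ab)=\phi(b\,\alpha_{i\beta}(a))$ for all $a,b$ in a dense $\alpha$-invariant subalgebra of analytic elements (here $\operatorname{span}\{t_\mu t_\nu^*\}$ can be used). Since $D$ is hereditary, $\Lambda\backslash D:=(\Lambda^0\backslash D)\Lambda(\Lambda^0\backslash D)$ is a $k$-graph (possibly with sources), and there is a surjective homomorphism $q_D:\mathcal{T}C^*(\Lambda)\to\mathcal{T}C^*(\Lambda\backslash D)$ which sends each $t_\lambda$ with $\lambda\in\Lambda\backslash D$ to the corresponding generator, and whose kernel is the ideal generated by $\{q_v:v\in D\}$. On $\mathcal{T}C^*(\Lambda\backslash D)$, $\alpha^r$ denotes the induced dynamics, given by the same formula with the same $r$ (that is, $r_i=\ln\rho(A_i)$ with $A_i$ the vertex matrices of $\Lambda$). The vector $z\in[0,\infty)^{\Lambda^0}$: let $x\in(0,\infty)^D$ be the common unimodular Perron-Frobenius eigenvector of the commuting irreducible matrices $A_{D,i}$, that is, the unique strictly positive vector with $\|x\|_1=1$ and $A_{D,i}x=\rho(A_{D,i})x$ for all $i$. Let $H=\{v\in\Lambda^0:v\Lambda D=\emptyset\}$, $F=\Lambda^0\setminus(D\cup H)$, $E_i=(A_i(v,w))_{v,w\in F}$ and $B_i=(A_i(v,w))_{v\in F,w\in D}$. Let $y=(\rho(A_{D,i})1_F-E_i)^{-1}B_ix\in[0,\infty)^F$, which does not depend on $i$. Then $z=(y,x,0)$ with respect to $\Lambda^0=F\cup D\cup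 H$. (It is known that the state $\psi$ in the claim exists; it is determined by the displayed formula.) *)

(* Defs.v *)
From HB Require Import structures.
From mathcomp Require Import all_boot all_order all_algebra.
From mathcomp Require Import finmap complex.
From mathcomp Require Import all_classical all_reals all_analysis.
Set Implicit Arguments.
Unset Strict Implicit.
Unset Printing Implicit Defensive.
Import Order.TTheory GRing.Theory Num.Theory.
Import numFieldNormedType.Exports.
Local Open Scope classical_set_scope.
Local Open Scope ring_scope.
Local Open Scope complex_scope.

(** * Complex C*-algebras (not necessarily unital)

  MathComp's rings are unital, hence the separate product [cmul] on top of a
  complex Banach space. *)

HB.mixin Record isCStarAlgebra (R : realType) (A : Type)
    & CompleteNormedModule R[i] A := {
  cmul : A -> A -> A ;
  star : A -> A ;
  cmulA : forall a b c : A, cmul a (cmul b c) = cmul (cmul a b) c ;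
  cmulDl : forall a b c : A, cmul (a + b) c = cmul a c + cmul b c ;
  cmulDr : forall a b c : A, cmul a (b + c) = cmul a b + cmul a c ;
  cmulZl : forall (x : R[i]) (a b : A), cmul (x *: a) b = x *: cmul a b ;
  cmulZr : forall (x : R[i]) (a b : A), cmul a (x *: b) = x *: cmul a b ;
  starD : forall a b : A, star (a + b) = star a + star b ;
  starZ : forall (x : R[i]) (a : A), star (x *: a) = x^* *: star a ;
  starM : forall a b : A, star (cmul a b) = cmul (star b) (star a) ;
  starK : forall a : A, star (star a) = a ;
  norm_cmul : forall a b : A, `|cmul a b| <= `|a| * `|b| ;
  norm_cstar : forall a : A, `|cmul (star a) a| = `|a| ^+ 2
}.

#[short(type="cStarAlgType")]
HB.structure Definition CStarAlgebra (R : realType) :=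
  { A of isCStarAlgebra R A & CompleteNormedModule R[i] A }.

Notation "a ** b" := (cmul a b) (at level 40, left associativity) : ring_scope.

Section CStarAlgebras.
Variable R : realType.
Implicit Types A B : cStarAlgType R.

Definition cle A (a b : A) : Prop := exists c : A, b - a = star c ** c.

Definition star_hom A B (f : A -> B) : Prop :=
  [/\ linear f, (forall a b, f (a ** b) = f a ** f b)
    & (forall a, f (star a) = star (f a))].

Definition closed_star_subalgebra A (S : set A) : Prop :=
  [/\ S 0 /\ (forall (x : R[i]) a b, S a -> S b -> S (x *: a + b)),
      (forall a b, S a -> S b -> S (a ** b)),
      (forall a, S a -> S (star a)) & closed S].

Definition closed_ideal A (I : set A) : Prop :=
  [/\ I 0, (forall (x : R[i]) a b, I a -> I b -> I (x *: a + b)),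
      (forall a b, I b -> I (a ** b) /\ I (b ** a)) & closed I].

Definition ideal_generated A (X : set A) : set A :=
  [set a | forall I, closed_ideal I -> X `<=` I -> I a].

(* The order of R[i] is partial: 0 <= z means that z is real and nonnegative.
   The last two clauses say that the operator norm of phi is 1. *)
Definition is_state A (phi : A -> R[i]) : Prop :=
  [/\ scalar phi, (forall a, 0 <= phi (star a ** a)),
      (forall a, `|phi a| <= `|a|)
    & (forall e : R, 0 < e -> exists2 a : A, `|a| <= 1 & (1 - e)%:C < `|phi a|)].

Definition cstar_dynamics A (alpha : R -> A -> A) : Prop :=
  [/\ (forall t, star_hom (alpha t)), (forall a, alpha 0 a = a),
      (forall t u a, alpha (t + u) a = alpha t (alpha u a))
    & (forall a, continuous (fun t : R => alpha t a))].

Definition entire A (f : R[i] -> A) : Prop :=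
  exists c : nat -> A, forall z : R[i], series (fun n => z ^+ n *: c n) @ \oo --> f z.

(* f z is then alpha_z(a); f is determined by alpha and a. *)
Definition analytic_extension A (alpha : R -> A -> A) (a : A) (f : R[i] -> A) : Prop :=
  entire f /\ forall t : R, f t%:C = alpha t a.

(* S is meant to be a dense alpha-invariant subalgebra of analytic elements. *)
Definition KMS_state A (alpha : R -> A -> A) (S : set A) (beta : R)
    (phi : A -> R[i]) : Prop :=
  is_state phi /\
  forall a b, S a -> S b ->
    exists2 f, analytic_extension alpha a f & phi (a ** b) = phi (b ** f (0 +i* beta)).

End CStarAlgebras.

(** * k-graphs

  [kg_cmp l m] stands for the composite lm and is meaningful only if
  [kg_src l = kg_rng m]. The vertex set is a finite type from the outset, as
  only finite k-graphs are considered. *)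

Record kgraph (k : nat) := KGraph {
  kg_vtx : finType ;
  kg_mor : countType ;
  kg_rng : kg_mor -> kg_vtx ;
  kg_src : kg_mor -> kg_vtx ;
  kg_id : kg_vtx -> kg_mor ;
  kg_cmp : kg_mor -> kg_mor -> kg_mor ;
  kg_deg : kg_mor -> {ffun 'I_k -> nat} ;
  kg_rng_id : forall v, kg_rng (kg_id v) = v ;
  kg_src_id : forall v, kg_src (kg_id v) = v ;
  kg_rng_cmp : forall l m, kg_src l = kg_rng m -> kg_rng (kg_cmp l m) = kg_rng l ;
  kg_src_cmp : forall l m, kg_src l = kg_rng m -> kg_src (kg_cmp l m) = kg_src m ;
  kg_cmp_idl : forall l, kg_cmp (kg_id (kg_rng l)) l = l ;
  kg_cmp_idr : forall l, kg_cmp l (kg_id (kg_src l)) = l ;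
  kg_cmpA : forall l m n, kg_src l = kg_rng m -> kg_src m = kg_rng n ->
    kg_cmp l (kg_cmp m n) = kg_cmp (kg_cmp l m) n ;
  kg_deg_id : forall v, kg_deg (kg_id v) = 0 ;
  kg_deg_cmp : forall l m, kg_src l = kg_rng m ->
    kg_deg (kg_cmp l m) = kg_deg l + kg_deg m ;
  kg_fact : forall l n p, kg_deg l = n + p ->
    exists! mn : kg_mor * kg_mor,
      [/\ kg_deg mn.1 = n, kg_deg mn.2 = p, kg_src mn.1 = kg_rng mn.2
        & l = kg_cmp mn.1 mn.2]
}.

Arguments kg_id {k} L v : rename.

Section KGraphs.
Variables (k : nat) (L : kgraph k).
Local Notation V := (kg_vtx L).
Local Notation M := (kg_mor L).
Implicit Types (v w : V) (n : {ffun 'I_k -> nat}) (C D H : {set V}).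

Definition kg_unit (i : 'I_k) : {ffun 'I_k -> nat} := [ffun j => (j == i) : nat].

Definition kg_finite : Prop := forall n, finite_set [set l : M | kg_deg l = n].

Definition kg_paths_from v n : set M := [set l | kg_rng l = v /\ kg_deg l = n].

Definition kg_paths v n w : set M :=
  [set l | [/\ kg_rng l = v, kg_deg l = n & kg_src l = w]].

Definition kg_no_sources_sinks : Prop :=
  forall v n, (exists l : M, kg_deg l = n /\ kg_rng l = v) /\
              (exists l : M, kg_deg l = n /\ kg_src l = v).

Definition kg_le v w : Prop := exists l : M, kg_rng l = v /\ kg_src l = w.

Definition kg_component C : Prop :=
  exists v, forall w, (w \in C) <-> (kg_le v w /\ kg_le w v).

Definition kg_trivial C : Prop :=
  exists2 v, C = [set v]%SET &
    forall l : M, kg_rng l = v -> kg_src l = v -> l = kg_id L v.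

Definition kg_nontrivial_component C : Prop := kg_component C /\ ~ kg_trivial C.

Definition kg_hereditary H : Prop := forall v w, v \in H -> kg_le v w -> w \in H.

Definition kg_forwards_hereditary H : Prop :=
  forall v w, w \in H -> kg_le v w -> v \in H.

Definition kg_join (m n : {ffun 'I_k -> nat}) : {ffun 'I_k -> nat} :=
  [ffun i => maxn (m i) (n i)].

Definition kg_min (mu nu : M) : set (M * M) :=
  [set ez | [/\ kg_rng mu = kg_rng nu, kg_src mu = kg_rng ez.1,
                kg_src nu = kg_rng ez.2, kg_cmp mu ez.1 = kg_cmp nu ez.2
              & kg_deg (kg_cmp mu ez.1) = kg_join (kg_deg mu) (kg_deg nu)]].

End KGraphs.

(** * The k-graph obtained by removing a hereditary set of vertices *)

Section Minus.
Variables (k : nat) (L : kgraph k) (D : {set kg_vtx L}).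
Hypothesis hD : kg_hereditary D.

Definition minus_vtx := {v : kg_vtx L | v \notin D}.
Definition minus_mor :=
  {l : kg_mor L | (kg_rng l \notin D) && (kg_src l \notin D)}.

Definition minus_rng (l : minus_mor) : minus_vtx :=
  exist _ (kg_rng (val l)) (proj1 (andP (valP l))).
Definition minus_src (l : minus_mor) : minus_vtx :=
  exist _ (kg_src (val l)) (proj2 (andP (valP l))).

Lemma minus_idP (v : minus_vtx) :
  (kg_rng (kg_id L (val v)) \notin D) && (kg_src (kg_id L (val v)) \notin D).
Proof. by rewrite kg_rng_id kg_src_id (valP v). Qed.

Definition minus_id (v : minus_vtx) : minus_mor := exist _ (kg_id L (val v)) (minus_idP v).
(* Total composition: l is a junk value, returned only for non-composable pairs. *)
Definition minus_cmp (l m : minus_mor) : minus_mor :=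
  insubd l (kg_cmp (val l) (val m)).
Definition minus_deg (l : minus_mor) := kg_deg (val l).

Lemma minus_src_rng (l m : minus_mor) :
  minus_src l = minus_rng m -> kg_src (val l) = kg_rng (val m).
Proof. by move=> /(congr1 val). Qed.

Lemma val_minus_cmp (l m : minus_mor) : minus_src l = minus_rng m ->
  val (minus_cmp l m) = kg_cmp (val l) (val m).
Proof.
move=> /minus_src_rng e; rewrite val_insubd kg_rng_cmp // kg_src_cmp //.
by rewrite (proj1 (andP (valP l))) (proj2 (andP (valP m))).
Qed.

Lemma minus_rng_id v : minus_rng (minus_id v) = v.
Proof. by apply: val_inj; rewrite /= kg_rng_id. Qed.

Lemma minus_src_id v : minus_src (minus_id v) = v.
Proof. by apply: val_inj; rewrite /= kg_src_id. Qed.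

Lemma minus_rng_cmp l m :
  minus_src l = minus_rng m -> minus_rng (minus_cmp l m) = minus_rng l.
Proof.
move=> e; apply: val_inj; rewrite /= val_minus_cmp // kg_rng_cmp //.
exact: minus_src_rng.
Qed.

Lemma minus_src_cmp l m :
  minus_src l = minus_rng m -> minus_src (minus_cmp l m) = minus_src m.
Proof.
move=> e; apply: val_inj; rewrite /= val_minus_cmp // kg_src_cmp //.
exact: minus_src_rng.
Qed.

Lemma minus_cmp_idl l : minus_cmp (minus_id (minus_rng l)) l = l.
Proof.
by apply: val_inj; rewrite val_minus_cmp ?minus_src_id //= kg_cmp_idl.
Qed.

Lemma minus_cmp_idr l : minus_cmp l (minus_id (minus_src l)) = l.
Proof.
by apply: val_inj; rewrite val_minus_cmp ?minus_rng_id //= kg_cmp_idr.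
Qed.

Lemma minus_cmpA l m n : minus_src l = minus_rng m -> minus_src m = minus_rng n ->
  minus_cmp l (minus_cmp m n) = minus_cmp (minus_cmp l m) n.
Proof.
move=> e1 e2; apply: val_inj.
rewrite !val_minus_cmp ?minus_rng_cmp ?minus_src_cmp //.
by rewrite kg_cmpA //; exact: minus_src_rng.
Qed.

Lemma minus_deg_id v : minus_deg (minus_id v) = 0.
Proof. exact: kg_deg_id. Qed.

Lemma minus_deg_cmp l m : minus_src l = minus_rng m ->
  minus_deg (minus_cmp l m) = minus_deg l + minus_deg m.
Proof.
move=> e; rewrite /minus_deg val_minus_cmp // kg_deg_cmp //.
exact: minus_src_rng.
Qed.

Lemma minus_fact l n p : minus_deg l = n + p ->
  exists! mn : minus_mor * minus_mor,
    [/\ minus_deg mn.1 = n, minus_deg mn.2 = p, minus_src mn.1 = minus_rng mn.2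
      & l = minus_cmp mn.1 mn.2].
Proof.
move=> /kg_fact[[m m'] [/= [dm dm' smm' lE] mm'_uniq]].
have /andP[rl sl] := valP l.
have rm : kg_rng m \notin D by rewrite -(kg_rng_cmp smm') -lE.
have sm' : kg_src m' \notin D by rewrite -(kg_src_cmp smm') -lE.
have sm : kg_src m \notin D.
  apply: contra sm' => smD; apply: (hD smD).
  by exists m'; rewrite smm'.
have mP : (kg_rng m \notin D) && (kg_src m \notin D) by rewrite rm.
have m'P : (kg_rng m' \notin D) && (kg_src m' \notin D) by rewrite -smm' sm.
pose a : minus_mor := exist _ m mP; pose b : minus_mor := exist _ m' m'P.
have sab : minus_src a = minus_rng b by apply: val_inj.
exists (a, b); split => [|[c d] /= [dc dd scd lE']].
  by split=> //; apply: val_inj; rewrite val_minus_cmp.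
have : (m, m') = (val c, val d).
  apply: mm'_uniq; split=> //=; first exact: minus_src_rng.
  by rewrite lE' val_minus_cmp.
by case=> mE m'E; congr pair; apply: val_inj.
Qed.

Definition kg_minus : kgraph k :=
  @KGraph k minus_vtx minus_mor minus_rng minus_src minus_id minus_cmp minus_deg
    minus_rng_id minus_src_id minus_rng_cmp minus_src_cmp minus_cmp_idl
    minus_cmp_idr minus_cmpA minus_deg_id minus_deg_cmp minus_fact.

End Minus.

(** * Toeplitz algebras *)

Section Toeplitz.
Variables (R : realType) (k : nat) (L : kgraph k).
Local Notation q t v := (t (kg_id L v)).

(* The sums range over sets that are finite when L is finite
   ([\sum_(i \in S)] is 0 when the summand has infinite support in S). *)
Definition toeplitz_family (A : cStarAlgType R) (t : kg_mor L -> A) : Prop :=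
  [/\ (forall l, t l ** star (t l) ** t l = t l) /\
      ((forall v, star (q t v) = q t v /\ q t v ** q t v = q t v) /\
       (forall v w, v <> w -> q t v ** q t w = 0)),
      (forall l m, kg_src l = kg_rng m -> t l ** t m = t (kg_cmp l m)),
      (forall l, star (t l) ** t l = q t (kg_src l)),
      (forall v n, cle (\sum_(l \in kg_paths_from v n) (t l ** star (t l))) (q t v))
    & (forall mu nu, star (t mu) ** t nu =
         \sum_(ez \in kg_min mu nu) (t ez.1 ** star (t ez.2)))].

(* (A, t) is TC*(L): A is generated by a universal Toeplitz family t. *)
Definition toeplitz_algebra (A : cStarAlgType R) (t : kg_mor L -> A) : Prop :=
  [/\ toeplitz_family t,
      (forall S, closed_star_subalgebra S -> (forall l, S (t l)) -> S = [set: A])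
    & (forall (B : cStarAlgType R) (t' : kg_mor L -> B), toeplitz_family t' ->
         exists2 f : A -> B, star_hom f & forall l, f (t l) = t' l)].

Definition toeplitz_span (A : cStarAlgType R) (t : kg_mor L -> A) : set A :=
  [set a | exists (n : nat) (c : 'I_n -> R[i]) (mu nu : 'I_n -> kg_mor L),
     a = \sum_(j < n) c j *: (t (mu j) ** star (t (nu j)))].

Definition expi (x : R) : R[i] := cos x +i* sin x.

Definition toeplitz_dynamics (A : cStarAlgType R) (t : kg_mor L -> A)
    (r : 'I_k -> R) (alpha : R -> A -> A) : Prop :=
  cstar_dynamics alpha /\
  forall (x : R) l,
    alpha x (t l) = expi (x * \sum_(i < k) r i * (kg_deg l i)%:R) *: t l.

End Toeplitz.

Definition toeplitz_quotient (R : realType) (k : nat) (L : kgraph k)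
    (D : {set kg_vtx L}) (hD : kg_hereditary D)
    (A : cStarAlgType R) (t : kg_mor L -> A)
    (B : cStarAlgType R) (s : kg_mor (kg_minus hD) -> B) (q : A -> B) : Prop :=
  [/\ star_hom q, (forall b, exists a, q a = b),
      (forall l : kg_mor (kg_minus hD), q (t (val l)) = s l)
    & (forall a, q a = 0 <->
         ideal_generated [set p | exists2 v, v \in D & p = t (kg_id L v)] a)].

(** * Vertex matrices and the Perron-Frobenius data *)

Section VertexMatrices.
Variables (R : realType) (k : nat) (L : kgraph k).
Local Notation V := (kg_vtx L).

Definition spectral_radius n (A : 'M[R]_n) : R :=
  sup [set x : R | exists2 a : R[i],
         eigenvalue (map_mx (real_complex R) A) a & x%:C = `|a|].

Definition irreducible_mx n (A : 'M[R]_n) : Prop :=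
  forall v w, exists m : nat, (A ^+ m) v w != 0.

(* The block of the i-th vertex matrix with rows in X and columns in Y. *)
Definition vmx (X Y : {set V}) (i : 'I_k) : 'M[R]_(#|X|, #|Y|) :=
  \matrix_(a, b)
    (#|` fset_set (kg_paths (enum_val a) (kg_unit i) (enum_val b))|)%:R.

Definition rho_on (C : {set V}) (i : 'I_k) : R := spectral_radius (vmx C C i).

Definition rho (i : 'I_k) : R := rho_on [set: V]%SET i.

Definition coordinatewise_irreducible (C : {set V}) : Prop :=
  forall i, irreducible_mx (vmx C C i).

Definition rationally_independent n (x : 'I_n -> R) : Prop :=
  forall c : 'I_n -> int, \sum_(i < n) (c i)%:~R * x i = 0 -> forall i, c i = 0.

Definition restrict_cv (z : V -> R) (X : {set V}) : 'cV[R]_#|X| :=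
  \col_a z (enum_val a).

Definition not_to (D : {set V}) : {set V} :=
  finset (fun v => `[< forall w, w \in D -> ~ kg_le v w >]).

Definition perron_extension (D : {set V}) (z : V -> R) : Prop :=
  let H := not_to D in
  let F := ~: (D :|: H)%SET in
  [/\ (forall v, v \in D -> 0 < z v) /\ \sum_(v in D) z v = 1,
      (forall i, vmx D D i *m restrict_cv z D = rho_on D i *: restrict_cv z D),
      (forall i, restrict_cv z F =
         invmx ((rho_on D i)%:M - vmx F F i) *m (vmx F D i *m restrict_cv z D))
    & (forall v, v \in H -> z v = 0)].

End VertexMatrices.
Arguments rho R {k} L i.
Arguments rho_on R {k L} C i.

(* Main.v *)
Require Import Defs.
From HB Require Import structures.
From mathcomp Require Import all_boot all_order all_algebra.
From mathcomp Require Import finmap complex.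
From mathcomp Require Import all_classical all_reals all_analysis.
From mathcomp Require Import summability.
From mathcomp Require Import ring lra.

(** A KMS state [Phi] at inverse temperature 1 is determined by its vertex weights
  [m v = Phi (q_v)]: since the logarithms of the spectral radii are rationally independent,
  the KMS condition forces [Phi] to vanish on the monomials [t mu ** star (t nu)] with
  [mu <> nu] and to equal [boltzmann mu * m (kg_src mu)] when [mu = nu] ([kms_monomial]). So
  the theorem is a statement about the vectors [m].

  For every vertex [v] the algebra contains the gap projection
  [vgap t v = q_v * prod_i (1 - sum_e t_e t_e^star)], where [e] runs over the edges of the
  colour [i]; on paths it projects onto the vertex path at [v]. By the KMS condition the value
  of [Phi] at [vgap t v] is the entry at [v] of [eps = prod_i (1 - rho_i^-1 A_i) m]
  ([kms_gap]), so [eps >= 0]; the same argument with one colour gives [A_i m <= rho_i m]. On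
  [D], which is hereditary, with [A_(D,i)] irreducible of spectral radius [rho_i],
  Perron-Frobenius theory turns the last inequality into [m = c zeta], where [zeta = z / b] are
  the weights of [psi] ([subinvariant_on_component]). As [zeta] satisfies [A_i zeta = rho_i zeta]
  at all vertices ([perron_extension_harmonic]), the vector [m - c zeta] vanishes on [D] and has
  the same image [eps] under the gap operator [prod_i (1 - rho_i^-1 A_i)].

  Off [D] every component has spectral radius below [rho_i]. Hence the gap operator is injective
  on the vectors vanishing on [D] ([gap_vector_inj]), and the sum of [boltzmann a] over all
  paths [a] of the graph without [D] is finite ([path_sum_bound]). The second fact allows the
  Gibbs construction in the quotient: with [h_v] the coefficient in the one-dimensional corner
  at [vgap s v] ([gap_coef]), the functional
  [b |-> sum_a boltzmann a * eps (kg_src a) * h_(kg_src a) (star (s a) ** b ** s a)] is, up to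
  the normalising factor [S], a KMS state [phi] ([gibbs_generator]), and the image of its
  weights under the gap operator is [eps / S]. By injectivity [m - c zeta] is [S] times the
  weights of [phi] ([kms_remainder]). The weights of a state sum to 1, so [c + S = 1], and
  [Phi] agrees with [c psi + (1 - c) (phi o qD)] on monomials, hence everywhere. When
  [eps = 0] the same computation gives [c = 1].

  Two points need analysis. First, the corner coefficients require that the gap projections
  of the universal algebra do not vanish, which is seen in the representation by left
  prolongation on the square-summable functions of paths; the bounded operators on that space
  are shown to form a C-star-algebra for this purpose. Second, the KMS condition speaks of an
  entire extension of [x |-> alpha x (t mu)], and only the identity theorem for power series
  identifies it with the exponential ([phase_extension_unique]). *)

Set Implicit Arguments.
Unset Strict Implicit.
Unset Printing Implicit Defensive.
Import Order.TTheory GRing.Theory Num.Theory.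
Import numFieldNormedType.Exports.
Local Open Scope classical_set_scope.
Local Open Scope ring_scope.
Local Open Scope complex_scope.
Local Existing Instance totally_filter.

(** * Finite and unconditional sums *)

Lemma big_one_term (A : nmodType) (I : eqType) (s : seq I) (i0 : I) (F : I -> A) :
  uniq s -> i0 \in s -> (forall i, i \in s -> i != i0 -> F i = 0) ->
  \sum_(i <- s) F i = F i0.
Proof.
move=> us i0s F0; rewrite (bigD1_seq i0) //= big_seq_cond big1 ?addr0 //.
by move=> i /andP[]; apply: F0.
Qed.

Lemma pmap_pbij_uniq (X Y : eqType) (p : X -> option Y) (p' : Y -> option X) (s : seq X) :
  (forall x y, p x = Some y <-> p' y = Some x) -> uniq s -> uniq (pmap p s).
Proof.
move=> pp'; elim: s => //= x s IH /andP[xs us].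
case E: (p x) => [y|] /=; last exact: IH.
rewrite IH // andbT mem_pmap; apply/mapP => -[x' x's /esym/pp' E'].
by move/pp': E; rewrite E' => -[e]; rewrite -e x's in xs.
Qed.

(** Unconditional summation: [totally] is the filter of finite subsets. *)
Record has_sum (X : choiceType) (K : numFieldType) (f : X -> K) (l : K) : Prop := HasSum {
  has_sum_cvg : (fun F : {fset X} => \sum_(x <- F) f x : K^o) @ totally --> (l : K^o)
}.

Section HasSum.
Variable X : choiceType.

Section NumField.
Variable K : numFieldType.
Implicit Types (f g : X -> K) (l m : K).

Lemma has_sum_unique f l m : has_sum f l -> has_sum f m -> l = m.
Proof. by move=> [fl] [fm]; apply: (@cvg_unique K^o _ (fmap _ totally)) fl fm. Qed.

Lemma has_sumD f g l m :
  has_sum f l -> has_sum g m -> has_sum (fun x => f x + g x) (l + m).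
Proof.
move=> [fl] [gm]; split.
under eq_fun do rewrite big_split /=.
exact: cvgD.
Qed.

Lemma has_sumZ (c : K) f l : has_sum f l -> has_sum (fun x => c * f x) (c * l).
Proof.
move=> [fl]; split.
under eq_fun do rewrite -mulr_sumr.
exact: (@cvgZr _ K^o).
Qed.

Lemma has_sum_finite (A : {fset X}) f :
  (forall x, x \notin A -> f x = 0) -> has_sum f (\sum_(x <- A) f x).
Proof.
move=> f0; split=> U /nbhs_singleton Ul; exists A => // F /= AF.
by rewrite /= -(big_fset_incl _ AF) // => x _; apply: f0.
Qed.

Lemma has_sum0 : has_sum (fun _ : X => 0 : K) 0.
Proof.
have := @has_sum_finite fset0 (fun=> 0); rewrite big_seq_fset0; exact.
Qed.

Lemma has_sum_norm_le f l (C : K) : C \is Num.real ->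
  (forall F : {fset X}, \sum_(x <- F) `|f x| <= C) -> has_sum f l -> `|l| <= C.
Proof.
move=> Creal fC [fl]; rewrite real_leNgt //; apply/negP => Cl.
have /(cvgrPdist_lt _ (l : K^o))/(_ (`|l| - C)) := fl.
rewrite subr_gt0 => /(_ Cl)[F _ /(_ F (fsubset_refl F))] /=.
apply/negP; rewrite -real_leNgt ?realB ?normr_real //.
rewrite lerBlDl -lerBlDr.
apply: le_trans (lerB_dist _ _) _.
by rewrite opprB addrCA subrr addr0; apply: le_trans (fC F); apply: ler_norm_sum.
Qed.

End NumField.

(** Both sums run over the graph of the partial bijection [p], read from either side. *)
Lemma has_sum_reindex (Y : choiceType) (K : numFieldType) (p : X -> option Y)
    (p' : Y -> option X) (f : X -> Y -> K) (l : K) :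
  (forall x y, p x = Some y <-> p' y = Some x) ->
  has_sum (fun x => oapp (f x) 0 (p x)) l ->
  has_sum (fun y => oapp (f^~ y) 0 (p' y)) l.
Proof.
move=> pp' [fl]; split=> U /fl[F0 _ F0U].
exists [fset y | y in pmap p F0]%fset => // G /= F0G.
pose F := (F0 `|` [fset x | x in pmap p' G])%fset.
have := F0U F (fsubsetUl _ _); rewrite /preimage /=.
suff -> : \sum_(x <- F) oapp (f x) 0 (p x) = \sum_(y <- G) oapp (f^~ y) 0 (p' y) by [].
pose h y := oapp (f^~ y) 0 (p' y).
have -> : \sum_(x <- F) oapp (f x) 0 (p x) = \sum_(x <- F) oapp h 0 (p x).
  apply: eq_bigr => x _; case E: (p x) => [y|] //=.
  by rewrite /h; move/pp': E => ->.
rewrite -big_pmap.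
transitivity (\sum_(y <- G | isSome (p' y)) h y); last first.
  apply/esym.
  rewrite (bigID (fun y => isSome (p' y))) /= [X in _ + X]big1 ?addr0 //.
  by move=> y; rewrite /h; case: (p' y).
transitivity (\sum_(y <- pmap p F) h y); first by [].
rewrite -[RHS]big_filter; apply: perm_big; apply: uniq_perm.
- exact: pmap_pbij_uniq pp' (fset_uniq F).
- by rewrite filter_uniq // fset_uniq.
move=> y; rewrite mem_filter mem_pmap; apply/mapP/andP => [[x xF /esym E]|[]].
  have E' := E; move/pp': E => E; rewrite E; split => //.
  move: xF; rewrite /F in_fsetU => /orP[xF0|].
    apply: (fsubsetP F0G); rewrite !inE mem_pmap; apply/mapP; exists x => //.
  rewrite !inE mem_pmap => /mapP[y' y'G /esym/pp'].
  by rewrite E' => -[->].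
case E: (p' y) => [x|//] _ yG; exists x; last by move/pp': E => ->.
rewrite /F in_fsetU; apply/orP; right; rewrite !inE mem_pmap.
by apply/mapP; exists y.
Qed.

End HasSum.

Section HasSumReal.
Variables (R : realType) (X : choiceType).

Implicit Types f g : X -> R.

Lemma has_sum_ge0 f l : (forall x, 0 <= f x) -> has_sum f l -> 0 <= l.
Proof.
move=> f0 [fl]; apply: (closed_cvg _ (@closed_ge R 0)) fl.
by exists fset0 => // F _; apply: sumr_ge0.
Qed.

Lemma ler_sum_fset f (F G : {fset X}) : (forall x, 0 <= f x) -> (F `<=` G)%fset ->
  \sum_(x <- F) f x <= \sum_(x <- G) f x.
Proof.
move=> f0 FG; have e : perm_eq [seq x <- G | x \in F] F.
  apply: uniq_perm; rewrite ?filter_uniq ?fset_uniq // => x.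
  by rewrite mem_filter andb_idr // => /(fsubsetP FG).
by rewrite -(perm_big _ e) big_filter [leRHS](bigID (mem F)) /= lerDl sumr_ge0.
Qed.

Lemma has_sum_ge f l (F : {fset X}) :
  (forall x, 0 <= f x) -> has_sum f l -> \sum_(x <- F) f x <= l.
Proof.
move=> f0 [fl]; apply: (closed_cvg _ (@closed_ge R _)) fl.
by exists F => // G /= FG; apply: ler_sum_fset.
Qed.

Lemma has_sum_le f l (C : R) :
  (forall F : {fset X}, \sum_(x <- F) f x <= C) -> has_sum f l -> l <= C.
Proof.
move=> fC [fl]; apply: (closed_cvg _ (@closed_le R C)) fl.
by exists fset0 => // F _ /=.
Qed.

Lemma nonneg_has_sum f (C : R) : (forall x, 0 <= f x) ->
  (forall F : {fset X}, \sum_(x <- F) f x <= C) -> exists l, has_sum f l.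
Proof.
move=> f0 fC.
pose E := [set \sum_(x <- F) f x | F in [set: {fset X}]].
have supE : has_sup E.
  split; first by exists (\sum_(x <- fset0) f x), fset0.
  by exists C => _ [F _ <-].
exists (sup E); split; apply/(@cvgrPdist_le R R^o) => e e0.
have [_ [F _ <-] eF] := sup_adherent e0 supE.
exists F => // G /= FG.
have GE : \sum_(x <- G) f x <= sup E by apply: ub_le_sup; [case: supE|exists G].
rewrite ger0_norm ?subr_ge0 // lerBlDr -lerBlDl; apply: le_trans (ltW eF) _.
exact: ler_sum_fset.
Qed.

(** [f] is the difference of the nonnegative families [`|f| + f] and [`|f|]. *)
Lemma bounded_has_sum f (C : R) :
  (forall F : {fset X}, \sum_(x <- F) `|f x| <= C) -> exists l, has_sum f l.
Proof.
move=> fC.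
have [l hl] := @nonneg_has_sum (fun x => `|f x|) C (fun x => normr_ge0 _) fC.
have [|F|m hm] := @nonneg_has_sum (fun x => `|f x| + f x) (C *+ 2).
- by move=> x; rewrite -lerBlDl sub0r lerNl -normrN; apply: ler_norm.
- have fF : \sum_(x <- F) f x <= C.
    by apply: le_trans (fC F); apply: ler_sum => x _; apply: ler_norm.
  by rewrite big_split mulr2n /= lerD.
exists (m + (-1) * l); have := has_sumD hm (has_sumZ (-1) hl).
by under [X in has_sum X _]eq_fun do rewrite mulN1r addrAC subrr add0r.
Qed.

End HasSumReal.

Section Complex.
Variable R : realType.
Implicit Types x y : R[i].

Lemma normC_le_ReIm x : `|x| <= (`|complex.Re x| + `|complex.Im x|)%:C.
Proof.
have -> : `|x| = `|(complex.Re x)%:C + 'i%C * (complex.Im x)%:C| by rewrite -complexE.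
apply: le_trans (ler_normD _ _) _; rewrite normrM.
have -> : `|'i%C| = 1 :> R[i].
  by rewrite normc_def /= expr0n expr1n add0r sqrtr1.
by rewrite mul1r rmorphD /= !normc_def /= !expr0n !addr0 !sqrtr_sqr.
Qed.

Lemma normC_ge_Im x : `|complex.Im x|%:C <= `|x|.
Proof.
rewrite normc_def lecR -sqrtr_sqr ler_sqrt ?lerDr ?sqr_ge0 //.
by rewrite addr_ge0 ?sqr_ge0.
Qed.

Lemma cvg_complexP (T : Type) (F : set_system T) (FF : Filter F) (u : T -> R[i]) l :
  ((fun t => complex.Re (u t) : R^o) @ F --> (complex.Re l : R^o)) ->
  ((fun t => complex.Im (u t) : R^o) @ F --> (complex.Im l : R^o)) ->
  (u : T -> R[i]^o) @ F --> (l : R[i]^o).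
Proof.
move=> /(@cvgrPdist_lt R R^o) rl /(@cvgrPdist_lt R R^o) il.
apply/cvgrPdist_le => -[e e'] /=; rewrite ltcE /= => /andP[/eqP -> e0].
have e20 : 0 < e / 2 by rewrite divr_gt0.
apply: filterS2 (rl _ e20) (il _ e20) => t /= rt it.
apply: le_trans (normC_le_ReIm _) _.
rewrite raddfB /= -[e +i* 0]/(e%:C) lecR.
by rewrite raddfB [e]splitr lerD // ltW.
Qed.

Lemma cvg_Re (T : Type) (F : set_system T) (FF : Filter F) (u : T -> R[i]) l :
  (u : T -> R[i]^o) @ F --> (l : R[i]^o) ->
  ((fun t => complex.Re (u t) : R^o) @ F --> (complex.Re l : R^o)).
Proof.
move=> /cvgrPdist_le ul; apply/(@cvgrPdist_le R R^o) => e e0.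
have := ul e%:C; rewrite ltcR => /(_ e0); apply: filterS => t /= h.
by rewrite -lecR -raddfB; apply: le_trans (normc_ge_Re _) h.
Qed.

Lemma cvg_Im (T : Type) (F : set_system T) (FF : Filter F) (u : T -> R[i]) l :
  (u : T -> R[i]^o) @ F --> (l : R[i]^o) ->
  ((fun t => complex.Im (u t) : R^o) @ F --> (complex.Im l : R^o)).
Proof.
move=> /cvgrPdist_le ul; apply/(@cvgrPdist_le R R^o) => e e0.
have := ul e%:C; rewrite ltcR => /(_ e0); apply: filterS => t /= h.
by rewrite -lecR -raddfB; apply: le_trans (normC_ge_Im _) h.
Qed.

Lemma bounded_has_sumC (X : choiceType) (f : X -> R[i]) (C : R) :
  (forall F : {fset X}, \sum_(x <- F) `|f x| <= C%:C) -> exists l, has_sum f l.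
Proof.
move=> fC.
have [F|l [hl]] := @bounded_has_sum R X (fun a => complex.Re (f a)) C.
  rewrite -lecR; apply: le_trans (fC F); rewrite rmorph_sum /=.
  by apply: ler_sum => x _; apply: normc_ge_Re.
have [F|m [hm]] := @bounded_has_sum R X (fun a => complex.Im (f a)) C.
  rewrite -lecR; apply: le_trans (fC F); rewrite rmorph_sum /=.
  by apply: ler_sum => x _; apply: normC_ge_Im.
exists (l +i* m); split; apply: cvg_complexP => /=.
  by under eq_fun do rewrite raddf_sum.
by under eq_fun do rewrite raddf_sum.
Qed.

Lemma has_sum_real_complex (X : choiceType) (f : X -> R) (l : R) :
  has_sum f l -> has_sum (fun a => (f a)%:C) l%:C.
Proof.
move=> [fl]; split; apply: cvg_complexP => /=.
  by under eq_fun do rewrite -rmorph_sum /=.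
under eq_fun do rewrite -rmorph_sum /=.
apply: cvg_cst.
Qed.

Lemma has_sum_conj (X : choiceType) (f : X -> R[i]) (l : R[i]) :
  has_sum f l -> has_sum (fun a => (f a)^*) l^*.
Proof.
move=> [/(@cvgrPdist_le _ R[i]^o) fl]; split.
apply/(@cvgrPdist_le _ R[i]^o) => e /fl.
by apply: filterS => F; rewrite -rmorph_sum -rmorphB normcJ.
Qed.

Lemma has_sum_geC0 (X : choiceType) (f : X -> R[i]) (l : R[i]) :
  (forall a, 0 <= f a) -> has_sum f l -> 0 <= l.
Proof.
move=> f0 [fl].
have f0' a : complex.Im (f a) = 0 by apply: ger0_Im.
have reS : has_sum (fun a => complex.Re (f a)) (complex.Re l).
  split; under eq_fun do rewrite -raddf_sum.
  exact: (@cvg_Re _ _ totally_filter _ _ fl).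
have imS : has_sum (fun a => complex.Im (f a)) (complex.Im l).
  split; under eq_fun do rewrite -raddf_sum.
  exact: (@cvg_Im _ _ totally_filter _ _ fl).
have im0 : complex.Im l = 0.
  apply: has_sum_unique imS _.
  by rewrite (_ : (fun a => complex.Im (f a)) = fun=> 0); [apply: has_sum0|apply/funext].
rewrite lecE im0 eqxx /=; apply: has_sum_ge0 reS => a.
by have := f0 a; rewrite lecE => /andP[].
Qed.

End Complex.

(** * Square-summable families *)

Section SquareSummable.
Variables (R : realType) (X : choiceType).

Definition sqmod (z : R[i]) : R := complex.Re z ^+ 2 + complex.Im z ^+ 2.

Lemma sqmod_ge0 z : 0 <= sqmod z.
Proof. by rewrite addr_ge0 ?sqr_ge0. Qed.

Lemma sqmod_norm z : (sqmod z)%:C = `|z| ^+ 2.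
Proof. exact: add_Re2_Im2. Qed.

Lemma sqmodM z w : sqmod (z * w) = sqmod z * sqmod w.
Proof.
apply: complexI; rewrite sqmod_norm normrM exprMn -!sqmod_norm.
by rewrite -rmorphM.
Qed.

Lemma sqmodD_le z w : sqmod (z + w) <= 2 * sqmod z + 2 * sqmod w.
Proof.
case: z w => [a b] [c d]; rewrite /sqmod /=.
rewrite -subr_ge0; have -> : 2 * (a ^+ 2 + b ^+ 2) + 2 * (c ^+ 2 + d ^+ 2) -
  ((a + c) ^+ 2 + (b + d) ^+ 2) = (a - c) ^+ 2 + (b - d) ^+ 2 by ring.
by rewrite addr_ge0 ?sqr_ge0.
Qed.

(** Arithmetic-geometric mean inequality; the free weight [t] is optimised in [l2_dot_le]. *)
Lemma norm_conjM_le (t : R) (z w : R[i]) : 0 < t ->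
  `|z^* * w| <= ((t * sqmod z + t^-1 * sqmod w) / 2)%:C.
Proof.
move=> t0; rewrite normrM normcJ.
have ez : `|z| = (Num.sqrt (sqmod z))%:C by rewrite normc_def.
have ew : `|w| = (Num.sqrt (sqmod w))%:C by rewrite normc_def.
rewrite ez ew -rmorphM lecR.
have := sqmod_ge0 z; have := sqmod_ge0 w.
move: (sqmod z) (sqmod w) => a b b0 a0.
rewrite -{2}(sqr_sqrtr a0) -{2}(sqr_sqrtr b0).
move: (Num.sqrt a) (Num.sqrt b) => {ez ew a b a0 b0} a b.
rewrite -subr_ge0.
have -> : (t * a ^+ 2 + t^-1 * b ^+ 2) / 2 - a * b = t^-1 / 2 * (t * a - b) ^+ 2.
  by field; rewrite gt_eqF.
by rewrite mulr_ge0 ?sqr_ge0 // mulr_ge0 ?invr_ge0 ?ltW.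
Qed.

Definition square_summable (u : X -> R[i]) : Prop :=
  exists C : R, forall F : {fset X}, \sum_(x <- F) sqmod (u x) <= C.

Record l2 := L2 { l2_fun :> X -> R[i]; l2P : square_summable l2_fun }.

Lemma l2_eqP (u v : l2) : (forall x, u x = v x) -> u = v.
Proof.
case: u v => [u pu] [v pv] /= /funext uv; case: _ / uv pv => pv.
by congr L2; apply: Prop_irrelevance.
Qed.

HB.instance Definition _ := gen_eqMixin l2.
HB.instance Definition _ := gen_choiceMixin l2.

Lemma square_summable0 : square_summable (fun=> 0).
Proof.
exists 0 => F; rewrite big1 // => x _.
by rewrite /sqmod /= !expr0n addr0.
Qed.

Lemma square_summableD (u v : l2) : square_summable (fun x => u x + v x).
Proof.
have [[C uC] [D vD]] := (l2P u, l2P v); exists (2 * C + 2 * D) => F.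
apply: (@le_trans _ _ (\sum_(x <- F) (2 * sqmod (u x) + 2 * sqmod (v x)))).
  by apply: ler_sum => x _; apply: sqmodD_le.
rewrite big_split /= -!mulr_sumr.
by apply: lerD; apply: ler_wpM2l.
Qed.

Lemma square_summableZ (c : R[i]) (u : l2) : square_summable (fun x => c * u x).
Proof.
have [C uC] := l2P u; exists (sqmod c * C) => F.
under eq_bigr do rewrite sqmodM.
by rewrite -mulr_sumr; apply: ler_wpM2l => //; apply: sqmod_ge0.
Qed.

Definition l2_zero : l2 := L2 square_summable0.
Definition l2_add u v : l2 := L2 (square_summableD u v).
Definition l2_scale c u : l2 := L2 (square_summableZ c u).
Definition l2_opp u : l2 := l2_scale (-1) u.

Fact l2_addA : associative l2_add.
Proof. by move=> u v w; apply: l2_eqP => x /=; rewrite addrA. Qed.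
Fact l2_addC : commutative l2_add.
Proof. by move=> u v; apply: l2_eqP => x /=; rewrite addrC. Qed.
Fact l2_add0 : left_id l2_zero l2_add.
Proof. by move=> u; apply: l2_eqP => x /=; rewrite add0r. Qed.
Fact l2_addN : left_inverse l2_zero l2_opp l2_add.
Proof. by move=> u; apply: l2_eqP => x /=; rewrite mulN1r addNr. Qed.

HB.instance Definition _ := GRing.isZmodule.Build l2 l2_addA l2_addC l2_add0 l2_addN.

Fact l2_scaleA a b (u : l2) : l2_scale a (l2_scale b u) = l2_scale (a * b) u.
Proof. by apply: l2_eqP => x /=; rewrite mulrA. Qed.
Fact l2_scale1 : left_id 1 l2_scale.
Proof. by move=> u; apply: l2_eqP => x /=; rewrite mul1r. Qed.
Fact l2_scaleDr : right_distributive l2_scale +%R.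
Proof. by move=> a u v; apply: l2_eqP => x /=; rewrite mulrDr. Qed.
Fact l2_scaleDl (u : l2) : {morph l2_scale^~ u : a b / a + b}.
Proof. by move=> a b; apply: l2_eqP => x /=; rewrite mulrDl. Qed.

HB.instance Definition _ :=
  GRing.Zmodule_isLmodule.Build R[i] l2 l2_scaleA l2_scale1 l2_scaleDr l2_scaleDl.

Implicit Types u v w : l2.

Lemma l2_addE u v x : (u + v) x = u x + v x. Proof. by []. Qed.
Lemma l2_scaleE (c : R[i]) u x : (c *: u) x = c * u x. Proof. by []. Qed.
Lemma l2_oppE u x : (- u) x = - u x. Proof. by rewrite -mulN1r. Qed.
Lemma l2_subE u v x : (u - v) x = u x - v x. Proof. by rewrite l2_addE l2_oppE. Qed.
Lemma l2_0E x : (0 : l2) x = 0. Proof. by []. Qed.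

Lemma l2_dot_bound u v (t : R) : 0 < t -> exists C : R, forall F : {fset X},
  \sum_(x <- F) `|(u x)^* * v x| <= C%:C.
Proof.
move=> t0; have [[C uC] [D vD]] := (l2P u, l2P v).
exists ((t * C + t^-1 * D) / 2) => F.
apply: (@le_trans _ _ (\sum_(x <- F) ((t * sqmod (u x) + t^-1 * sqmod (v x)) / 2)%:C)).
  by apply: ler_sum => x _; apply: norm_conjM_le.
rewrite -rmorph_sum lecR /= -mulr_suml big_split /= -!mulr_sumr.
rewrite ler_wpM2r ?invr_ge0 //; apply: lerD; apply: ler_wpM2l => //.
  exact: ltW.
by rewrite invr_ge0 ltW.
Qed.

Lemma l2_dot_ex u v : exists l, has_sum (fun x => (u x)^* * v x) l.
Proof. by have [C /bounded_has_sumC] := l2_dot_bound u v ltr01. Qed.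

Definition l2_dot u v : R[i] := projT1 (cid (l2_dot_ex u v)).

Lemma l2_dotP u v : has_sum (fun x => (u x)^* * v x) (l2_dot u v).
Proof. by rewrite /l2_dot; case: cid. Qed.

Lemma l2_dot_unique u v l : has_sum (fun x => (u x)^* * v x) l -> l2_dot u v = l.
Proof. exact: has_sum_unique (l2_dotP u v). Qed.

Lemma l2_sqnorm_ex u : exists l, has_sum (fun x => sqmod (u x)) l.
Proof. by have [C uC] := l2P u; apply: nonneg_has_sum uC => x; apply: sqmod_ge0. Qed.

Definition l2_sqnorm u : R := projT1 (cid (l2_sqnorm_ex u)).

Lemma l2_sqnormP u : has_sum (fun x => sqmod (u x)) (l2_sqnorm u).
Proof. by rewrite /l2_sqnorm; case: cid. Qed.

Lemma l2_sqnorm_ge0 u : 0 <= l2_sqnorm u.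
Proof. by apply: has_sum_ge0 (l2_sqnormP u) => x; apply: sqmod_ge0. Qed.

Lemma l2_sqnorm_ge u (F : {fset X}) : \sum_(x <- F) sqmod (u x) <= l2_sqnorm u.
Proof. by apply: has_sum_ge (l2_sqnormP u) => x; apply: sqmod_ge0. Qed.

Lemma l2_sqnorm_le u (C : R) :
  (forall F : {fset X}, \sum_(x <- F) sqmod (u x) <= C) -> l2_sqnorm u <= C.
Proof. by move=> uC; apply: has_sum_le (l2_sqnormP u). Qed.

Definition l2_norm u : R := Num.sqrt (l2_sqnorm u).

Lemma l2_norm_ge0 u : 0 <= l2_norm u. Proof. exact: sqrtr_ge0. Qed.

Lemma sqr_l2_norm u : l2_norm u ^+ 2 = l2_sqnorm u.
Proof. by rewrite sqr_sqrtr // l2_sqnorm_ge0. Qed.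

Lemma l2_norm0_eq0 u : l2_norm u = 0 -> u = 0.
Proof.
move=> u0; apply: l2_eqP => x; rewrite l2_0E.
have := l2_sqnorm_ge u [fset x]%fset; rewrite big_seq_fset1 -sqr_l2_norm u0 expr0n /=.
move=> h; have : sqmod (u x) = 0 by apply/le_anti; rewrite h sqmod_ge0.
by move/(congr1 (real_complex R)); rewrite sqmod_norm => /eqP; rewrite sqrf_eq0 normr_eq0 => /eqP.
Qed.

Lemma l2_normZ (c : R[i]) u : l2_norm (c *: u) = Num.sqrt (sqmod c) * l2_norm u.
Proof.
rewrite /l2_norm -sqrtrM ?sqmod_ge0 //; congr Num.sqrt.
apply: has_sum_unique (l2_sqnormP _) _.
under eq_fun do rewrite l2_scaleE sqmodM.
exact: has_sumZ (l2_sqnormP u).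
Qed.

Lemma l2_dot_self u : l2_dot u u = (l2_sqnorm u)%:C.
Proof.
apply: l2_dot_unique.
have -> : (fun x => (u x)^* * u x) = (fun x => (sqmod (u x))%:C).
  by apply/funext => x; rewrite sqmod_norm sqr_normc mulrC.
exact: has_sum_real_complex (l2_sqnormP u).
Qed.

(** The termwise bound of [norm_conjM_le], at the weight [t] that balances both terms. *)
Lemma l2_dot_le u v : `|l2_dot u v| <= (l2_norm u * l2_norm v)%:C.
Proof.
have bound (t : R) : 0 < t ->
    `|l2_dot u v| <= ((t * l2_sqnorm u + t^-1 * l2_sqnorm v) / 2)%:C.
  move=> t0; apply: has_sum_norm_le (l2_dotP u v) => [|F].
    by apply/complex_realP; eexists.
  apply: (@le_trans _ _ (\sum_(x <- F) ((t * sqmod (u x) + t^-1 * sqmod (v x)) / 2)%:C)).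
    by apply: ler_sum => x _; apply: norm_conjM_le.
  rewrite -rmorph_sum lecR /= -mulr_suml big_split /= -!mulr_sumr.
  rewrite ler_wpM2r ?invr_ge0 //; apply: lerD; apply: ler_wpM2l => //;
    rewrite ?l2_sqnorm_ge ?invr_ge0 //; exact: ltW.
have [u0|u0] := eqVneq (l2_norm u) 0.
  rewrite u0 (l2_norm0_eq0 u0) mul0r.
  have -> : l2_dot 0 v = 0; last by rewrite normr0.
  apply: l2_dot_unique; under eq_fun do rewrite l2_0E rmorph0 mul0r.
  exact: has_sum0.
have [v0|v0] := eqVneq (l2_norm v) 0.
  rewrite v0 (l2_norm0_eq0 v0) mulr0.
  have -> : l2_dot u 0 = 0; last by rewrite normr0.
  apply: l2_dot_unique; under eq_fun do rewrite l2_0E mulr0.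
  exact: has_sum0.
have up : 0 < l2_norm u by rewrite lt_neqAle eq_sym u0 l2_norm_ge0.
have vp : 0 < l2_norm v by rewrite lt_neqAle eq_sym v0 l2_norm_ge0.
(* The weight for which both terms of the bound are equal. *)
have := bound (l2_norm v / l2_norm u) (divr_gt0 vp up).
rewrite -!sqr_l2_norm; set c := _ / 2; have -> // : c = l2_norm u * l2_norm v.
by rewrite /c; field; rewrite u0 v0.
Qed.

Lemma l2_dotC u v : l2_dot v u = (l2_dot u v)^*.
Proof.
apply: l2_dot_unique; have := has_sum_conj (l2_dotP u v).
by under [X in has_sum X _ -> _]eq_fun do rewrite rmorphM /= conjcK mulrC.
Qed.

Lemma l2_dotDr u v w : l2_dot u (v + w) = l2_dot u v + l2_dot u w.
Proof.
apply: l2_dot_unique; under eq_fun do rewrite l2_addE mulrDr.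
exact: has_sumD (l2_dotP u v) (l2_dotP u w).
Qed.

Lemma l2_dotZr u v (c : R[i]) : l2_dot u (c *: v) = c * l2_dot u v.
Proof.
apply: l2_dot_unique; under eq_fun do rewrite l2_scaleE mulrCA.
exact: has_sumZ (l2_dotP u v).
Qed.

Lemma l2_dotDl u v w : l2_dot (v + w) u = l2_dot v u + l2_dot w u.
Proof. by rewrite l2_dotC l2_dotDr rmorphD /= -!l2_dotC. Qed.

Lemma l2_dotZl u v (c : R[i]) : l2_dot (c *: v) u = c^* * l2_dot v u.
Proof. by rewrite l2_dotC l2_dotZr rmorphM /= -l2_dotC. Qed.

Lemma l2_dotBl u v w : l2_dot (v - w) u = l2_dot v u - l2_dot w u.
Proof. by rewrite -scaleN1r l2_dotDl l2_dotZl rmorphN rmorph1 mulN1r. Qed.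

Lemma l2_dotBr u v w : l2_dot u (v - w) = l2_dot u v - l2_dot u w.
Proof. by rewrite -scaleN1r l2_dotDr l2_dotZr mulN1r. Qed.

Lemma l2_normD u v : l2_norm (u + v) <= l2_norm u + l2_norm v.
Proof.
rewrite -(@ler_pXn2r _ 2) ?nnegrE ?l2_norm_ge0 ?addr_ge0 ?l2_norm_ge0 //.
rewrite -lecR sqr_l2_norm -l2_dot_self !(l2_dotDl, l2_dotDr) !l2_dot_self.
have uv : l2_dot u v + l2_dot v u <= ((l2_norm u * l2_norm v) *+ 2)%:C.
  rewrite (l2_dotC u v) addcJ -(rmorph_nat (real_complex R)) -rmorphM /= lecR.
  rewrite mulr_natl lerMn2r /= -lecR; apply: le_trans (l2_dot_le u v).
  apply: le_trans (normc_ge_Re _); rewrite lecR.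
  exact: ler_norm.
have -> : (l2_sqnorm u)%:C + l2_dot u v + (l2_dot v u + (l2_sqnorm v)%:C) =
    (l2_sqnorm u + l2_sqnorm v)%:C + (l2_dot u v + l2_dot v u).
  by rewrite rmorphD /=; ring.
rewrite sqrrD !sqr_l2_norm addrAC [X in _ <= X]rmorphD /=.
by rewrite lerD2l.
Qed.

Lemma l2_norm0 : l2_norm 0 = 0.
Proof. by rewrite -(scale0r (0 : l2)) l2_normZ /sqmod /= expr0n addr0 sqrtr0 mul0r. Qed.

Lemma l2_normN u : l2_norm (- u) = l2_norm u.
Proof.
by rewrite -scaleN1r l2_normZ /sqmod /= oppr0 expr0n addr0 sqrrN expr1n sqrtr1 mul1r.
Qed.

Lemma l2_normB u v : l2_norm (u - v) = l2_norm (v - u).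
Proof. by rewrite -l2_normN opprB. Qed.

Lemma l2_dot_inj u v : (forall w, l2_dot u w = l2_dot v w) -> u = v.
Proof.
move=> uv; apply/eqP; rewrite -subr_eq0; apply/eqP; apply: l2_norm0_eq0.
apply/eqP; rewrite -sqrf_eq0 sqr_l2_norm -(inj_eq (@complexI R)) -l2_dot_self.
by rewrite l2_dotBl uv subrr.
Qed.

Lemma l2_norm_coord u x : `|u x| <= (l2_norm u)%:C.
Proof.
rewrite -(@ler_pXn2r _ 2) ?nnegrE ?normr_ge0 ?ler0c ?l2_norm_ge0 //.
rewrite -sqmod_norm -rmorphXn lecR /= sqr_l2_norm.
by have := l2_sqnorm_ge u [fset x]%fset; rewrite big_seq_fset1.
Qed.

Lemma l2_norm_le u (C : R) : 0 <= C ->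
  (forall F : {fset X}, \sum_(x <- F) sqmod (u x) <= C ^+ 2) -> l2_norm u <= C.
Proof.
move=> C0 uC; rewrite -(@ler_pXn2r _ 2) ?nnegrE ?l2_norm_ge0 //.
by rewrite sqr_l2_norm; apply: l2_sqnorm_le.
Qed.

End SquareSummable.

(** * Bounded operators with an adjoint *)

(** A bounded operator is encoded by its underlying function together with the mere
  existence of an adjoint: linearity follows, and equality of operators is equality
  of functions. *)
Record l2_op (R : realType) (X : choiceType) := L2Op {
  op_fun :> l2 R X -> l2 R X;
  op_adj_ex : exists g, forall u v, l2_dot (op_fun u) v = l2_dot u (g v);
  op_bound_ex : exists2 C : R, 0 <= C & forall u, l2_norm (op_fun u) <= C * l2_norm u
}.

Section Operators.
Variables (R : realType) (X : choiceType).
Local Notation H := (l2 R X).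
Local Notation op := (l2_op R X).
Implicit Types (u v w : H) (a b c : op).

Lemma op_eqP a b : (forall u, a u = b u) -> a = b.
Proof.
case: a b => [f p q] [g p' q'] /= /funext fg; case: _ / fg p' q' => p' q'.
by congr L2Op; apply: Prop_irrelevance.
Qed.

Definition op_adj a : H -> H := projT1 (cid (op_adj_ex a)).

Lemma op_adjP a u v : l2_dot (a u) v = l2_dot u (op_adj a v).
Proof. by rewrite /op_adj; case: cid. Qed.

Lemma op_adjP' a u v : l2_dot (op_adj a u) v = l2_dot u (a v).
Proof. by rewrite l2_dotC -op_adjP -l2_dotC. Qed.

Lemma op_add a u v : a (u + v) = a u + a v.
Proof. by apply: l2_dot_inj => w; rewrite l2_dotDl !op_adjP l2_dotDl. Qed.

Lemma op_scale a (x : R[i]) u : a (x *: u) = x *: a u.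
Proof. by apply: l2_dot_inj => w; rewrite l2_dotZl !op_adjP l2_dotZl. Qed.

Lemma op_0 a : a 0 = 0.
Proof. by rewrite -(scale0r 0) op_scale !scale0r. Qed.

(** Cauchy-Schwarz for the square of the norm of [op_adj a u], which is the product of
  [u] and [a (op_adj a u)]. *)
Lemma op_adj_bound a (C : R) : 0 <= C -> (forall u, l2_norm (a u) <= C * l2_norm u) ->
  forall u, l2_norm (op_adj a u) <= C * l2_norm u.
Proof.
move=> C0 aC u; have [->|n0] := eqVneq (l2_norm (op_adj a u)) 0.
  by rewrite mulr_ge0 ?l2_norm_ge0.
have np : 0 < l2_norm (op_adj a u) by rewrite lt_neqAle eq_sym n0 l2_norm_ge0.
rewrite -(ler_pM2r np) -expr2 sqr_l2_norm -lecR -l2_dot_self op_adjP'.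
apply: le_trans (real_ler_norm _) _.
  by rewrite -op_adjP' l2_dot_self; apply/complex_realP; eexists.
apply: le_trans (l2_dot_le _ _) _; rewrite lecR mulrAC [leRHS]mulrC mulrA.
by rewrite -[leRHS]mulrA ler_wpM2l ?l2_norm_ge0.
Qed.

Lemma op_fun_adj_ex a : exists g, forall u v, l2_dot (op_adj a u) v = l2_dot u (g v).
Proof. by exists a => u v; apply: op_adjP'. Qed.

Lemma op_fun_adj_bd a :
  exists2 C : R, 0 <= C & forall u, l2_norm (op_adj a u) <= C * l2_norm u.
Proof. by have [C C0 aC] := op_bound_ex a; exists C => //; apply: op_adj_bound. Qed.

Definition op_star a : op := L2Op (op_fun_adj_ex a) (op_fun_adj_bd a).

Lemma op_starP a u v : l2_dot (op_star a u) v = l2_dot u (a v).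
Proof. exact: op_adjP'. Qed.

Lemma op_starP' a u v : l2_dot (a u) v = l2_dot u (op_star a v).
Proof. exact: op_adjP. Qed.

Lemma op_star_eq a b : (forall u v, l2_dot (a u) v = l2_dot u (b v)) -> op_star b = a.
Proof.
by move=> ab; apply: op_eqP => u; apply: l2_dot_inj => v; rewrite op_starP ab.
Qed.

Lemma op_starK : involutive op_star.
Proof. by move=> a; apply: op_star_eq => u v; rewrite op_starP'. Qed.

Lemma op_zero_adj : exists g : H -> H, forall u v : H, l2_dot (0 : H) v = l2_dot u (g v).
Proof.
exists (fun=> 0) => u v; transitivity (0 : R[i]).
  by rewrite -(scale0r (0 : H)) l2_dotZl rmorph0 mul0r.
by rewrite -(scale0r (0 : H)) l2_dotZr mul0r.
Qed.
Lemma op_zero_bd : exists2 C : R, 0 <= C & forall u, l2_norm (0 : H) <= C * l2_norm u.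
Proof. by exists 0 => // u; rewrite mul0r l2_norm0. Qed.
Definition op_zero : op := L2Op op_zero_adj op_zero_bd.

Lemma op_plus_adj a b : exists g, forall u v, l2_dot (a u + b u) v = l2_dot u (g v).
Proof.
by exists (fun v => op_adj a v + op_adj b v) => u v; rewrite l2_dotDl l2_dotDr !op_adjP.
Qed.
Lemma op_plus_bd a b :
  exists2 C : R, 0 <= C & forall u, l2_norm (a u + b u) <= C * l2_norm u.
Proof.
have [C C0 aC] := op_bound_ex a; have [D D0 bD] := op_bound_ex b.
exists (C + D) => [|u]; first exact: addr_ge0.
by apply: le_trans (l2_normD _ _) _; rewrite mulrDl lerD.
Qed.
Definition op_plus a b : op := L2Op (op_plus_adj a b) (op_plus_bd a b).

Lemma op_mulc_adj (x : R[i]) a : exists g, forall u v, l2_dot (x *: a u) v = l2_dot u (g v).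
Proof.
by exists (fun v => x^* *: op_adj a v) => u v; rewrite l2_dotZl l2_dotZr !op_adjP.
Qed.
Lemma op_mulc_bd (x : R[i]) a :
  exists2 C : R, 0 <= C & forall u, l2_norm (x *: a u) <= C * l2_norm u.
Proof.
have [C C0 aC] := op_bound_ex a.
exists (Num.sqrt (sqmod x) * C) => [|u]; first by rewrite mulr_ge0 ?sqrtr_ge0.
by rewrite l2_normZ -mulrA ler_wpM2l ?sqrtr_ge0.
Qed.
Definition op_mulc x a : op := L2Op (op_mulc_adj x a) (op_mulc_bd x a).

Lemma op_comp_adj a b : exists g, forall u v, l2_dot (a (b u)) v = l2_dot u (g v).
Proof. by exists (fun v => op_adj b (op_adj a v)) => u v; rewrite !op_adjP. Qed.
Lemma op_comp_bd a b : exists2 C : R, 0 <= C & forall u, l2_norm (a (b u)) <= C * l2_norm u.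
Proof.
have [C C0 aC] := op_bound_ex a; have [D D0 bD] := op_bound_ex b.
exists (C * D) => [|u]; first exact: mulr_ge0.
by apply: le_trans (aC _) _; rewrite -mulrA ler_wpM2l.
Qed.
Definition op_comp a b : op := L2Op (op_comp_adj a b) (op_comp_bd a b).

HB.instance Definition _ := gen_eqMixin op.
HB.instance Definition _ := gen_choiceMixin op.

Fact op_plusA : associative op_plus.
Proof. by move=> a b c; apply: op_eqP => u /=; rewrite addrA. Qed.
Fact op_plusC : commutative op_plus.
Proof. by move=> a b; apply: op_eqP => u /=; rewrite addrC. Qed.
Fact op_plus0 : left_id op_zero op_plus.
Proof. by move=> a; apply: op_eqP => u /=; rewrite add0r. Qed.
Fact op_plusN : left_inverse op_zero (op_mulc (-1)) op_plus.
Proof. by move=> a; apply: op_eqP => u /=; rewrite scaleN1r addNr. Qed.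

HB.instance Definition _ := GRing.isZmodule.Build op op_plusA op_plusC op_plus0 op_plusN.

Fact op_mulcA x y a : op_mulc x (op_mulc y a) = op_mulc (x * y) a.
Proof. by apply: op_eqP => u /=; rewrite scalerA. Qed.
Fact op_mulc1 : left_id 1 op_mulc.
Proof. by move=> a; apply: op_eqP => u /=; rewrite scale1r. Qed.
Fact op_mulcDr : right_distributive op_mulc +%R.
Proof. by move=> x a b; apply: op_eqP => u /=; rewrite scalerDr. Qed.
Fact op_mulcDl a : {morph op_mulc^~ a : x y / x + y}.
Proof. by move=> x y; apply: op_eqP => u /=; rewrite scalerDl. Qed.

HB.instance Definition _ :=
  GRing.Zmodule_isLmodule.Build R[i] op op_mulcA op_mulc1 op_mulcDr op_mulcDl.

Lemma op_addE a b u : (a + b) u = a u + b u. Proof. by []. Qed.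
Lemma op_scaleE (x : R[i]) a u : (x *: a) u = x *: a u. Proof. by []. Qed.
Lemma op_subE a b u : (a - b) u = a u - b u.
Proof. by rewrite op_addE; congr (_ + _); rewrite -scaleN1r op_scaleE scaleN1r. Qed.
Lemma op_0E u : (0 : op) u = 0. Proof. by []. Qed.

Definition op_bounds a : set R :=
  [set C | 0 <= C /\ forall u, l2_norm (a u) <= C * l2_norm u].

Definition op_norm a : R := inf (op_bounds a).

Lemma op_bounds_inf a : has_inf (op_bounds a).
Proof.
split; first by have [C C0 aC] := op_bound_ex a; exists C.
by exists 0 => C [].
Qed.

Lemma op_norm_ge0 a : 0 <= op_norm a.
Proof. by apply: lb_le_inf => [|C []]; case: (op_bounds_inf a). Qed.

Lemma op_normP a u : l2_norm (a u) <= op_norm a * l2_norm u.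
Proof.
have [u0|u0] := eqVneq (l2_norm u) 0.
  by have [C C0 /(_ u)] := op_bound_ex a; rewrite u0 !mulr0.
have up : 0 < l2_norm u by rewrite lt_neqAle eq_sym u0 l2_norm_ge0.
rewrite -ler_pdivrMr //; apply: lb_le_inf; first by case: (op_bounds_inf a).
by move=> C [C0 aC]; rewrite ler_pdivrMr.
Qed.

Lemma op_norm_le a (C : R) : 0 <= C -> (forall u, l2_norm (a u) <= C * l2_norm u) ->
  op_norm a <= C.
Proof. by move=> C0 aC; apply: ge_inf => //; case: (op_bounds_inf a). Qed.

Lemma op_normD a b : op_norm (a + b) <= op_norm a + op_norm b.
Proof.
apply: op_norm_le => [|u]; first by rewrite addr_ge0 ?op_norm_ge0.
rewrite op_addE mulrDl; apply: le_trans (l2_normD _ _) _.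
by apply: lerD; apply: op_normP.
Qed.

Lemma op_normZ_le (x : R[i]) a : op_norm (x *: a) <= Num.sqrt (sqmod x) * op_norm a.
Proof.
apply: op_norm_le => [|u]; first by rewrite mulr_ge0 ?sqrtr_ge0 ?op_norm_ge0.
by rewrite op_scaleE l2_normZ -mulrA ler_wpM2l ?sqrtr_ge0 ?op_normP.
Qed.

Lemma sqrt_sqmod (x : R[i]) : (Num.sqrt (sqmod x))%:C = `|x|.
Proof. by rewrite normc_def. Qed.

Lemma op_normZ (x : R[i]) a : op_norm (x *: a) = Num.sqrt (sqmod x) * op_norm a.
Proof.
apply/le_anti; rewrite op_normZ_le /=.
have [->|x0] := eqVneq x 0.
  by rewrite /sqmod /= expr0n addr0 sqrtr0 mul0r op_norm_ge0.
have xp : 0 < Num.sqrt (sqmod x) by rewrite -ltcR sqrt_sqmod normr_gt0.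
have := op_normZ_le x^-1 (x *: a); rewrite scalerA mulVf // scale1r.
have -> : Num.sqrt (sqmod x^-1) = (Num.sqrt (sqmod x))^-1.
  by apply: complexI; rewrite fmorphV /= !sqrt_sqmod normfV.
by rewrite ler_pdivlMl.
Qed.

Lemma op_norm_eq0 a : op_norm a = 0 -> a = 0.
Proof.
move=> a0; apply: op_eqP => u; apply: l2_norm0_eq0; apply/le_anti.
by rewrite l2_norm_ge0 andbT -(mul0r (l2_norm u)) -a0 op_normP.
Qed.

Fact op_normCD a b : (op_norm (a + b))%:C <= (op_norm a)%:C + (op_norm b)%:C.
Proof. by rewrite -rmorphD lecR op_normD. Qed.
Fact op_normCZ (x : R[i]) a : (op_norm (x *: a))%:C = `|x| * (op_norm a)%:C.
Proof. by rewrite op_normZ rmorphM /= sqrt_sqmod. Qed.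
Fact op_normC_eq0 a : (op_norm a)%:C = 0 -> a = 0.
Proof. by move=> /complexI; apply: op_norm_eq0. Qed.

HB.instance Definition _ :=
  Lmodule_isNormed.Build R[i] op op_normCD op_normCZ op_normC_eq0.

Lemma op_normE a : `|a| = (op_norm a)%:C. Proof. by []. Qed.

Lemma op_norm_star_le a : op_norm (op_star a) <= op_norm a.
Proof.
apply: op_norm_le (op_norm_ge0 a) _; apply: op_adj_bound; first exact: op_norm_ge0.
exact: op_normP.
Qed.

Lemma op_norm_star a : op_norm (op_star a) = op_norm a.
Proof.
by apply/le_anti; rewrite op_norm_star_le -{1}(op_starK a) op_norm_star_le.
Qed.

Lemma op_norm_comp a b : op_norm (op_comp a b) <= op_norm a * op_norm b.
Proof.
apply: op_norm_le => [|u]; first by rewrite mulr_ge0 ?op_norm_ge0.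
apply: le_trans (op_normP a (b u)) _; rewrite -mulrA ler_wpM2l ?op_norm_ge0 //.
exact: op_normP.
Qed.

(** The inequality that is not formal is Cauchy-Schwarz applied to the square of the norm
  of [a u], which is the product of [op_star a (a u)] and [u]. *)
Lemma op_norm_cstar a : op_norm (op_comp (op_star a) a) = op_norm a ^+ 2.
Proof.
apply/le_anti/andP; split.
  by apply: le_trans (op_norm_comp _ _) _; rewrite op_norm_star expr2.
set n := op_norm (op_comp _ _); have n0 : 0 <= n by apply: op_norm_ge0.
rewrite -(sqr_sqrtr n0) ler_pXn2r ?nnegrE ?op_norm_ge0 ?sqrtr_ge0 //.
apply: op_norm_le => [|u]; first exact: sqrtr_ge0.
rewrite -(@ler_pXn2r _ 2) ?nnegrE ?l2_norm_ge0 ?mulr_ge0 ?l2_norm_ge0 ?sqrtr_ge0 //.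
rewrite sqr_l2_norm exprMn [X in X * _]sqr_sqrtr // -lecR -l2_dot_self -op_starP.
apply: le_trans (real_ler_norm _) _.
  by rewrite op_starP l2_dot_self; apply/complex_realP; eexists.
apply: le_trans (l2_dot_le _ _) _; rewrite lecR expr2 mulrA.
by rewrite ler_wpM2r ?l2_norm_ge0 //; apply: (op_normP (op_comp (op_star a) a)).
Qed.

End Operators.

(** * Completeness of the algebra of operators *)

Section OperatorCompleteness.
Variables (R : realType) (X : choiceType).
Local Notation H := (l2 R X).
Local Notation op := (l2_op R X).
Implicit Types (u v w : H) (a b c : op).

Lemma cvg_sqmodB (T : Type) (F : set_system T) (FF : Filter F) (f : T -> R[i]) (l z : R[i]) :
  (f : T -> R[i]^o) @ F --> (l : R[i]^o) ->
  (fun t => sqmod (z - f t) : R^o) @ F --> (sqmod (z - l) : R^o).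
Proof.
move=> fl; have rl := cvg_Re FF fl; have il := cvg_Im FF fl.
rewrite /sqmod.
have -> : (fun t => complex.Re (z - f t) ^+ 2 + complex.Im (z - f t) ^+ 2 : R^o) =
   (fun t => (complex.Re z - complex.Re (f t)) * (complex.Re z - complex.Re (f t)) +
             (complex.Im z - complex.Im (f t)) * (complex.Im z - complex.Im (f t)) : R^o).
  by apply/funext => t; rewrite !raddfB !expr2.
rewrite !raddfB !expr2.
by apply: cvgD; apply: cvgM; apply: cvgB => //; apply: cvg_cst.
Qed.

Lemma complex_cauchy_cvg (T : Type) (F : set_system T) (FF : ProperFilter F) (f : T -> R[i]) :
  (forall e : R, 0 < e -> exists t, F [set t' | `|f t - f t'| <= e%:C]) ->
  exists l : R[i], (f : T -> R[i]^o) @ F --> (l : R[i]^o).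
Proof.
move=> fC.
have aux (g : R[i] -> R) : (forall x y, `|g x - g y|%:C <= `|x - y|) ->
    exists l : R, ((fun t => g (f t)) : T -> R^o) @ F --> (l : R^o).
  move=> gL; suff /cvg_ex[l gl] : cvg (((fun t => g (f t)) : T -> R^o) @ F) by exists l.
  apply: cauchy_cvg; apply: cauchy_exP => e e0.
  have e20 : 0 < e / 2 by rewrite divr_gt0.
  have [t Ft] := fC _ e20; exists (g (f t)).
  suff : F [set t' | ball (g (f t) : R^o) e (g (f t'))] by [].
  apply: filterS Ft => t' /= ft; rewrite /ball /=.
  rewrite -ltcR; apply: le_lt_trans (gL _ _) _; apply: le_lt_trans ft _.
  by rewrite ltcR ltr_pdivrMr // mulr2n mulrDr mulr1 ltrDl.
have [|r rP] := aux (@complex.Re R).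
  by move=> x y; rewrite -raddfB; apply: normc_ge_Re.
have [|i iP] := aux (@complex.Im R).
  by move=> x y; rewrite -raddfB; apply: normC_ge_Im.
by exists (r +i* i); apply: cvg_complexP.
Qed.

Section Limit.
Variables (F : set_system op) (FF : ProperFilter F).
Hypothesis F_cauchy : forall e : R, 0 < e -> exists b, F [set a | op_norm (b - a) <= e].

Lemma op_lim_ex : exists L : H -> X -> R[i],
  forall u x, ((fun a => a u x) : op -> R[i]^o) @ F --> (L u x : R[i]^o).
Proof.
suff h : forall u x, exists l : R[i],
    ((fun a => a u x) : op -> R[i]^o) @ F --> (l : R[i]^o).
  by exists (fun u x => projT1 (cid (h u x))) => u x; case: cid.
move=> u x; apply: complex_cauchy_cvg => e e0.
have n0 : 0 < l2_norm u + 1 by rewrite ltr_wpDl ?l2_norm_ge0.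
have [b Fb] := F_cauchy (divr_gt0 e0 n0); exists b.
apply: filterS Fb => a /= ba.
rewrite -l2_subE -op_subE; apply: le_trans (l2_norm_coord _ _) _; rewrite lecR.
apply: le_trans (op_normP _ _) _; apply: le_trans (ler_wpM2r (l2_norm_ge0 _) ba) _.
by rewrite mulrAC ler_pdivrMr // ler_pM2l // lerDl.
Qed.

Let L := projT1 (cid op_lim_ex).
Let LP : forall u x, ((fun a => a u x) : op -> R[i]^o) @ F --> (L u x : R[i]^o).
Proof. by rewrite /L; case: cid. Qed.

(** On finitely many coordinates the bound passes to the pointwise limit; the bound does not
  depend on the coordinates, so it holds for the full norm. *)
Lemma op_lim_dist (e : R) b : 0 <= e -> F [set a | op_norm (b - a) <= e] ->
  forall u (S : {fset X}), \sum_(x <- S) sqmod (b u x - L u x) <= (e * l2_norm u) ^+ 2.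
Proof.
move=> e0 Fb u S.
have h : (fun a => \sum_(x <- S) sqmod (b u x - a u x) : R^o) @ F -->
    (\sum_(x <- S) sqmod (b u x - L u x) : R^o).
  elim: (enum_fset S) => [|x s IH].
    rewrite big_nil; under eq_fun do rewrite big_nil.
    exact: cvg_cst.
  rewrite big_cons; under eq_fun do rewrite big_cons.
  by apply: (@cvgD R R^o) => //; apply: cvg_sqmodB; apply: LP.
apply: (closed_cvg _ (@closed_le R _)) h.
apply: filterS Fb => a /= ba.
have -> : \sum_(x <- S) sqmod (b u x - a u x) = \sum_(x <- S) sqmod (((b - a) u) x).
  by apply: eq_bigr => x _; rewrite op_subE l2_subE.
apply: le_trans (l2_sqnorm_ge _ _) _; rewrite -sqr_l2_norm.
rewrite ler_pXn2r ?nnegrE ?mulr_ge0 ?l2_norm_ge0 //.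
by apply: le_trans (op_normP _ _) _; rewrite ler_wpM2r ?l2_norm_ge0.
Qed.

Lemma op_lim_square_summable u : square_summable (L u).
Proof.
have [b Fb] := F_cauchy ltr01; have := op_lim_dist (b := b) ler01 Fb u => d.
have [C bC] := l2P (b u); exists (2 * C + 2 * (1 * l2_norm u) ^+ 2) => S.
apply: (@le_trans _ _ (\sum_(x <- S) (2 * sqmod (b u x) + 2 * sqmod (b u x - L u x)))).
  apply: ler_sum => x _.
  have -> : sqmod (L u x) = sqmod (b u x + (-1) * (b u x - L u x)).
    by congr sqmod; ring.
  apply: le_trans (sqmodD_le _ _) _; rewrite sqmodM.
  by rewrite {2}/sqmod /= oppr0 expr0n addr0 sqrrN expr1n mul1r.
rewrite big_split /= -!mulr_sumr.
by apply: lerD; apply: ler_wpM2l => //; apply: d.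
Qed.

Definition op_lim u : H := L2 (op_lim_square_summable u).

Lemma op_lim_close (e : R) b : 0 <= e -> F [set a | op_norm (b - a) <= e] ->
  forall u, l2_norm (b u - op_lim u) <= e * l2_norm u.
Proof.
move=> e0 Fb u; apply: l2_norm_le; first by rewrite mulr_ge0 ?l2_norm_ge0.
move=> S; have := op_lim_dist e0 Fb u S.
by under [X in _ -> X <= _]eq_bigr do rewrite l2_subE.
Qed.

End Limit.

(** Cauchy filters of operators converge pointwise; the pointwise limit of the adjoints is an
  adjoint of the limit, which is why the adjoint filter [G] is followed in parallel. *)
Lemma op_complete (F : set_system op) (FF : ProperFilter F) :
  (forall e : R, 0 < e -> exists b, F [set a | op_norm (b - a) <= e]) ->
  exists l : op, forall e : R, 0 < e -> F [set a | op_norm (l - a) <= e].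
Proof.
move=> Fc; pose G : set_system op := fmap (@op_star R X) F.
have GF : ProperFilter G by apply: fmap_proper_filter.
have starB a b : op_star (a - b) = op_star a - op_star b.
  apply: op_star_eq => u v; rewrite !op_subE l2_dotBl l2_dotBr.
  by rewrite !op_starP.
have Gc (e : R) : 0 < e -> exists b, G [set a | op_norm (b - a) <= e].
  move=> e0; have [b Fb] := Fc e e0; exists (op_star b).
  suff : F [set a | op_norm (op_star b - op_star a) <= e] by [].
  by apply: filterS Fb => a /= ba; rewrite -starB op_norm_star.
have adj : exists g, forall u v, l2_dot (op_lim FF Fc u) v = l2_dot u (g v).
  exists (op_lim GF Gc) => u v; apply/eqP; rewrite -subr_eq0 -normr_le0.
  have bd (e : R) : 0 < e ->
      `|l2_dot (op_lim FF Fc u) v - l2_dot u (op_lim GF Gc v)| <=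
      ((l2_norm u * l2_norm v *+ 2) * e)%:C.
    move=> e0; have [b Fb] := Fc e e0.
    have Gb : G [set a | op_norm (op_star b - a) <= e].
      suff : F [set a | op_norm (op_star b - op_star a) <= e] by [].
      by apply: filterS Fb => a /= ba; rewrite -starB op_norm_star.
    have h1 := op_lim_close FF Fc (ltW e0) Fb u.
    have h2 := op_lim_close GF Gc (ltW e0) Gb v.
    have -> : l2_dot (op_lim FF Fc u) v - l2_dot u (op_lim GF Gc v) =
        l2_dot u (op_star b v - op_lim GF Gc v) - l2_dot (b u - op_lim FF Fc u) v.
      by rewrite l2_dotBl l2_dotBr -op_starP'; ring.
    apply: le_trans (ler_normB _ _) _; rewrite mulr2n mulrDl rmorphD /=.
    apply: lerD; apply: le_trans (l2_dot_le _ _) _; rewrite lecR -mulrA.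
      by rewrite ler_wpM2l ?l2_norm_ge0 // mulrC.
    by rewrite [leRHS]mulrCA [leRHS]mulrC ler_wpM2r ?l2_norm_ge0 // mulrC.
  have [c0|c0] := eqVneq (l2_norm u * l2_norm v *+ 2) 0.
    by have := bd 1 ltr01; rewrite c0 mul0r.
  have cp : 0 < l2_norm u * l2_norm v *+ 2.
    by rewrite lt_neqAle eq_sym c0 mulrn_wge0 ?mulr_ge0 ?l2_norm_ge0.
  rewrite -[X in `|X|]addr0.
  have [d dE] : exists d : R, `|l2_dot (op_lim FF Fc u) v - l2_dot u (op_lim GF Gc v)| = d%:C.
    by rewrite normc_def; eexists.
  rewrite addr0 dE -[0]/((0 : R)%:C) lecR; apply/ler_addgt0Pr => e e0; rewrite add0r.
  have := bd (e / (l2_norm u * l2_norm v *+ 2)) (divr_gt0 e0 cp).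
  by rewrite dE lecR mulrCA divff // mulr1.
have bd : exists2 C : R, 0 <= C & forall u, l2_norm (op_lim FF Fc u) <= C * l2_norm u.
  have [b Fb] := Fc 1 ltr01; exists (op_norm b + 1) => [|u].
    by rewrite addr_ge0 ?op_norm_ge0.
  have := op_lim_close FF Fc ler01 Fb u; rewrite l2_normB => h.
  have -> : op_lim FF Fc u = b u + (op_lim FF Fc u - b u) by rewrite addrC subrK.
  by apply: le_trans (l2_normD _ _) _; rewrite mulrDl lerD ?op_normP.
exists (L2Op adj bd) => e e0.
have [b Fb] := Fc (e / 2) (divr_gt0 e0 (ltr0Sn _ _)).
apply: filterS (Fb) => a /= ba.
rewrite -(subrKA b) [e]splitr; apply: le_trans (op_normD _ _) _; apply: lerD => //.
apply: op_norm_le; first by rewrite divr_ge0 ?ltW.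
move=> u; rewrite op_subE l2_normB; apply: op_lim_close Fb u.
by rewrite divr_ge0 ?ltW.
Qed.

Fact l2_op_cauchy_cvg (F : set_system op) : ProperFilter F -> cauchy F -> cvg F.
Proof.
move=> FF /cauchyP Fc.
have [e e0|l lF] := op_complete FF.
  have [b Fb] := Fc e%:C ltac:(by rewrite ltcR); exists b.
  by apply: filterS Fb => a; rewrite -ball_normE /= op_normE ltcR => /ltW.
apply/cvg_ex; exists l; apply/cvgrPdist_le => -[e e'] /=.
rewrite ltcE /= => /andP[/eqP -> e0].
by apply: filterS (lF e e0) => a /= h; rewrite op_normE -[_ +i* 0]/(e%:C) lecR.
Qed.

HB.instance Definition _ := Uniform_isComplete.Build op l2_op_cauchy_cvg.

Fact op_compA a b c : op_comp a (op_comp b c) = op_comp (op_comp a b) c.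
Proof. exact: op_eqP. Qed.
Fact op_compDl a b c : op_comp (a + b) c = op_comp a c + op_comp b c.
Proof. exact: op_eqP. Qed.
Fact op_compDr a b c : op_comp a (b + c) = op_comp a b + op_comp a c.
Proof. by apply: op_eqP => u; rewrite op_addE /= op_add. Qed.
Fact op_compZl (x : R[i]) a b : op_comp (x *: a) b = x *: op_comp a b.
Proof. exact: op_eqP. Qed.
Fact op_compZr (x : R[i]) a b : op_comp a (x *: b) = x *: op_comp a b.
Proof. by apply: op_eqP => u; rewrite op_scaleE /= op_scale. Qed.
Fact op_starD a b : op_star (a + b) = op_star a + op_star b.
Proof.
by apply: op_star_eq => u v; rewrite !op_addE l2_dotDl l2_dotDr !op_starP.
Qed.
Fact op_starZ (x : R[i]) a : op_star (x *: a) = x^* *: op_star a.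
Proof.
apply: op_star_eq => u v; rewrite !op_scaleE l2_dotZl l2_dotZr op_starP.
by rewrite conjCK.
Qed.
Fact op_starM a b : op_star (op_comp a b) = op_comp (op_star b) (op_star a).
Proof. by apply: op_star_eq => u v /=; rewrite !op_starP. Qed.
Fact op_norm_cmul a b : `|op_comp a b| <= `|a| * `|b|.
Proof. by rewrite !op_normE -rmorphM lecR op_norm_comp. Qed.
Fact op_norm_cstarC a : `|op_comp (op_star a) a| = `|a| ^+ 2.
Proof. by rewrite !op_normE -rmorphXn op_norm_cstar. Qed.

HB.instance Definition _ := isCStarAlgebra.Build R op op_compA op_compDl op_compDr
  op_compZl op_compZr op_starD op_starZ op_starM (@op_starK R X) op_norm_cmul
  op_norm_cstarC.

End OperatorCompleteness.


(** * Factorisation in a k-graph *)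

Section KGraphLemmas.
Variables (k : nat) (L : kgraph k).
Local Notation V := (kg_vtx L).
Local Notation M := (kg_mor L).
Implicit Types (l m x y mu nu : M) (v w : V) (n p : {ffun 'I_k -> nat}).

Lemma degD n p i : (n + p) i = (n i + p i)%N.
Proof. by rewrite ffunE. Qed.

Lemma deg_addI n p p' : n + p = n + p' -> p = p'.
Proof. by move=> /ffunP e; apply/ffunP => i; have := e i; rewrite !degD => /addnI. Qed.

(** The right factors then have equal degrees too, so both pairs are the factorisation of
  the common composite. *)
Lemma kg_fact_uniq l m l' m' : kg_src l = kg_rng m -> kg_src l' = kg_rng m' ->
  kg_cmp l m = kg_cmp l' m' -> kg_deg l = kg_deg l' -> l = l' /\ m = m'.
Proof.
move=> lm lm' e d.
have d' : kg_deg m = kg_deg m'.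
  by have := congr1 (@kg_deg k L) e; rewrite !kg_deg_cmp // d => /deg_addI.
have [[a b] [_ ab]] := kg_fact (kg_deg_cmp lm).
have e1 : (a, b) = (l, m) by apply: ab.
have e2 : (a, b) = (l', m') by apply: ab.
by move: e2; rewrite e1 => -[].
Qed.

Lemma kg_cmpI l m m' : kg_src l = kg_rng m -> kg_src l = kg_rng m' ->
  kg_cmp l m = kg_cmp l m' -> m = m'.
Proof. by move=> lm lm' e; have [] := kg_fact_uniq lm lm' e erefl. Qed.

(** Compare the factorisations of [l] through the identities at its two ends. *)
Lemma kg_deg0 l : kg_deg l = 0 -> l = kg_id L (kg_rng l).
Proof.
move=> l0; have [] // := @kg_fact_uniq l (kg_id L (kg_src l)) (kg_id L (kg_rng l)) l.
- by rewrite kg_rng_id.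
- by rewrite kg_src_id.
- by rewrite kg_cmp_idl kg_cmp_idr.
- by rewrite l0 kg_deg_id.
Qed.

Lemma kg_deg_neq0 l : l <> kg_id L (kg_rng l) -> exists i, (0 < kg_deg l i)%N.
Proof.
move=> ln; apply: contrapT => h; apply: ln; apply: kg_deg0.
apply/ffunP => i; rewrite ffunE; apply/eqP; rewrite -leqn0 leqNgt.
by apply/negP => li; apply: h; exists i.
Qed.

Lemma kg_split l n : (forall i, (n i <= kg_deg l i)%N) ->
  exists x y, [/\ kg_deg x = n, kg_src x = kg_rng y & l = kg_cmp x y].
Proof.
move=> nl; have dE : kg_deg l = n + [ffun i => kg_deg l i - n i]%N.
  by apply/ffunP => i; rewrite degD ffunE subnKC.
by have [[x y] [[/= dx _ xy lE] _]] := kg_fact dE; exists x, y.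
Qed.

Lemma kg_split_unit l i : (0 < kg_deg l i)%N ->
  exists x y, [/\ kg_deg x = kg_unit i, kg_src x = kg_rng y & l = kg_cmp x y].
Proof.
move=> li; apply: kg_split => j; rewrite ffunE.
by case: eqP => [->|].
Qed.

Lemma kg_lexx v : kg_le v v.
Proof. by exists (kg_id L v); rewrite kg_rng_id kg_src_id. Qed.

Lemma kg_le_trans v w u : kg_le v w -> kg_le w u -> kg_le v u.
Proof.
move=> [l [<- lw]] [m [mw <-]]; exists (kg_cmp l m).
by rewrite kg_rng_cmp ?kg_src_cmp // mw.
Qed.

(** The partial inverse of [kg_ext]. Encoding extension and division of paths as mutually
  inverse partial maps makes the path-space operators instances of [pbij_op]. *)
Definition kg_div mu y : option M :=
  if pselect (exists l, kg_src mu = kg_rng l /\ y = kg_cmp mu l) is left h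
  then Some (projT1 (cid h)) else None.

Lemma kg_divP mu y l :
  kg_div mu y = Some l <-> kg_src mu = kg_rng l /\ y = kg_cmp mu l.
Proof.
rewrite /kg_div; case: pselect => [h|h]; last by split => // hl; case: h; exists l.
case: cid => m [/= sm ym]; split => [[<-]//|[sl yl]].
by congr Some; apply: (@kg_cmpI mu); rewrite -?ym.
Qed.

Lemma kg_div_cmp mu l : kg_src mu = kg_rng l -> kg_div mu (kg_cmp mu l) = Some l.
Proof. by move=> ml; apply/kg_divP. Qed.

Definition kg_ext mu l : option M :=
  if kg_src mu == kg_rng l then Some (kg_cmp mu l) else None.

Lemma kg_extP mu l y : kg_ext mu l = Some y <-> kg_div mu y = Some l.
Proof.
rewrite kg_divP /kg_ext; case: eqP => [ml|ml]; last by split => // -[].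
by split => [[<-]//|[_ ->]].
Qed.

Lemma kg_div_id v y : kg_div (kg_id L v) y = if kg_rng y == v then Some y else None.
Proof.
case: eqP => [<-|yv].
  by apply/kg_divP; rewrite kg_src_id kg_cmp_idl.
case E: kg_div => [l|//]; move/kg_divP: E; rewrite kg_src_id => -[vl yl].
by case: yv; rewrite yl vl kg_cmp_idl.
Qed.

Lemma kg_ext_id v y : kg_ext (kg_id L v) y = if kg_rng y == v then Some y else None.
Proof.
by rewrite /kg_ext kg_src_id eq_sym; case: eqP => // <-; rewrite kg_cmp_idl.
Qed.

Lemma kg_div_mul l m y : kg_src l = kg_rng m ->
  kg_div (kg_cmp l m) y = obind (kg_div m) (kg_div l y).
Proof.
move=> lm; case E: (kg_div l y) => [a|] /=.
  have /kg_divP[la ->] := E.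
  case E': (kg_div m a) => [b|].
    have /kg_divP[mb ->] := E'.
    by rewrite kg_cmpA // kg_div_cmp // kg_src_cmp.
  case E2 : kg_div => [b|//]; move/kg_divP: E2; rewrite kg_src_cmp // => -[mb].
  rewrite -kg_cmpA // => /kg_cmpI; rewrite kg_rng_cmp // => /(_ la lm) am.
  by move: E'; rewrite am kg_div_cmp.
case E2 : kg_div => [b|//]; move/kg_divP: E2; rewrite kg_src_cmp // => -[mb].
rewrite -kg_cmpA // => ye; move: E; rewrite ye kg_div_cmp // kg_rng_cmp //.
Qed.

(** Cut the common extension at the join of the two degrees. *)
Lemma kg_min_factor mu nu x y : kg_src mu = kg_rng x -> kg_src nu = kg_rng y ->
  kg_cmp mu x = kg_cmp nu y -> exists ez (w : M), [/\ kg_min mu nu ez,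
    kg_src ez.1 = kg_rng w, kg_src ez.2 = kg_rng w,
    x = kg_cmp ez.1 w & y = kg_cmp ez.2 w].
Proof.
move=> mux nuy e; pose n := kg_join (kg_deg mu) (kg_deg nu).
have nle i : (n i <= kg_deg (kg_cmp mu x) i)%N.
  by rewrite ffunE geq_max {2}e !kg_deg_cmp // !degD !leq_addr.
have [a [w [da aw we]]] := kg_split nle.
have aux m c : kg_src m = kg_rng c -> kg_cmp mu x = kg_cmp m c ->
    (forall i, (kg_deg m i <= kg_deg a i)%N) ->
    exists b, [/\ kg_src m = kg_rng b, a = kg_cmp m b, kg_src b = kg_rng w & c = kg_cmp b w].
  move=> mc ec ma; have [m' [b [dm' mb ae]]] := kg_split ma.
  have bw : kg_src b = kg_rng w by rewrite -aw ae kg_src_cmp.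
  have [] // := @kg_fact_uniq m c m' (kg_cmp b w); rewrite ?kg_rng_cmp //.
    by rewrite -ec we ae kg_cmpA.
  by move=> mm' cb; subst m'; exists b.
have [|eta [ma ae ew xe]] := aux _ _ mux erefl.
  by move=> i; rewrite da ffunE leq_maxl.
have [|zeta [na ae' zw ye]] := aux _ _ nuy e.
  by move=> i; rewrite da ffunE leq_maxr.
exists (eta, zeta), w; split => //=; split => //=.
- by rewrite -(kg_rng_cmp mux) e kg_rng_cmp.
- by rewrite -ae.
- by rewrite -ae.
Qed.

Lemma kg_min_deg1 mu nu ez i : kg_min mu nu ez ->
  kg_deg ez.1 i = (kg_join (kg_deg mu) (kg_deg nu) i - kg_deg mu i)%N.
Proof. by move=> [_ sm _ _ <-]; rewrite kg_deg_cmp // degD addKn. Qed.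

Lemma kg_min_deg2 mu nu ez i : kg_min mu nu ez ->
  kg_deg ez.2 i = (kg_join (kg_deg mu) (kg_deg nu) i - kg_deg nu i)%N.
Proof. by move=> [_ _ sn e <-]; rewrite e kg_deg_cmp // degD addKn. Qed.

Lemma kg_min_uniq mu nu ez ez' (w w' : M) : kg_min mu nu ez -> kg_min mu nu ez' ->
  kg_src ez.1 = kg_rng w -> kg_src ez'.1 = kg_rng w' ->
  kg_cmp ez.1 w = kg_cmp ez'.1 w' -> ez = ez'.
Proof.
move=> h h' ew ew' e; have [|e1 _] := kg_fact_uniq ew ew' e.
  by apply/ffunP => i; rewrite (kg_min_deg1 i h) (kg_min_deg1 i h').
case: ez ez' h h' e1 {ew ew' e} => [a b] [a' b'] h h' /= aa'; congr pair => //.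
have [/= _ _ nb abE _] := h; have [/= _ _ nb' abE' _] := h'.
by apply: (kg_cmpI nb nb'); rewrite -abE -abE' aa'.
Qed.

Lemma kg_min_finite mu nu : kg_finite L -> finite_set (kg_min mu nu).
Proof.
move=> fin; pose n := kg_join (kg_deg mu) (kg_deg nu).
pose d (m : M) := [ffun i => (n i - kg_deg m i)%N] : {ffun 'I_k -> nat}.
apply: (@sub_finite_set _ _ ([set l | kg_deg l = d mu] `*` [set l | kg_deg l = d nu])).
  move=> [a b] [/= rr sa sb ab dj].
  have aux (m c : M) : kg_src m = kg_rng c -> kg_deg (kg_cmp m c) = n -> kg_deg c = d m.
    move=> mc; rewrite kg_deg_cmp // => e; apply/ffunP => i.
    by rewrite ffunE -e degD addKn.
  by split => /=; apply: aux => //; rewrite -ab.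
by apply: finite_setX; apply: fin.
Qed.

Lemma kg_paths_from_finite v n : kg_finite L -> finite_set (@kg_paths_from k L v n).
Proof. by move=> fin; apply: sub_finite_set (fin n) => l []. Qed.

End KGraphLemmas.

(** * The path-space representation *)

Section PartialBijectionOperators.
Variables (R : realType) (X : choiceType).

Lemma l2_sqnorm_ge_seq (u : l2 R X) (s : seq X) : uniq s ->
  \sum_(x <- s) sqmod (u x) <= l2_sqnorm u.
Proof.
move=> us; rewrite (perm_big (enum_fset [fset x in s]%fset)) ?l2_sqnorm_ge //=.
by apply: uniq_perm => // x; rewrite !inE.
Qed.

Section Construction.
Variables (p p' : X -> option X).
Hypothesis pp' : forall x y, p x = Some y <-> p' y = Some x.

Let sum_le (u : l2 R X) (F : {fset X}) :
  \sum_(y <- F) sqmod (oapp u 0 (p' y)) <= l2_sqnorm u.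
Proof.
have -> : \sum_(y <- F) sqmod (oapp u 0 (p' y)) = \sum_(x <- pmap p' F) sqmod (u x).
  rewrite big_pmap; apply: eq_bigr => y _; case: (p' y) => //=.
  by rewrite /sqmod /= expr0n addr0.
by apply: l2_sqnorm_ge_seq; exact: pmap_pbij_uniq (fun x y => iff_sym (pp' y x)) (fset_uniq F).
Qed.

Lemma pbij_square_summable (u : l2 R X) : square_summable (fun y => oapp u 0 (p' y)).
Proof. by exists (l2_sqnorm u). Qed.

Definition pbij_fun (u : l2 R X) : l2 R X := L2 (pbij_square_summable u).

Lemma pbij_bound :
  exists2 C : R, 0 <= C & forall u, l2_norm (pbij_fun u) <= C * l2_norm u.
Proof.
exists 1 => // u; rewrite mul1r; apply: l2_norm_le (l2_norm_ge0 _) _ => F.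
by rewrite sqr_l2_norm; apply: sum_le.
Qed.

End Construction.

Section Adjoint.
Variables (p p' : X -> option X).
Hypothesis pp' : forall x y, p x = Some y <-> p' y = Some x.
Let p'p x y : p' x = Some y <-> p y = Some x. Proof. by rewrite pp'. Qed.

Lemma pbij_dot u v : l2_dot (pbij_fun pp' u) v = l2_dot u (pbij_fun p'p v).
Proof.
apply: l2_dot_unique.
have := l2_dotP u (pbij_fun p'p v).
have -> : (fun x => (u x)^* * pbij_fun p'p v x) =
    (fun x => oapp (fun y => (u x)^* * v y) 0 (p x)).
  by apply/funext => x /=; case: (p x) => //=; rewrite mulr0.
move=> /(has_sum_reindex pp').
congr (has_sum _ _); apply/funext => y /=.
by case: (p' y) => //=; rewrite rmorph0 mul0r.
Qed.

Lemma pbij_adj_ex : exists g, forall u v, l2_dot (pbij_fun pp' u) v = l2_dot u (g v).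
Proof. by exists (pbij_fun p'p) => u v; apply: pbij_dot. Qed.

(** The partial isometry that moves the basis vector at [x] to the one at [p x]. *)
Definition pbij_op : l2_op R X := L2Op pbij_adj_ex (pbij_bound pp').

Lemma pbij_starE u x : star pbij_op u x = oapp u 0 (p x).
Proof.
suff -> : star pbij_op u = pbij_fun p'p u by [].
apply: l2_dot_inj => w; rewrite [LHS](op_starP pbij_op) l2_dotC.
by rewrite pbij_dot -l2_dotC.
Qed.

End Adjoint.

Lemma l2_op_eqP (a b : l2_op R X) : (forall u x, a u x = b u x) -> a = b.
Proof. by move=> ab; apply: op_eqP => u; apply: l2_eqP => x. Qed.

Lemma l2_op_mulE (a b : l2_op R X) u : (a ** b) u = a (b u).
Proof. by []. Qed.

Lemma l2_op_sumE (I : Type) (s : seq I) (P : pred I) (F : I -> l2_op R X) u x :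
  (\sum_(i <- s | P i) F i) u x = \sum_(i <- s | P i) F i u x.
Proof. by apply: (big_morph (fun a : l2_op R X => a u x)). Qed.

End PartialBijectionOperators.

Section PathRepresentation.
Variables (R : realType) (k : nat) (L : kgraph k).
Local Notation M := (kg_mor L).
Hypothesis L_finite : kg_finite L.

(** The representation on the Hilbert space of all paths, in which [l] acts by prolongation
  on the left. Its only use is to show that the gap projections of the universal algebra
  do not vanish and carry positive functionals. *)
Definition path_rep (l : M) : l2_op R M := pbij_op R (@kg_extP k L l).

Lemma path_repE l u y : path_rep l u y = oapp u 0 (kg_div l y). Proof. by []. Qed.

Lemma path_rep_starE l u x : star (path_rep l) u x = oapp u 0 (kg_ext l x).
Proof. exact: pbij_starE. Qed.

Lemma path_rep_idE v u y : path_rep (kg_id L v) u y = if kg_rng y == v then u y else 0.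
Proof. by rewrite path_repE kg_div_id; case: eqP. Qed.

Lemma path_rep_rangeE l u y :
  (path_rep l ** star (path_rep l)) u y = if kg_div l y then u y else 0.
Proof.
rewrite l2_op_mulE path_repE; case E: kg_div => [x|] //=.
by rewrite path_rep_starE; move/kg_extP: E => ->.
Qed.

(** The difference is the projection onto the paths from [v] that do not reach degree [n];
  as a projection it is its own square root. *)
Lemma path_rep_gap v n :
  cle (\sum_(l \in kg_paths_from v n) (path_rep l ** star (path_rep l)))
      (path_rep (kg_id L v)).
Proof.
rewrite fsbig_finite /=; last exact: kg_paths_from_finite.
set S := fset_set _.
have SP l : l \in S -> kg_rng l = v /\ kg_deg l = n.
  by rewrite in_fset_set ?inE //; apply: kg_paths_from_finite.
(* [P y]: the path [y] starts at [v] and has no initial segment of degree [n]. *)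
pose P y := (kg_rng y == v) && ~~ has (fun l => isSome (kg_div l y)) S.
pose p y := if P y then Some y else None.
have pp x y : p x = Some y <-> p y = Some x.
  by rewrite /p; split; case: ifP => // Px [e]; move: Px; rewrite e => ->.
exists (pbij_op R pp); apply: l2_op_eqP => u y.
rewrite op_subE l2_subE path_rep_idE l2_op_sumE l2_op_mulE pbij_starE.
under eq_bigr do rewrite path_rep_rangeE.
have -> : oapp (pbij_op R pp u) 0 (p y) = if P y then u y else 0.
  by rewrite /p; case Py: (P y) => //=; rewrite /p Py.
rewrite /P; case: hasP => [[l lS ly]|h] /=.
  rewrite andbF (big_one_term (i0 := l)) ?fset_uniq // => [|m mS ml].
    have [rl dl] := SP _ lS; move: ly; case E: kg_div => [x|//] _.
    by have /kg_divP[lx ->] := E; rewrite kg_rng_cmp // rl eqxx subrr.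
  case E: (kg_div m y) => [x'|//]; move: ly; case E': kg_div => [x|//] _.
  case/negP: ml; apply/eqP; move/kg_divP: E => [mx' ye]; move/kg_divP: E' => [lx ye'].
  by have [] // := kg_fact_uniq mx' lx; rewrite -?ye // (SP _ lS).2 (SP _ mS).2.
rewrite andbT big_seq big1 ?subr0 // => l lS; case E: kg_div => //.
by case: h; exists l => //; rewrite E.
Qed.

(** Both sides send [u] to the function [x |-> u y] where [y] is the path with
  [mu x = nu y], if it exists; by [kg_min_factor] exactly one summand sees it. *)
Lemma path_rep_min mu nu : star (path_rep mu) ** path_rep nu =
  \sum_(ez \in kg_min mu nu) (path_rep ez.1 ** star (path_rep ez.2)).
Proof.
rewrite fsbig_finite /=; last exact: kg_min_finite.
set S := fset_set _.
have SP ez : (ez \in S) = (ez \in kg_min mu nu).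
  by rewrite in_fset_set //; apply: kg_min_finite.
apply: l2_op_eqP => u x; rewrite l2_op_mulE l2_op_sumE path_rep_starE.
have termE ez : (path_rep ez.1 ** star (path_rep ez.2)) u x =
    oapp u 0 (obind (kg_ext ez.2) (kg_div ez.1 x)).
  rewrite l2_op_mulE path_repE; case: kg_div => [w|] //=.
  by rewrite path_rep_starE.
under eq_bigr do rewrite termE.
pose g := obind (kg_div nu) (kg_ext mu x).
have -> : oapp (path_rep nu u) 0 (kg_ext mu x) = oapp u 0 g.
  by rewrite /g; case: kg_ext.
have gP ez : ez \in S -> obind (kg_ext ez.2) (kg_div ez.1 x) <> None ->
    obind (kg_ext ez.2) (kg_div ez.1 x) = g.
  rewrite SP inE => -[rr me nz e _]; rewrite /g.
  case E: (kg_div ez.1 x) => [w|//] /=; have /kg_divP[ew ->] := E.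
  rewrite /kg_ext; case: eqP => // zw _.
  rewrite kg_rng_cmp // me eqxx /= kg_cmpA // e -kg_cmpA // kg_div_cmp //.
  by rewrite kg_rng_cmp.
case gE: g => [y|] /=; last first.
  rewrite big_seq big1 // => ez ezS.
  case E: obind => [y|//].
  have := gP ez ezS; rewrite E gE => h.
  by have /h : Some y <> None by [].
have [mux muxy] : kg_src mu = kg_rng x /\ kg_div nu (kg_cmp mu x) = Some y.
  by move: gE; rewrite /g /kg_ext; case: eqP.
have /kg_divP[nuy e] := muxy.
have [ez [w [ezm ew zw xe ye]]] := kg_min_factor mux nuy e.
have ezS : ez \in S by rewrite SP inE.
have ezE : obind (kg_ext ez.2) (kg_div ez.1 x) = Some y.
  by rewrite xe kg_div_cmp //= /kg_ext zw eqxx ye.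
rewrite (big_one_term (i0 := ez)) ?fset_uniq // ?ezE // => ez' ez'S ne.
case E: (kg_div ez'.1 x) => [w'|//] /=.
case/eqP: ne; move/kg_divP: E => [ew' xe'].
by apply: (kg_min_uniq _ ezm ew' ew); rewrite -?xe' -?xe //; move: ez'S; rewrite SP inE.
Qed.

Lemma path_rep_toeplitz : toeplitz_family path_rep.
Proof.
split; last exact: path_rep_min; last exact: path_rep_gap.
- split.
    move=> l; apply: l2_op_eqP => u y; rewrite -cmulA l2_op_mulE !path_repE.
    case E: (kg_div l y) => [x|//].
    rewrite -[LHS]/(star (path_rep l) (path_rep l u) x) path_rep_starE.
    by have /kg_extP -> := E; rewrite /= E.
  split => [v|v w vw].
    split; apply: l2_op_eqP => u y.
      rewrite path_rep_starE path_rep_idE kg_ext_id.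
      by case: eqP.
    by rewrite l2_op_mulE !path_rep_idE; case: eqP.
  apply: l2_op_eqP => u y; rewrite l2_op_mulE !path_rep_idE.
  by case: eqP => // yv; case: eqP => // yw; case: vw; rewrite -yv.
- move=> l m lm; apply: l2_op_eqP => u y; rewrite l2_op_mulE !path_repE kg_div_mul //.
  by case: kg_div.
move=> l; apply: l2_op_eqP => u x; rewrite l2_op_mulE path_rep_starE path_rep_idE.
rewrite /kg_ext eq_sym; case: eqP => //= lx.
by rewrite kg_div_cmp ?lx.
Qed.

End PathRepresentation.

(** * Elementary C*-algebra *)

Section CStarBasics.
Variable R : realType.
Implicit Types A B : cStarAlgType R.

Lemma cmul0l A (a : A) : 0 ** a = 0.
Proof. by rewrite -(scale0r 0) cmulZl !scale0r. Qed.

Lemma cmul0r A (a : A) : a ** 0 = 0.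
Proof. by rewrite -(scale0r 0) cmulZr !scale0r. Qed.

Lemma cmulNl A (a b : A) : (- a) ** b = - (a ** b).
Proof. by rewrite -scaleN1r cmulZl scaleN1r. Qed.

Lemma cmulNr A (a b : A) : a ** (- b) = - (a ** b).
Proof. by rewrite -scaleN1r cmulZr scaleN1r. Qed.

Lemma cmulBl A (a b c : A) : (a - b) ** c = a ** c - b ** c.
Proof. by rewrite cmulDl cmulNl. Qed.

Lemma cmulBr A (a b c : A) : c ** (a - b) = c ** a - c ** b.
Proof. by rewrite cmulDr cmulNr. Qed.

Lemma cmul_suml A (I : Type) (s : seq I) (P : pred I) (F : I -> A) a :
  (\sum_(i <- s | P i) F i) ** a = \sum_(i <- s | P i) (F i ** a).
Proof. by apply: (big_morph (fun b => b ** a)) => [b c|]; rewrite ?cmulDl ?cmul0l. Qed.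

Lemma cmul_sumr A (I : Type) (s : seq I) (P : pred I) (F : I -> A) a :
  a ** (\sum_(i <- s | P i) F i) = \sum_(i <- s | P i) (a ** F i).
Proof. by apply: (big_morph (fun b => a ** b)) => [b c|]; rewrite ?cmulDr ?cmul0r. Qed.

Lemma star0 A : star (0 : A) = 0.
Proof. by rewrite -(scale0r (0 : A)) starZ rmorph0 !scale0r. Qed.

Lemma starN A (a : A) : star (- a) = - star a.
Proof. by rewrite -scaleN1r starZ rmorphN rmorph1 scaleN1r. Qed.

Lemma starB A (a b : A) : star (a - b) = star a - star b.
Proof. by rewrite starD starN. Qed.

Lemma star_sum A (I : Type) (s : seq I) (P : pred I) (F : I -> A) :
  star (\sum_(i <- s | P i) F i) = \sum_(i <- s | P i) star (F i).
Proof. by apply: (big_morph (@star R A)) => [b c|]; rewrite ?starD ?star0. Qed.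

Lemma norm_star_le A (a : A) : `|a| <= `|star a|.
Proof.
have [->|a0] := eqVneq a 0; first by rewrite star0.
have ap : 0 < `|a| by rewrite normr_gt0.
by rewrite -(ler_pM2r ap) -expr2 -norm_cstar norm_cmul.
Qed.

Lemma norm_star A (a : A) : `|star a| = `|a|.
Proof. by apply/le_anti; rewrite norm_star_le -{2}(starK a) norm_star_le. Qed.

Lemma norm_projection_le1 A (p : A) : star p = p -> p ** p = p -> `|p| <= 1.
Proof.
move=> sp pp; have := norm_cstar p; rewrite sp pp => e.
have [->|p0] := eqVneq p 0; first by rewrite normr0.
have pn : 0 < `|p| by rewrite normr_gt0.
by rewrite -(ler_pM2r pn) -expr2 -e mul1r.
Qed.

(** This covers multiplications, adjoints and bounded functionals alike. *)
Lemma closed_preimage_lipschitz A (B : normedModType R[i]) (f : A -> B) (C : R[i]) (S : set B) :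
  (forall a b, `|f a - f b| <= C * `|a - b|) -> closed S -> closed (f @^-1` S).
Proof.
move=> fC; apply: preimage_closed => a _.
apply/cvgrPdist_le => e e0.
have C1 : 0 < `|C| + 1 by rewrite ltr_wpDl.
near=> b; apply: le_trans (fC _ _) _.
apply: le_trans (real_ler_norm _) _.
  rewrite ger0_real //; apply: le_trans (fC a b); exact: normr_ge0.
rewrite normrM normr_id.
apply: (@le_trans _ _ ((`|C| + 1) * `|a - b|)).
  by rewrite ler_wpM2r // lerDl.
rewrite mulrC -ler_pdivlMr //; near: b.
apply: cvgr_dist_le; first exact: cvg_id.
by rewrite divr_gt0.
Unshelve. all: by end_near. Qed.

Lemma closed_cmul_l A (b : A) (S : set A) : closed S -> closed [set a | S (b ** a)].
Proof.
apply: (closed_preimage_lipschitz (C := `|b|)) => x y.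
by rewrite -cmulBr norm_cmul.
Qed.

Lemma closed_cmul_r A (b : A) (S : set A) : closed S -> closed [set a | S (a ** b)].
Proof.
apply: (closed_preimage_lipschitz (C := `|b|)) => x y.
by rewrite -cmulBl mulrC norm_cmul.
Qed.

Lemma closed_star A (S : set A) : closed S -> closed [set a | S (star a)].
Proof.
apply: (closed_preimage_lipschitz (C := 1)) => x y.
by rewrite -starB norm_star mul1r.
Qed.

Lemma closed_eq_lipschitz A (B : normedModType R[i]) (f : A -> B) (C : R[i]) :
  (forall a b, `|f a - f b| <= C * `|a - b|) -> closed [set a | f a = 0].
Proof.
move=> fC; apply: (closed_preimage_lipschitz fC (S := [set 0])).
apply: accessible_closed_set1; apply: hausdorff_accessible; exact: norm_hausdorff.
Qed.

Lemma star_hom0 A B (f : A -> B) : star_hom f -> f 0 = 0.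
Proof.
move=> [fl _ _]; have := fl 1 0 0; rewrite !scale1r addr0 => /eqP.
by rewrite -subr_eq0 opprD addrA subrr add0r oppr_eq0 => /eqP.
Qed.

Lemma star_homD A B (f : A -> B) a b : star_hom f -> f (a + b) = f a + f b.
Proof. by move=> [fl _ _]; have := fl 1 a b; rewrite !scale1r. Qed.

Lemma star_homZ A B (f : A -> B) (x : R[i]) a : star_hom f -> f (x *: a) = x *: f a.
Proof.
by move=> fh; have [fl _ _] := fh; have := fl x a 0; rewrite (star_hom0 fh) !addr0.
Qed.

Lemma star_homB A B (f : A -> B) a b : star_hom f -> f (a - b) = f a - f b.
Proof. by move=> fh; rewrite star_homD // -scaleN1r star_homZ // scaleN1r. Qed.

Lemma star_hom_sum A B (f : A -> B) (I : Type) (s : seq I) (P : pred I) (F : I -> A) :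
  star_hom f -> f (\sum_(i <- s | P i) F i) = \sum_(i <- s | P i) f (F i).
Proof.
by move=> fh; apply: (big_morph f) => [a b|]; [apply: star_homD|apply: star_hom0].
Qed.

Lemma scalar0 A (f : A -> R[i]) : scalar f -> f 0 = 0.
Proof.
move=> fl; have := fl 1 0 0; rewrite scale1r addr0 mul1r => /eqP.
by rewrite -subr_eq0 opprD addrA subrr add0r oppr_eq0 => /eqP.
Qed.

Lemma scalarD A (f : A -> R[i]) a b : scalar f -> f (a + b) = f a + f b.
Proof. by move=> fl; have := fl 1 a b; rewrite scale1r mul1r. Qed.

Lemma scalarZ A (f : A -> R[i]) (x : R[i]) a : scalar f -> f (x *: a) = x * f a.
Proof. by move=> fl; have := fl x a 0; rewrite (scalar0 fl) !addr0. Qed.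

Lemma scalarB A (f : A -> R[i]) a b : scalar f -> f (a - b) = f a - f b.
Proof. by move=> fl; rewrite scalarD // -scaleN1r scalarZ // mulN1r. Qed.

Lemma scalar_sum A (f : A -> R[i]) (I : Type) (s : seq I) (P : pred I) (F : I -> A) :
  scalar f -> f (\sum_(i <- s | P i) F i) = \sum_(i <- s | P i) f (F i).
Proof.
by move=> fl; apply: (big_morph f) => [a b|]; [apply: scalarD|apply: scalar0].
Qed.

End CStarBasics.

(** * Gap projections *)

Section ToeplitzFamily.
Variables (R : realType) (k : nat) (L : kgraph k).
Hypothesis L_finite : kg_finite L.
Local Notation V := (kg_vtx L).
Local Notation M := (kg_mor L).
Variables (A : cStarAlgType R) (t : M -> A).
Hypothesis tf : toeplitz_family t.
Local Notation q v := (t (kg_id L v)).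

Let q_proj v : star (q v) = q v /\ q v ** q v = q v.
Proof. by case: tf => -[_ []]. Qed.

Lemma toeplitz_qs v : star (q v) = q v. Proof. by case: (q_proj v). Qed.

Lemma toeplitz_qq v w : q v ** q w = if v == w then q v else 0.
Proof.
case: eqP => [<-|vw]; first by case: (q_proj v).
by case: tf => -[_ [_ h]] _ _ _ _; apply: h.
Qed.

Lemma toeplitz_star_self l : star (t l) ** t l = q (kg_src l).
Proof. by case: tf. Qed.

Lemma toeplitz_q_t l : q (kg_rng l) ** t l = t l.
Proof. by case: tf => _ h _ _ _; rewrite h ?kg_src_id // kg_cmp_idl. Qed.

Lemma toeplitz_t_q l : t l ** q (kg_src l) = t l.
Proof. by case: tf => _ h _ _ _; rewrite h ?kg_rng_id // kg_cmp_idr. Qed.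

Lemma toeplitz_mul l m :
  t l ** t m = if kg_src l == kg_rng m then t (kg_cmp l m) else 0.
Proof.
case: eqP => [e|/eqP ne]; first by case: tf => _ h _ _ _; apply: h.
rewrite -toeplitz_t_q -(toeplitz_q_t m) -cmulA (cmulA (q _)) toeplitz_qq.
by rewrite (negbTE ne) cmul0l cmul0r.
Qed.

Lemma toeplitz_q_mul v l : q v ** t l = if v == kg_rng l then t l else 0.
Proof. by rewrite toeplitz_mul kg_src_id; case: eqP => // ->; rewrite kg_cmp_idl. Qed.

Lemma toeplitz_mul_q l v : t l ** q v = if kg_src l == v then t l else 0.
Proof. by rewrite toeplitz_mul kg_rng_id; case: eqP => // <-; rewrite kg_cmp_idr. Qed.

Lemma toeplitz_star_mul mu nu : star (t mu) ** t nu =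
  \sum_(ez <- fset_set (kg_min mu nu)) (t ez.1 ** star (t ez.2)).
Proof.
by case: tf => _ _ _ _ ->; rewrite fsbig_finite //=; apply: kg_min_finite.
Qed.

Lemma toeplitz_star_mul_deg mu nu : kg_deg mu = kg_deg nu ->
  star (t mu) ** t nu = if mu == nu then q (kg_src mu) else 0.
Proof.
case: eqP => [<- _|ne d]; first exact: toeplitz_star_self.
rewrite toeplitz_star_mul big_seq big1 // => ez.
rewrite in_fset_set ?inE; last exact: kg_min_finite.
move=> h; case: ne; have [rr ms ns e _] := h.
have [] // := kg_fact_uniq ms ns e.
Qed.

Lemma norm_toeplitz_q v : `|q v| <= 1.
Proof. by apply: norm_projection_le1; case: (q_proj v). Qed.

Lemma norm_toeplitz l : `|t l| <= 1.
Proof.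
rewrite -(@ler_pXn2r _ 2) ?nnegrE ?normr_ge0 // expr1n -norm_cstar.
by rewrite toeplitz_star_self norm_toeplitz_q.
Qed.

Definition toeplitz_one : A := \sum_v q v.
Local Notation one := toeplitz_one.

Lemma toeplitz_one_star : star one = one.
Proof. by rewrite star_sum; apply: eq_bigr => v _; apply: toeplitz_qs. Qed.

Lemma toeplitz_one_t l : one ** t l = t l.
Proof.
rewrite cmul_suml (bigD1 (kg_rng l)) //= toeplitz_q_t big1 ?addr0 // => v.
by rewrite toeplitz_q_mul => /negbTE ->.
Qed.

Lemma toeplitz_t_one l : t l ** one = t l.
Proof.
rewrite cmul_sumr (bigD1 (kg_src l)) //= toeplitz_t_q big1 ?addr0 // => v.
by rewrite toeplitz_mul_q eq_sym => /negbTE ->.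
Qed.

Lemma toeplitz_one_one : one ** one = one.
Proof. by rewrite {2}/one cmul_sumr; apply: eq_bigr => v _; apply: toeplitz_one_t. Qed.

Lemma norm_toeplitz_one : `|one| <= 1.
Proof. by apply: norm_projection_le1; [apply: toeplitz_one_star|apply: toeplitz_one_one]. Qed.

Lemma kg_edges_finite i : finite_set [set l : M | kg_deg l = kg_unit i].
Proof. exact: L_finite. Qed.

Definition kg_edges (i : 'I_k) : {fset M} := fset_set [set l : M | kg_deg l = kg_unit i].

Lemma kg_edgesP i l : (l \in kg_edges i) = (kg_deg l == kg_unit i).
Proof.
rewrite in_fset_set; last exact: kg_edges_finite.
by apply/idP/eqP; rewrite inE.
Qed.

Definition edge_map (i : 'I_k) (x : A) : A :=
  \sum_(e <- kg_edges i) (t e ** x ** star (t e)).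

(** In path space, with [l] duplicate-free, this is the projection onto the paths that have no
  edge of a colour in [l]. Defining it by iteration of [edge_map], rather than as a product
  of projections, lets the KMS condition be applied to one colour at a time in [kms_gap]. *)
Definition gap_seq (l : seq 'I_k) : A := foldr (fun i x => x - edge_map i x) one l.

Lemma edge_map_star i x : star (edge_map i x) = edge_map i (star x).
Proof.
by rewrite star_sum; apply: eq_bigr => e _; rewrite !starM starK cmulA.
Qed.

Lemma edge_map_q i x v : q v ** edge_map i x = edge_map i x ** q v.
Proof.
rewrite cmul_sumr cmul_suml; apply: eq_bigr => e _.
rewrite cmulA cmulA toeplitz_q_mul -[RHS]cmulA.
rewrite -[star (t e) ** q v]starK starM starK toeplitz_qs toeplitz_q_mul.
by case: eqP; rewrite ?star0 ?cmul0r ?cmul0l.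
Qed.

Lemma edge_map0 i : edge_map i 0 = 0.
Proof. by rewrite /edge_map big1 // => e _; rewrite cmul0r cmul0l. Qed.

Lemma gap_star l : star (gap_seq l) = gap_seq l.
Proof.
elim: l => [|i l IH] /=; first exact: toeplitz_one_star.
by rewrite starB edge_map_star IH.
Qed.

Lemma gap_q l v : q v ** gap_seq l = gap_seq l ** q v.
Proof.
elim: l => [|i l IH] /=; first by rewrite toeplitz_t_one toeplitz_one_t.
by rewrite cmulBr cmulBl IH edge_map_q.
Qed.

(** Distinct edges of one colour have orthogonal ranges: only the summand of [f] remains. *)
Lemma edge_map_same i x f : (forall v, q v ** x = x ** q v) -> kg_deg f = kg_unit i ->
  edge_map i x ** t f = t f ** x.
Proof.
move=> xq df; rewrite cmul_suml.
rewrite (big_one_term (i0 := f)) ?fset_uniq ?kg_edgesP ?df // => [|e].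
  by rewrite -cmulA toeplitz_star_self -cmulA -xq cmulA toeplitz_t_q.
rewrite kg_edgesP => /eqP de ef.
by rewrite -cmulA toeplitz_star_mul_deg ?de ?df // (negbTE ef) cmul0r.
Qed.

(** For distinct colours, the edge map moves past a path of the other colour: an edge
  followed by a path of the other colour can be rewritten in the opposite order. *)
Lemma edge_map_other i j x y f : i != j -> kg_deg f = kg_unit j ->
  (forall h, kg_deg h = kg_unit j -> x ** t h = t h ** y) ->
  edge_map i x ** t f = t f ** edge_map i y.
Proof.
move=> ij df xy.
have unit_join e : kg_deg e = kg_unit i ->
    forall ez, kg_min e f ez -> kg_deg ez.2 = kg_unit i.
  move=> de ez h; apply/ffunP => n; rewrite (kg_min_deg2 n h) !ffunE de df !ffunE.
  by case: (n =P i) => [->|_]; [rewrite (negbTE ij)|case: (n =P j)].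
(* [star (t e) ** t f] is a sum of terms [t z' ** star (t z)] with [z] of colour [i], hence
   it is not changed by the sum of the range projections of those edges. *)
have insert e : kg_deg e = kg_unit i -> star (t e) ** t f =
    \sum_(z <- kg_edges i) (star (t e) ** (t f ** t z) ** star (t z)).
  move=> de; rewrite -[RHS](eq_bigr _ (fun z _ => cmulA _ _ _)) /=.
  under eq_bigr do rewrite -cmulA.
  rewrite -cmul_sumr.
  rewrite -cmul_sumr cmulA toeplitz_star_mul cmul_suml; apply: eq_big_seq => ez.
  rewrite in_fset_set ?inE; last exact: kg_min_finite.
  move=> /(unit_join _ de) dz; rewrite -cmulA; congr (_ ** _).
  rewrite cmul_sumr (big_one_term (i0 := ez.2)) ?fset_uniq ?kg_edgesP ?dz //.
    by rewrite cmulA toeplitz_star_self -{1}(toeplitz_t_q ez.2) starM toeplitz_qs.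
  move=> z; rewrite kg_edgesP => /eqP d ze.
  by rewrite cmulA toeplitz_star_mul_deg ?d // eq_sym (negbTE ze) cmul0l.
rewrite cmul_suml.
transitivity (\sum_(e <- kg_edges i) \sum_(z <- kg_edges i)
   (t e ** x ** (star (t e) ** (t f ** t z)) ** star (t z))).
  apply: eq_big_seq => e; rewrite kg_edgesP => /eqP de.
  rewrite -cmulA insert // cmul_sumr; apply: eq_bigr => z _.
  by rewrite cmulA.
rewrite exchange_big /= cmul_sumr; apply: eq_big_seq => z; rewrite kg_edgesP => /eqP dz.
rewrite -cmul_suml !cmulA; congr (_ ** _).
rewrite toeplitz_mul; case: eqP => [fz|_]; last first.
  rewrite cmul0l big1 // => e _; by rewrite !cmul0r.
(* Rewrite [f z], of colours [j] and [i], as [e h] with the colours exchanged; only the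
   summand of [e] survives. *)
have [|e [h [de eh fE]]] := @kg_split_unit _ _ (kg_cmp f z) i.
  by rewrite kg_deg_cmp // degD dz !ffunE eqxx addn1.
have dh : kg_deg h = kg_unit j.
  have := congr1 (@kg_deg k L) fE; rewrite !kg_deg_cmp // df dz de addrC.
  by move/deg_addI.
rewrite (big_one_term (i0 := e)) ?fset_uniq ?kg_edgesP ?de //.
  have -> : t (kg_cmp f z) = t e ** t h by rewrite toeplitz_mul eh eqxx fE.
  rewrite (cmulA (star _)) toeplitz_star_self eh toeplitz_q_t -cmulA xy //.
  by rewrite cmulA.
move=> e'; rewrite kg_edgesP => /eqP de' ne.
have -> : t (kg_cmp f z) = t e ** t h by rewrite toeplitz_mul eh eqxx fE.
by rewrite (cmulA (star _)) toeplitz_star_mul_deg ?de ?de' // (negbTE ne) cmul0l cmul0r.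
Qed.

Lemma gap_comm l j f : j \notin l -> kg_deg f = kg_unit j ->
  gap_seq l ** t f = t f ** gap_seq l.
Proof.
elim: l f => [|i l IH] f /=; first by rewrite toeplitz_t_one toeplitz_one_t.
rewrite inE negb_or => /andP[ji jl] df; rewrite cmulBl cmulBr IH //.
by rewrite (edge_map_other (y := gap_seq l) _ df) 1?eq_sym // => h; apply: IH.
Qed.

(** The colour [j] annihilates [t f] by [edge_map_same]; the other colours let it pass by
  [edge_map_other]. *)
Lemma gap_kill l j f : uniq l -> j \in l -> kg_deg f = kg_unit j ->
  gap_seq l ** t f = 0.
Proof.
elim: l f => [//|i l IH] f /= /andP[il ul]; rewrite inE cmulBl => /orP[/eqP ->|jl] df.
  by rewrite edge_map_same //; [rewrite (gap_comm il) // subrr|exact: gap_q].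
have ij : i != j by apply: contraNneq il => ->.
rewrite IH // (edge_map_other (y := 0) ij df) => [|h dh].
  by rewrite edge_map0 cmul0r subrr.
by rewrite IH // cmul0r.
Qed.

Definition gap : A := gap_seq (enum 'I_k).

Lemma gap_t mu i : (0 < kg_deg mu i)%N -> gap ** t mu = 0.
Proof.
move=> /kg_split_unit[x [y [dx xy ->]]].
have -> : t (kg_cmp x y) = t x ** t y by rewrite toeplitz_mul xy eqxx.
by rewrite cmulA (gap_kill _ _ dx) ?enum_uniq ?mem_enum // cmul0l.
Qed.

Lemma gap_one l : gap_seq l ** one = gap_seq l.
Proof.
elim: l => [|i l IH] /=; first exact: toeplitz_one_one.
rewrite cmulBl IH; congr (_ - _); rewrite cmul_suml; apply: eq_bigr => e _.
rewrite -cmulA; congr (_ ** _).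
by rewrite -toeplitz_one_star -starM toeplitz_one_t.
Qed.

(** By [gap_kill], [gap_seq l] annihilates all that is subtracted from the unit. *)
Lemma gap_seq_idem l : uniq l -> gap_seq l ** gap_seq l = gap_seq l.
Proof.
move=> ul; suff h l' : {subset l' <= l} -> gap_seq l ** gap_seq l' = gap_seq l by apply: h.
elim: l' => [|i l' IH] sl /=; first exact: gap_one.
rewrite cmulBr IH => [|j jl']; last by apply: sl; rewrite inE jl' orbT.
rewrite cmul_sumr big_seq big1 ?subr0 // => e; rewrite kg_edgesP => /eqP de.
by rewrite !cmulA (gap_kill ul _ de) ?cmul0l // sl ?mem_head.
Qed.

Lemma gap_q_idem l v : uniq l -> q v ** gap_seq l ** (q v ** gap_seq l) = q v ** gap_seq l.
Proof.
move=> ul; rewrite -cmulA (cmulA (gap_seq l)) -gap_q -(cmulA (q v) (gap_seq l)) gap_seq_idem //.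
by rewrite cmulA toeplitz_qq eqxx.
Qed.

(** In path space, the projection onto the line of the basis vector at the vertex [v]. *)
Definition vgap v : A := q v ** gap.

Lemma vgap_star v : star (vgap v) = vgap v.
Proof. by rewrite starM gap_star toeplitz_qs -gap_q. Qed.

Lemma vgap_idem v : vgap v ** vgap v = vgap v.
Proof. by apply: gap_q_idem; apply: enum_uniq. Qed.

Lemma vgap_t v mu : vgap v ** t mu = if mu == kg_id L v then vgap v else 0.
Proof.
case: eqP => [->|ne]; first by rewrite /vgap -cmulA -gap_q cmulA toeplitz_qq eqxx.
have [e|/kg_deg_neq0[i /gap_t g]] := pselect (mu = kg_id L (kg_rng mu)).
  rewrite /vgap -cmulA e -gap_q cmulA toeplitz_qq.
  by case: eqP => [vm|_]; [case: ne; rewrite vm|rewrite cmul0l].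
by rewrite /vgap -cmulA g cmul0r.
Qed.

Lemma vgap_monomial v mu nu : vgap v ** (t mu ** star (t nu)) ** vgap v =
  if (mu == kg_id L v) && (nu == kg_id L v) then vgap v else 0.
Proof.
rewrite cmulA vgap_t -cmulA.
have -> : star (t nu) ** vgap v = if nu == kg_id L v then vgap v else 0.
  rewrite -{1}vgap_star -starM vgap_t; case: eqP; rewrite ?vgap_star ?star0 //.
case: eqP => _; case: eqP => _; rewrite ?cmul0l ?cmul0r //.
by rewrite vgap_idem.
Qed.

Lemma norm_vgap v : `|vgap v| <= 1.
Proof. by apply: norm_projection_le1; [apply: vgap_star|apply: vgap_idem]. Qed.

End ToeplitzFamily.

(** * Density of the monomials and corners at the gap projections *)

Lemma norm_le_eps0 (R : realType) (A : cStarAlgType R) (a : A) :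
  (forall e : R, 0 < e -> `|a| <= e%:C) -> a = 0.
Proof.
move=> h; apply/eqP; rewrite -normr_eq0 -(RRe_real (normr_real a)).
apply/eqP; congr (_ %:C); apply/le_anti/andP; split.
  apply/ler_addgt0Pr => e e0; rewrite add0r -lecR (RRe_real (normr_real a)).
  exact: h.
by rewrite -lecR (RRe_real (normr_real a)) normr_ge0.
Qed.

Section Delta.
Variables (R : realType) (X : choiceType).

Lemma delta_square_summable (x : X) : @square_summable R X (fun y => (y == x)%:R).
Proof.
exists 1 => F.
have E (y : X) : sqmod ((y == x)%:R : R[i]) = (y == x)%:R.
  by case: eqP; rewrite /sqmod /= !(expr0n, expr1n, addr0).
under eq_bigr do rewrite E.
have [xF|xF] := boolP (x \in F).
  rewrite (big_one_term (i0 := x)) ?fset_uniq ?eqxx // => y _ /negbTE -> //.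
rewrite big_seq big1 // => y yF; case: eqP => // yx.
by rewrite -yx yF in xF.
Qed.

Definition l2_delta (x : X) : l2 R X := L2 (delta_square_summable x).

Lemma l2_deltaE x y : l2_delta x y = (y == x)%:R. Proof. by []. Qed.

Lemma l2_delta_neq0 x : l2_delta x <> 0.
Proof.
by move=> /(congr1 (fun u : l2 R X => u x))/eqP; rewrite l2_deltaE eqxx l2_0E oner_eq0.
Qed.

End Delta.

Section Density.
Variables (R : realType) (k : nat) (L : kgraph k).
Hypothesis L_finite : kg_finite L.
Variables (A : cStarAlgType R) (t : kg_mor L -> A).
Hypothesis t_univ : toeplitz_algebra t.

Let tf : toeplitz_family t. Proof. by case: t_univ. Qed.

Definition closed_subspace (S : set A) : Prop :=
  [/\ S 0, (forall (x : R[i]) a b, S a -> S b -> S (x *: a + b)) & closed S].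

Lemma closed_subspace_sum (S : set A) (I : eqType) (s : seq I) (F : I -> A) :
  closed_subspace S -> (forall i, i \in s -> S (F i)) -> S (\sum_(i <- s) F i).
Proof.
move=> [S0 SD _] h; rewrite big_seq; elim/big_ind: _ => // a b Sa Sb.
by rewrite -(scale1r a); apply: SD.
Qed.

Lemma monomial_mul_subspace (S : set A) mu nu sg ta : closed_subspace S ->
  (forall mu nu, S (t mu ** star (t nu))) ->
  S (t mu ** star (t nu) ** (t sg ** star (t ta))).
Proof.
move=> Ss Sm; rewrite cmulA -(cmulA (t mu)) (toeplitz_star_mul L_finite tf).
rewrite cmul_sumr cmul_suml; apply: closed_subspace_sum => // ez _.
rewrite -!cmulA -starM cmulA !(toeplitz_mul tf).
have [S0 _ _] := Ss.
by do 2!case: eqP => _; rewrite ?star0 ?cmul0l ?cmul0r.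
Qed.

(** The smallest closed subspace containing the monomials is a star-subalgebra, because
  the product of two monomials is a finite sum of monomials. *)
Lemma toeplitz_dense (S : set A) : closed_subspace S ->
  (forall mu nu, S (t mu ** star (t nu))) -> forall a, S a.
Proof.
move=> Ss Sm a.
pose C : set A := [set a | forall S : set A, closed_subspace S ->
  (forall mu nu, S (t mu ** star (t nu))) -> S a].
have CT : C = setT; last first.
  by have aC : C a by [rewrite CT]; apply: aC.
have [_ gen _] := t_univ; apply: gen; last first.
  move=> l S' S's S'm; rewrite -(toeplitz_t_q tf) -[t (kg_id _ _)](toeplitz_qs tf).
  exact: S'm.
have Cs : closed_subspace C.
  split.
  - by move=> S' [].
  - by move=> x b c Cb Cc S' S's S'm; have [_ SD _] := S's; apply: SD; [apply: Cb|apply: Cc].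
  move=> b bC S' S's S'm; have [_ _] := S's; apply => B /bC[c [Cc Bc]].
  by exists c; split => //; apply: Cc.
have [C0 CD Cc] := Cs; split => //.
- move=> b c Cb Cc' S' S's S'm.
  have sub_r d : closed_subspace [set x | S' (x ** d)].
    have [S0 SD Sc] := S's; split => /=; first by rewrite cmul0l.
      by move=> x e f Se Sf; rewrite cmulDl cmulZl; apply: SD.
    exact: closed_cmul_r.
  have sub_l d : closed_subspace [set x | S' (d ** x)].
    have [S0 SD Sc] := S's; split => /=; first by rewrite cmul0r.
      by move=> x e f Se Sf; rewrite cmulDr cmulZr; apply: SD.
    exact: closed_cmul_l.
  apply: (Cb _ (sub_r c)) => mu nu /=.
  apply: (Cc' _ (sub_l _)) => sg ta /=.
  exact: monomial_mul_subspace.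
move=> b Cb S' S's S'm; apply: (Cb [set x | S' (star x)]) => /=.
  have [S0 SD Sc] := S's; split => /=; first by rewrite star0.
    by move=> x e f Se Sf; rewrite starD starZ; apply: SD.
  exact: closed_star.
by move=> mu nu; rewrite starM starK.
Qed.

Lemma toeplitz_one_mul a : toeplitz_one t ** a = a.
Proof.
apply/eqP; rewrite -subr_eq0; apply/eqP.
apply: (@toeplitz_dense [set a | toeplitz_one t ** a - a = 0]) => /= [|mu nu].
  split => /=; first by rewrite cmul0r subrr.
    move=> x b c /eqP; rewrite subr_eq0 => /eqP hb /eqP; rewrite subr_eq0 => /eqP hc.
    by rewrite cmulDr cmulZr hb hc subrr.
  apply: (@closed_eq_lipschitz _ _ _ _ (`|toeplitz_one t| + 1)) => x y.
  have -> : toeplitz_one t ** x - x - (toeplitz_one t ** y - y) =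
      toeplitz_one t ** (x - y) - (x - y).
    by rewrite cmulBr opprD opprK addrACA [in RHS]opprB [X in _ + X]addrC.
  by apply: le_trans (ler_normB _ _) _; rewrite mulrDl mul1r lerD // norm_cmul.
by rewrite cmulA (toeplitz_one_t tf) subrr.
Qed.

Lemma toeplitz_mul_one a : a ** toeplitz_one t = a.
Proof.
by rewrite -[LHS]starK starM (toeplitz_one_star tf) toeplitz_one_mul starK.
Qed.

End Density.

Section HomGap.
Variables (R : realType) (k : nat) (L : kgraph k).
Variables (A B : cStarAlgType R) (t : kg_mor L -> A) (t' : kg_mor L -> B) (f : A -> B).
Hypotheses (fh : star_hom f) (ft : forall l, f (t l) = t' l).

Lemma star_hom_gap_seq l : f (gap_seq t l) = gap_seq t' l.
Proof.
have [_ fM fS] := fh.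
elim: l => [|i l IH] /=.
  by rewrite (star_hom_sum _ _ _ fh); apply: eq_bigr => v _; rewrite ft.
rewrite (star_homB _ _ fh) IH (star_hom_sum _ _ _ fh); congr (_ - _).
by apply: eq_bigr => e _; rewrite !fM fS IH ft.
Qed.

Lemma star_hom_vgap v : f (vgap t v) = vgap t' v.
Proof. by have [_ fM _] := fh; rewrite fM ft star_hom_gap_seq. Qed.

End HomGap.

Section GapCoefficient.
Variables (R : realType) (k : nat) (L : kgraph k).
Hypothesis L_finite : kg_finite L.
Variables (A : cStarAlgType R) (t : kg_mor L -> A).
Hypothesis t_univ : toeplitz_algebra t.

Let tf : toeplitz_family t. Proof. by case: t_univ. Qed.

(** The path at [v] of degree 0 is not a prolongation of any edge. *)
Lemma path_rep_vgap_delta v :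
  vgap (@path_rep R k L) v (l2_delta R (kg_id L v)) = l2_delta R (kg_id L v).
Proof.
set d := l2_delta R _.
have idd w : path_rep R (kg_id L w) d = if w == v then d else 0.
  apply: l2_eqP => y; rewrite path_rep_idE l2_deltaE.
  have [->|wv] := eqVneq w v.
    case: eqP => // yv; rewrite l2_deltaE; case: eqP => // e.
    by case: yv; rewrite e kg_rng_id.
  rewrite l2_0E; case: eqP => // yw; case: eqP => // e.
  by case/eqP: wv; rewrite -yw e kg_rng_id.
have gd l : gap_seq (@path_rep R k L) l d = d.
  elim: l => [|i l IH].
    apply: l2_eqP => y; rewrite l2_op_sumE (bigD1 v) // idd eqxx big1; first exact: addr0.
    by move=> w; rewrite andTb => /negbTE wv; rewrite idd wv.
  rewrite [gap_seq _ _]/= op_subE IH.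
  have -> : edge_map (@path_rep R k L) i (gap_seq (@path_rep R k L) l) d = 0.
    apply: l2_eqP => y; rewrite l2_op_sumE big_seq big1 // => e.
    rewrite kg_edgesP // => /eqP de; rewrite !l2_op_mulE.
    have -> : star (path_rep R e) d = 0; last by rewrite !op_0.
    apply: l2_eqP => x; rewrite path_rep_starE /kg_ext; case: eqP => //= ex.
    case: eqP => // /(congr1 (@kg_deg k L)).
    rewrite kg_deg_id kg_deg_cmp // de => /ffunP/(_ i).
    by rewrite degD !ffunE eqxx.
  by rewrite subr0.
by rewrite l2_op_mulE gd idd eqxx.
Qed.

Let rep : exists2 f : A -> l2_op R (kg_mor L), star_hom f & forall l, f (t l) = path_rep R l.
Proof. by have [_ _] := t_univ; apply; apply: path_rep_toeplitz. Qed.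

Lemma vgap_neq0 v : vgap t v <> 0.
Proof.
move=> g0; have [f fh ft] := rep.
have := star_hom_vgap fh ft v; rewrite g0 (star_hom0 fh) => /esym e.
by have := path_rep_vgap_delta v; rewrite e op_0E => /esym; apply: l2_delta_neq0.
Qed.

Let closed_corner v : closed [set a | exists c : R[i], vgap t v ** a ** vgap t v = c *: vgap t v].
Proof.
set Q := vgap t v; set S := [set a | _]; move=> a aS.
have Qp : 0 < `|Q| by rewrite normr_gt0; apply/eqP; apply: vgap_neq0.
(* The coefficient is Lipschitz on [S], hence converges along [S] at any limit point [a]. *)
pose f b : R[i] := xget 0 [set c : R[i] | Q ** b ** Q = c *: Q].
have fP b : S b -> Q ** b ** Q = f b *: Q.
  by move=> [c Sc]; rewrite /f; case: xgetP => [c' _ //|h]; case: (h c).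
have QQ b : `|Q ** b ** Q| <= `|b| * `|Q|.
  apply: le_trans (norm_cmul _ _) _; rewrite ler_wpM2r //.
  by apply: le_trans (norm_cmul _ _) _; rewrite ler_piMl // (norm_vgap L_finite tf).
pose F : set_system A := within S (nbhs a).
have FF : ProperFilter F by apply: within_nbhs_proper.
have [e e0|l lP] := @complex_cauchy_cvg R A F FF f.
  have e20 : 0 < (e / 2)%:C by rewrite ltcR divr_gt0.
  have [b [Sb ab]] := aS _ (nbhsx_ballx a _ e20); exists b.
  rewrite -ball_normE /= in ab.
  have : nbhs a (ball a (e / 2)%:C) by apply: nbhsx_ballx.
  rewrite /F /within /=; apply: filterS => c ac Sc /=; rewrite -ball_normE /= in ac.
  rewrite -(ler_pM2r Qp) -normrZ scalerBl -!fP // -cmulBl -cmulBr.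
  apply: le_trans (QQ _) _; rewrite ler_wpM2r //.
  rewrite -(subrKA a); apply: le_trans (ler_normD _ _) _.
  by rewrite [e]splitr rmorphD /= lerD ?ltW // distrC.
exists l; apply/eqP; rewrite -subr_eq0; apply/eqP; apply: norm_le_eps0 => e' e0.
have e20 : 0 < (e' / 2)%:C by rewrite ltcR divr_gt0.
have h1 : F [set b | `|l - f b| <= (e' / 2)%:C] 
  by move/(cvgrPdist_le (f : A -> R[i]^o)): lP => /(_ _ e20).
have h2 : F (ball a (e' / 2)%:C).
  by rewrite /F /within /=; apply: filterS (nbhsx_ballx a _ e20).
have h3 : F S by rewrite /F /within; apply: nearW.
have [b [/= lb [ab Sb]]] := filter_ex (filterI h1 (filterI h2 h3)).
rewrite -ball_normE /= in ab.
have -> : Q ** a ** Q - l *: Q = Q ** (a - b) ** Q - (l - f b) *: Q.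
  by rewrite cmulBr cmulBl scalerBl (fP b) // opprB addrA subrK.
apply: le_trans (ler_normB _ _) _; rewrite [e']splitr rmorphD /= lerD //.
  apply: le_trans (QQ _) _; apply: le_trans (ltW ab).
  by rewrite ler_piMr // (norm_vgap L_finite tf).
by rewrite normrZ; apply: le_trans lb; rewrite ler_piMr // (norm_vgap L_finite tf).
Qed.

(** On monomials this is [vgap_monomial], and the elements for which it holds form a closed
  subspace. *)
Lemma vgap_corner v a : exists c : R[i], vgap t v ** a ** vgap t v = c *: vgap t v.
Proof.
apply: (@toeplitz_dense _ _ _ L_finite _ _ t_univ
  [set a | exists c : R[i], vgap t v ** a ** vgap t v = c *: vgap t v]) => [|mu nu].
  split; last exact: closed_corner.
    by exists 0; rewrite cmul0r cmul0l scale0r.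
  move=> x b c [y hb] [z hc]; exists (x * y + z).
  by rewrite cmulDr cmulZr cmulDl cmulZl hb hc scalerDl scalerA.
rewrite /= (vgap_monomial L_finite tf).
by case: andP => _; [exists 1; rewrite scale1r|exists 0; rewrite scale0r].
Qed.

(** In path space, the vector functional of the basis vector at [v]. Reading it off the
  one-dimensional corner makes it compatible with quotient maps. *)
Definition gap_coef v a : R[i] := projT1 (cid (vgap_corner v a)).

Lemma gap_coefP v a : vgap t v ** a ** vgap t v = gap_coef v a *: vgap t v.
Proof. by rewrite /gap_coef; case: cid. Qed.

Lemma vgap_scaleI v (c d : R[i]) : c *: vgap t v = d *: vgap t v -> c = d.
Proof.
move=> /eqP; rewrite -subr_eq0 -scalerBl scaler_eq0 subr_eq0.
by case: eqP => //= _ /eqP /vgap_neq0.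
Qed.

Lemma gap_coef_unique v a (c : R[i]) : vgap t v ** a ** vgap t v = c *: vgap t v ->
  gap_coef v a = c.
Proof. by rewrite gap_coefP => /vgap_scaleI. Qed.

Lemma gap_coef_scalar v : scalar (gap_coef v).
Proof.
move=> x a b; apply: gap_coef_unique.
by rewrite cmulDr cmulZr cmulDl cmulZl !gap_coefP scalerDl scalerA.
Qed.

Lemma gap_coef_norm v a : `|gap_coef v a| <= `|a|.
Proof.
have Qp : 0 < `|vgap t v| by rewrite normr_gt0; apply/eqP; apply: vgap_neq0.
rewrite -(ler_pM2r Qp) -normrZ -gap_coefP.
apply: le_trans (norm_cmul _ _) _; rewrite ler_wpM2r //.
by apply: le_trans (norm_cmul _ _) _; rewrite ler_piMl // (norm_vgap L_finite tf).
Qed.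

Lemma gap_coef_monomial v mu nu : gap_coef v (t mu ** star (t nu)) =
  ((mu == kg_id L v) && (nu == kg_id L v))%:R.
Proof.
apply: gap_coef_unique; rewrite (vgap_monomial L_finite tf).
by case: andP; rewrite ?scale1r ?scale0r.
Qed.

Lemma gap_coef_vgap v a : gap_coef v (vgap t v ** a) = gap_coef v a.
Proof.
apply: gap_coef_unique; rewrite cmulA (vgap_idem L_finite tf).
exact: gap_coefP.
Qed.

(** In the path-space representation the coefficient is the vector functional of the
  basis vector at the vertex. *)
Lemma gap_coef_ge0 v a : 0 <= gap_coef v (star a ** a).
Proof.
have [f fh ft] := rep; have [_ fM fS] := fh.
pose d := l2_delta R (kg_id L v).
have fd : f (vgap t v) d = d by rewrite (star_hom_vgap fh ft) path_rep_vgap_delta.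
have e : l2_dot d (f (vgap t v ** (star a ** a) ** vgap t v) d) =
    (l2_sqnorm (f a d))%:C.
  rewrite fM fM [f (star a ** a)]fM fS !l2_op_mulE fd.
  have -> : f (vgap t v) = star (f (vgap t v)) by rewrite -fS (vgap_star tf).
  rewrite -[l2_dot _ _]/(l2_dot d (op_star (f (vgap t v)) (op_star (f a) (f a d)))).
  by rewrite -!op_starP' fd l2_dot_self.
have ed : l2_dot d d = 1.
  apply: l2_dot_unique.
  have -> : (1 : R[i]) = \sum_(x <- [fset kg_id L v]%fset) (d x)^* * d x.
    by rewrite big_seq_fset1 l2_deltaE eqxx rmorph1 mulr1.
  apply: has_sum_finite => x; rewrite inE l2_deltaE => /negbTE ->.
  by rewrite mulr0.
move: e; rewrite gap_coefP (star_homZ _ _ fh) op_scaleE fd l2_dotZr ed mulr1 => ->.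
by rewrite ler0c l2_sqnorm_ge0.
Qed.

End GapCoefficient.

(** * Analytic continuation of a one-parameter group of phases *)

Section PhaseSeries.
Variable R : realType.
Implicit Types (x y kap t : R) (z : R[i]).

Definition phase_coef kap (n : nat) : R[i] := ('i%C * kap%:C) ^+ n / n`!%:R.

Definition phase_term kap z (n : nat) : R[i] := z ^+ n * phase_coef kap n.

Lemma phase_term_norm kap z n (r : R) : `|z| = r%:C ->
  `|phase_term kap z n| = (exp_coeff (r * `|kap|) n)%:C.
Proof.
move=> zr; rewrite /phase_term /phase_coef !normrM !normrX normfV zr normrM.
have -> : `|'i%C : R[i]| = 1 by rewrite normc_def /= expr0n expr1n add0r sqrtr1.
have -> : `|kap%:C| = `|kap|%:C by rewrite normc_def /= expr0n addr0 sqrtr_sqr.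
rewrite mul1r normr_nat /exp_coeff /= exprMn [RHS]rmorphM /= rmorphM !rmorphXn /=.
by rewrite fmorphV /= rmorph_nat mulrA.
Qed.

Lemma phase_series_cvg kap z : exists l : R[i],
  (series (phase_term kap z) : nat -> R[i]^o) @ \oo --> (l : R[i]^o).
Proof.
have [r zr] : exists r : R, `|z| = r%:C by rewrite normc_def; eexists.
have r0 : 0 <= r by rewrite -lecR -zr normr_ge0.
have aux (g : R[i] -> R) : (forall w, `|g w|%:C <= `|w|) ->
    cvgn (series (fun n => g (phase_term kap z n))).
  move=> gL; apply: normed_cvg; apply: (@series_le_cvg _ _ (exp_coeff (r * `|kap|))).
  - by move=> n /=; apply: normr_ge0.
  - by move=> n; rewrite exp_coeff_ge0 // mulr_ge0.
  - by move=> n /=; rewrite -lecR -(phase_term_norm _ _ zr).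
  exact: is_cvg_series_exp_coeff.
have /cvg_ex[a ha] := aux (@complex.Re R) (@normc_ge_Re R).
have /cvg_ex[b hb] := aux (@complex.Im R) (@normC_ge_Im R).
exists (a +i* b); apply: cvg_complexP => /=.
  by under eq_fun do rewrite raddf_sum; exact: ha.
by under eq_fun do rewrite raddf_sum; exact: hb.
Qed.

(** The exponential of [i kap z] through its power series, the form in which analytic
  extensions are given. *)
Definition phase kap z : R[i] := projT1 (cid (phase_series_cvg kap z)).

Lemma phaseP kap z : (series (phase_term kap z) : nat -> R[i]^o) @ \oo --> (phase kap z : R[i]^o).
Proof. by rewrite /phase; case: cid. Qed.

Lemma phase_unique kap z l :
  (series (phase_term kap z) : nat -> R[i]^o) @ \oo --> (l : R[i]^o) -> phase kap z = l.
Proof. by move=> h; apply: (@cvg_unique R[i]^o _ (fmap _ \oo)) (@phaseP kap z) h. Qed.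

Lemma exp_i_coeff x n : ('i%C * x%:C) ^+ n / n`!%:R = cos_coeff x n +i* sin_coeff x n.
Proof.
have iE : ('i%C : R[i]) ^+ n = ((~~ odd n)%:R * (-1) ^+ n./2) +i* ((odd n)%:R * (-1) ^+ n.-1./2).
  suff h : ('i%C : R[i]) ^+ n = ((~~ odd n)%:R * (-1) ^+ n./2) +i* ((odd n)%:R * (-1) ^+ n.-1./2) /\
     ('i%C : R[i]) ^+ n.+1 = ((~~ odd n.+1)%:R * (-1) ^+ n.+1./2) +i* ((odd n.+1)%:R * (-1) ^+ n./2).
    by case: h.
  elim: n => [|n [IH1 IH2]].
    by rewrite expr0 expr1 /= !expr0 !mulr1.
  split=> //; rewrite exprS exprS mulrA -expr2 sqr_i IH1 /= negbK mulN1r.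
  apply/eqP; rewrite eq_complex /= exprS mulN1r mulrN eqxx /=.
  case: (odd n) (odd_double_half n) => /= [|] e; last by rewrite !mul0r oppr0.
  move: e; set p := n./2 => <-; rewrite /= doubleK exprS mulN1r !mul1r //.
rewrite exprMn iE -rmorphXn -(rmorph_nat (real_complex R)) -fmorphV /=.
apply/eqP; rewrite eq_complex /= !(mulr0, mul0r, subr0, addr0, add0r).
by rewrite /cos_coeff /sin_coeff /= !eqxx.
Qed.

Lemma phase_real kap t : phase kap t%:C = expi (t * kap).
Proof.
apply: phase_unique.
have E n : phase_term kap t%:C n = cos_coeff (t * kap) n +i* sin_coeff (t * kap) n.
  rewrite -exp_i_coeff /phase_term /phase_coef mulrA -exprMn; congr (_ ^+ _ / _).
  by rewrite rmorphM mulrCA.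
apply: cvg_complexP => /=.
  under eq_fun do rewrite raddf_sum; under eq_fun do under eq_bigr do rewrite E /=.
  rewrite unlock; exact: is_cvg_series_cos_coeff.
under eq_fun do rewrite raddf_sum; under eq_fun do under eq_bigr do rewrite E /=.
rewrite unlock; exact: is_cvg_series_sin_coeff.
Qed.

Lemma phase_i kap : phase kap 'i%C = (expR (- kap))%:C.
Proof.
apply: phase_unique.
have E n : phase_term kap 'i%C n = (exp_coeff (- kap) n)%:C.
  rewrite /phase_term /phase_coef mulrA -exprMn mulrA -expr2 sqr_i mulN1r.
  by rewrite /exp_coeff /= [RHS]rmorphM rmorphXn fmorphV /= rmorph_nat rmorphN.
apply: cvg_complexP => /=.
  under eq_fun do rewrite raddf_sum; under eq_fun do under eq_bigr do rewrite E /=.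
  exact: is_cvg_series_exp_coeff.
under eq_fun do rewrite raddf_sum; under eq_fun do under eq_bigr do rewrite E /=.
by under eq_fun do rewrite big1 //; apply: cvg_cst.
Qed.

Lemma expiB x y : expi (x - y) = expi x * (expi y)^*.
Proof.
by apply/eqP; rewrite eq_complex /= cosB sinB mulrN opprK mulrN addrC eqxx /= addrC eqxx.
Qed.

End PhaseSeries.

Section IdentityTheorem.
Variables (R : realType) (A : cStarAlgType R).

Lemma geometric_half_le (t : R) (n : nat) : 0 <= t -> t <= 2^-1 ->
  \sum_(0 <= i < n) t ^+ i <= 2.
Proof.
move=> t0 t2; have t1 : 0 < 1 - t by lra.
have e : (1 - t) * \sum_(0 <= i < n) t ^+ i = 1 - t ^+ n.
  by rewrite -[in RHS](expr1n _ n) subrXX big_mkord; congr (_ * _); apply: eq_bigr => i _;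
    rewrite expr1n mul1r.
rewrite -(ler_pM2l t1) e; have := exprn_ge0 n t0; lra.
Qed.

(** If [d m] is the first nonzero coefficient, dividing by [t ^ m] bounds its norm by a
  multiple of [t], for all small [t]. *)
Lemma power_series_zero (d : nat -> A) :
  (forall t : R, series (fun n => t%:C ^+ n *: d n) @ \oo --> (0 : A)) -> forall n, d n = 0.
Proof.
move=> h.
have [M Mp dM] : exists2 M : R, 0 < M & forall n, `|d n| <= M%:C.
  have /cvg_series_cvg_0 : cvgn (series (fun n => (1 : R)%:C ^+ n *: d n)).
    by apply/cvg_ex; exists 0; apply: h.
  move=> /cvgrPdist_le/(_ 1 ltr01)[N _ dN].
  have re n : `|d n| = (complex.Re `|d n|)%:C by rewrite RRe_real // normr_real.
  exists (1 + \sum_(0 <= i < N) complex.Re `|d i|).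
    rewrite ltr_pwDl // sumr_ge0 // => i _.
    by rewrite -lecR -re normr_ge0.
  have Re0 i : 0 <= complex.Re `|d i| by rewrite -lecR -re normr_ge0.
  move=> n; have [nN|Nn] := ltnP n N.
    rewrite re lecR; rewrite big_mkord (bigD1 (Ordinal nN)) //= addrCA lerDl.
    by rewrite addr_ge0 // sumr_ge0.
  apply: (@le_trans _ _ 1); last by rewrite -[1]/((1 : R)%:C) lecR lerDl sumr_ge0.
  by have := dN n Nn; rewrite sub0r normrN rmorph1 expr1n scale1r.
have step m : (forall j, (j < m)%N -> d j = 0) -> d m = 0.
  move=> d0; apply: norm_le_eps0 => e e0.
  (* [t <= 1/2] bounds the geometric tail by 2, the other bound makes [2 M t <= e]. *)
  pose t := Num.min 2^-1 (e / (2 * M)).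
  have t0 : 0 < t by rewrite lt_min invr_gt0 ltr0Sn divr_gt0 // mulr_gt0.
  have t2 : t <= 2^-1 by rewrite ge_min lexx.
  have te : 2 * M * t <= e.
    by rewrite mulrC -ler_pdivlMr ?mulr_gt0 // ge_min lexx orbT.
  have tn n : `|t%:C ^+ n : R[i]| = (t ^+ n)%:C.
    by rewrite -rmorphXn /= normc_def /= expr0n addr0 sqrtr_sqr ger0_norm // exprn_ge0 ?ltW.
  have bd (N : nat) : `|series (fun n => t%:C ^+ n *: d n) (m.+1 + N)%N - t%:C ^+ m *: d m| <=
      (t ^+ m * (2 * M * t))%:C.
    rewrite /series /= (@big_cat_nat _ _ _ m) ?leq_addr //=; last first.
      by rewrite (leq_trans (leqnSn m)) // leq_addr.
    rewrite big_nat big1 ?add0r => [|i /andP[_ im]]; last by rewrite d0 // scaler0.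
    rewrite big_ltn ?ltn_addr // addrAC subrr add0r.
    rewrite -{1}[m.+1]add0n big_addn addKn.
    apply: le_trans (ler_norm_sum _ _ _) _.
    apply: (@le_trans _ _ (\sum_(0 <= i < N) (t ^+ m.+1 * M * t ^+ i)%:C)).
      apply: ler_sum => i _; rewrite normrZ tn addnC exprD.
      rewrite mulrAC [leRHS]rmorphM /= ler_wpM2l ?dM //.
      by rewrite ler0c mulr_ge0 ?exprn_ge0 ?ltW.
    rewrite -rmorph_sum lecR -mulr_sumr exprS.
    have -> : t ^+ m * (2 * M * t) = t * t ^+ m * M * 2 by ring.
    apply: ler_wpM2l (geometric_half_le N (ltW t0) t2).
    by rewrite ltW // !mulr_gt0 ?exprn_gt0.
  have lim0 : `|t%:C ^+ m *: d m| <= (t ^+ m * (2 * M * t))%:C.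
    apply/ler_addgt0Pr => -[e' e''] /=; rewrite ltcE /= => /andP[/eqP -> e'0].
    have /cvgrPdist_le/(_ (e' +i* 0)) := h t; rewrite ltcE /= eqxx e'0 => /(_ isT)[N _ /(_ (m.+1 + N)%N)].
    rewrite /= leq_addl => /(_ isT); rewrite sub0r normrN => hN.
    rewrite -[t%:C ^+ m *: d m](subKr (series (fun n => t%:C ^+ n *: d n) (m.+1 + N)%N)).
    apply: le_trans (ler_normB _ _) _; rewrite addrC; apply: lerD => //.
  move: lim0; rewrite normrZ tn rmorphM /= ler_pM2l ?ltcR ?exprn_gt0 // => lim0.
  by apply: le_trans lim0 _; rewrite lecR.
move=> n; elim/ltn_ind: n => n IH; apply: step => j; exact: IH.
Qed.

Lemma cvgZ_const (u : nat -> R[i]) (l : R[i]) (a : A) :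
  (u : nat -> R[i]^o) @ \oo --> (l : R[i]^o) -> (fun n => u n *: a) @ \oo --> l *: a.
Proof. by move=> ul; apply: cvgZl. Qed.

Lemma phase_entire kap (a : A) z :
  series (fun n => z ^+ n *: (phase_coef kap n *: a)) @ \oo --> phase kap z *: a.
Proof.
have -> : series (fun n => z ^+ n *: (phase_coef kap n *: a)) =
    (fun n => series (phase_term kap z) n *: a).
  apply/funext => n; rewrite /series /= scaler_suml; apply: eq_bigr => i _.
  by rewrite scalerA.
by apply: cvgZ_const; apply: phaseP.
Qed.

Section Extension.
Variables (alpha : R -> A -> A) (a : A) (kap : R).
Hypothesis alpha_a : forall t, alpha t a = expi (t * kap) *: a.

(** Two power series that agree on the real line have the same coefficients. *)
Lemma phase_extension_unique f : analytic_extension alpha a f ->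
  forall z, f z = phase kap z *: a.
Proof.
move=> [[c cf] fa] z.
have cE : forall n, c n - phase_coef kap n *: a = 0.
  apply: power_series_zero => t.
  have -> : series (fun n => t%:C ^+ n *: (c n - phase_coef kap n *: a)) =
     (fun N => series (fun n => t%:C ^+ n *: c n) N -
               series (fun n => t%:C ^+ n *: (phase_coef kap n *: a)) N).
    by apply/funext => N; rewrite /series /= -sumrB; apply: eq_bigr => i _; rewrite scalerBr.
  have -> : (0 : A) = f t%:C - phase kap t%:C *: a by rewrite fa phase_real alpha_a subrr.
  by apply: cvgB; [apply: cf|apply: phase_entire].
have ce n : c n = phase_coef kap n *: a by apply/eqP; rewrite -subr_eq0 cE.
have := cf z; have -> : c = (fun n => phase_coef kap n *: a) by apply/funext.
move=> h; apply: (@cvg_unique A _ (fmap _ \oo)) h _ => //.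
exact: phase_entire.
Qed.

End Extension.

End IdentityTheorem.

(** * States and the KMS condition on Toeplitz algebras *)

Section ToeplitzFunctionals.
Variables (R : realType) (k : nat) (L : kgraph k).
Hypothesis L_finite : kg_finite L.
Local Notation V := (kg_vtx L).
Local Notation M := (kg_mor L).
Variables (A : cStarAlgType R) (t : M -> A).
Hypothesis t_univ : toeplitz_algebra t.
Local Notation q v := (t (kg_id L v)).
Local Notation one := (toeplitz_one t).

Let tf : toeplitz_family t. Proof. by case: t_univ. Qed.

(** The zero set is a closed subspace, and the monomials span a dense one. *)
Lemma functional_zero (f : A -> R[i]) (C : R[i]) : scalar f ->
  (forall a, `|f a| <= C * `|a|) -> (forall mu nu, f (t mu ** star (t nu)) = 0) ->
  forall a, f a = 0.
Proof.
move=> fl fC fm; apply: (toeplitz_dense L_finite t_univ (S := [set a | f a = 0])) => //=.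
split => /=; first exact: scalar0.
  by move=> x a b fa fb; rewrite fl fa fb mulr0 addr0.
apply: (@closed_eq_lipschitz R A R[i]^o f C) => a b.
by rewrite -scalarB.
Qed.

Lemma monomial_span mu nu : toeplitz_span t (t mu ** star (t nu)).
Proof.
exists 1%N, (fun=> 1), (fun=> mu), (fun=> nu).
by rewrite big_ord1 scale1r.
Qed.

Lemma generator_monomial mu : t mu = t mu ** star (q (kg_src mu)).
Proof. by rewrite (toeplitz_qs tf) (toeplitz_t_q tf). Qed.

Lemma generator_span mu : toeplitz_span t (t mu).
Proof. by rewrite generator_monomial; apply: monomial_span. Qed.

Section Positive.
Variable phi : A -> R[i].
Hypotheses (phi_lin : scalar phi) (phi_pos : forall a, 0 <= phi (star a ** a)).

Lemma positive_one_ge0 : 0 <= phi one.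
Proof. by rewrite -(toeplitz_one_one tf) -{1}(toeplitz_one_star tf). Qed.

Let expand a (x : R[i]) : phi (star (a + x *: one) ** (a + x *: one)) =
  phi (star a ** a) + x * phi (star a) + x^* * phi a + x^* * x * phi one.
Proof.
rewrite starD starZ (toeplitz_one_star tf) cmulDl !cmulDr !cmulZl !cmulZr.
rewrite (toeplitz_one_one tf) (toeplitz_one_mul L_finite t_univ).
rewrite (toeplitz_mul_one L_finite t_univ) scalerA !(scalarD _ _ phi_lin) !(scalarZ _ _ phi_lin).
by rewrite !addrA.
Qed.

(** Polarisation: positivity at [a + one] and [a + i one] makes two combinations of [phi a]
  and [phi (star a)] real. *)
Lemma positive_star a : phi (star a) = (phi a)^*.
Proof.
have re b : complex.Im (phi (star b ** b)) = 0 by apply: ger0_Im.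
have Im1 := ger0_Im positive_one_ge0.
have := re (a + 1 *: one); have := re (a + 'i%C *: one).
rewrite !expand !raddfD /= re; move: Im1.
case: (phi (star a)) (phi a) (phi one) => [x y] [z w] [p p'] /= ->.
rewrite !(mulr0, mul0r, mulr1, mul1r, oppr0, subr0, addr0, add0r, mulNr, mulrN, opprK).
move=> e1 e2; apply/eqP; rewrite eq_complex /=.
apply/andP; split; apply/eqP; lra.
Qed.

End Positive.

(** Were [p = phi one] less than 1, positivity at [a - phi a *: one] would bound
  [`|phi a| ^ 2 * (2 - p)] by 1 on the unit ball, and the norm of [phi] would be below 1. *)
Lemma state_one phi : is_state phi -> phi one = 1.
Proof.
move=> [pl pp pn ps].
have p0 := positive_one_ge0 pp.
have pE : phi one = (complex.Re (phi one))%:C by rewrite RRe_real // ger0_real.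
set p := complex.Re (phi one) in pE.
have p1 : p <= 1.
  rewrite -lecR -pE; apply: le_trans (real_ler_norm (ger0_real p0)) _.
  by apply: le_trans (pn _) _; apply: norm_toeplitz_one.
suff p1' : 1 <= p by rewrite pE; congr (_ %:C); apply/le_anti; rewrite p1 p1'.
rewrite leNgt; apply/negP => plt.
have key a : `|a| <= 1 -> `|phi a| ^+ 2 * (2 - p)%:C <= 1.
  move=> a1; have := pp (a - phi a *: one).
  have -> : phi (star (a - phi a *: one) ** (a - phi a *: one)) =
      phi (star a ** a) - `|phi a| ^+ 2 * (2 - p)%:C.
    rewrite starB starZ (toeplitz_one_star tf) cmulBl !cmulBr !cmulZl !cmulZr.
    rewrite (toeplitz_one_one tf) (toeplitz_one_mul L_finite t_univ).
    rewrite (toeplitz_mul_one L_finite t_univ) scalerA !(scalarB _ _ pl) !(scalarZ _ _ pl).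
    have conjE (x : R[i]) : Num.conj x = conjc x by [].
    by rewrite (positive_star pl pp) pE sqr_normc rmorphB /= (rmorph_nat (real_complex R) 2) !conjE; ring.
  rewrite subr_ge0 => h; apply: le_trans h _.
  apply: le_trans (real_ler_norm _) _; first exact/ger0_real/pp.
  apply: le_trans (pn _) _; apply: le_trans (norm_cmul _ _) _; rewrite norm_star.
  by rewrite -expr2 expr_le1.
pose s : R := 2 - p.
have s1 : 1 < s by rewrite /s; lra.
(* Chosen so that [(1 - e) ^ 2 * s = 1 + e ^ 2 * s > 1]. *)
pose e : R := (s - 1) / (2 * s).
have e0 : 0 < e by rewrite /e divr_gt0 ?subr_gt0 // mulr_gt0 // (lt_trans ltr01).
have [a a1 pa] := ps e e0.
have := key a a1; apply/negP; rewrite -real_ltNge ?real1 //; last first.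
  by rewrite realM ?realX ?normr_real //; apply/complex_realP; eexists.
have e1 : e < 1 by rewrite /e ltr_pdivrMr; lra.
apply: (@lt_le_trans _ _ (((1 - e) ^+ 2) * s)%:C).
  rewrite ltcR.
  have es : e * (2 * s) = s - 1 by rewrite /e divfK // gt_eqF //; lra.
  have -> : (1 - e) ^+ 2 * s = 1 + e ^+ 2 * s.
    have -> : (1 - e) ^+ 2 * s = s - e * (2 * s) + e ^+ 2 * s by ring.
    by rewrite es; ring.
  by rewrite ltrDl mulr_gt0 ?exprn_gt0 //; lra.
rewrite rmorphM ler_wpM2r ?ler0c //=; first by lra.
rewrite rmorphXn lerXn2r ?nnegrE ?normr_ge0 ?ler0c ?ltW //=; by rewrite ?ltcR ?subr_gt0.
Qed.

End ToeplitzFunctionals.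

Section KMS.
Variables (R : realType) (k : nat) (L : kgraph k).
Hypothesis L_finite : kg_finite L.
Local Notation V := (kg_vtx L).
Local Notation M := (kg_mor L).
Variables (A : cStarAlgType R) (t : M -> A).
Hypothesis t_univ : toeplitz_algebra t.
Local Notation q v := (t (kg_id L v)).
Variables (r : 'I_k -> R) (alpha : R -> A -> A).
Hypothesis alpha_dyn : toeplitz_dynamics t r alpha.

Let tf : toeplitz_family t. Proof. by case: t_univ. Qed.

Definition kg_weight (l : M) : R := \sum_(i < k) r i * (kg_deg l i)%:R.

Lemma kg_weight_cmp l m : kg_src l = kg_rng m ->
  kg_weight (kg_cmp l m) = kg_weight l + kg_weight m.
Proof.
move=> lm; rewrite -big_split; apply: eq_bigr => i _ /=.
by rewrite kg_deg_cmp // degD natrD mulrDr.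
Qed.

Lemma kg_weight_edge i e : kg_deg e = kg_unit i -> kg_weight e = r i.
Proof.
move=> de; rewrite /kg_weight (bigD1 i) //= de ffunE eqxx mulr1 big1 ?addr0 // => j ji.
by rewrite ffunE (negbTE ji) mulr0.
Qed.

Definition boltzmann (l : M) : R := expR (- kg_weight l).

Lemma boltzmann_gt0 l : 0 < boltzmann l. Proof. exact: expR_gt0. Qed.

Lemma boltzmann_cmp l m : kg_src l = kg_rng m ->
  boltzmann (kg_cmp l m) = boltzmann l * boltzmann m.
Proof. by move=> lm; rewrite /boltzmann kg_weight_cmp // opprD expRD. Qed.

Lemma alpha_monomial mu nu x : alpha x (t mu ** star (t nu)) =
  expi (x * (kg_weight mu - kg_weight nu)) *: (t mu ** star (t nu)).
Proof.
have [[ah _ _ _] at_] := alpha_dyn; have [_ aM aS] := ah x.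
rewrite aM aS !at_ starZ cmulZl cmulZr scalerA; congr (_ *: _).
by rewrite mulrBr expiB.
Qed.

(** The adjoint of the hypothesis, as a positive functional is hermitian. *)
Lemma twisted_star (phi : A -> R[i]) nu : scalar phi ->
  (forall a, 0 <= phi (star a ** a)) ->
  (forall b, phi (t nu ** b) = (boltzmann nu)%:C * phi (b ** t nu)) ->
  forall b, phi (star (t nu) ** b) = ((boltzmann nu)^-1)%:C * phi (b ** star (t nu)).
Proof.
move=> pl pp tw b.
rewrite -[star (t nu) ** b]starK (positive_star L_finite t_univ pl pp) starM starK.
rewrite -[b ** star _]starK (positive_star L_finite t_univ pl pp) starM starK.
have conjB (x : R[i]) : conjc ((boltzmann nu)%:C * x) = (boltzmann nu)%:C * conjc x.
  by rewrite rmorphM /= oppr0.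
rewrite tw conjB mulrA -rmorphM /= mulVf ?rmorph1 ?mul1r //.
by rewrite gt_eqF ?boltzmann_gt0.
Qed.

Section OfKMS.
Variable Phi : A -> R[i].
Hypothesis Phi_KMS : KMS_state alpha (toeplitz_span t) 1 Phi.

Let Phi_state : is_state Phi. Proof. by case: Phi_KMS. Qed.
Let Phi_lin : scalar Phi. Proof. by case: Phi_state. Qed.
Let Phi_pos a : 0 <= Phi (star a ** a). Proof. by case: Phi_state. Qed.
Let Phi_norm a : `|Phi a| <= `|a|. Proof. by case: Phi_state. Qed.

(** The analytic extension of [t mu] is forced to be the phase of rate [kg_weight mu], with
  value [boltzmann mu] at [i]; the identity extends from monomials [b] by density. *)
Lemma kms_generator mu b : Phi (t mu ** b) = (boltzmann mu)%:C * Phi (b ** t mu).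
Proof.
apply/eqP; rewrite -subr_eq0; apply/eqP.
set c := (boltzmann mu)%:C.
apply: (functional_zero L_finite t_univ (f := fun b => Phi (t mu ** b) - c * Phi (b ** t mu))
    (C := `|t mu| + `|c| * `|t mu|)).
- move=> x a d; rewrite cmulDr cmulDl cmulZr cmulZl !Phi_lin; ring.
- move=> a; apply: le_trans (ler_normB _ _) _; rewrite mulrDl normrM.
  apply: lerD; first by apply: le_trans (Phi_norm _) _; apply: norm_cmul.
  rewrite -mulrA ler_wpM2l //; apply: le_trans (Phi_norm _) _.
  by rewrite mulrC norm_cmul.
move=> sg ta; have [_ h] := Phi_KMS.
have [f fext ->] := h _ _ (generator_span t_univ mu) (monomial_span t sg ta).
have [_ at_] := alpha_dyn.
have -> : f (0 +i* 1) = c *: t mu.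
  rewrite (@phase_extension_unique _ _ alpha (t mu) (kg_weight mu) _ f fext) //.
  by rewrite phase_i.
by rewrite cmulZr (scalarZ _ _ Phi_lin) subrr.
Qed.

Lemma kms_star_generator nu b :
  Phi (star (t nu) ** b) = ((boltzmann nu)^-1)%:C * Phi (b ** star (t nu)).
Proof. by apply: (twisted_star Phi_lin Phi_pos) => d; apply: kms_generator. Qed.

Hypothesis weight_inj : forall mu nu : M, kg_weight mu = kg_weight nu -> kg_deg mu = kg_deg nu.

(** If the degrees differ, moving [t mu] and then [star (t nu)] around multiplies the value
  by a ratio of Boltzmann factors other than 1. *)
Lemma kms_monomial mu nu : Phi (t mu ** star (t nu)) =
  if mu == nu then (boltzmann mu)%:C * Phi (q (kg_src mu)) else 0.
Proof.
have [d|d] := pselect (kg_deg mu = kg_deg nu).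
  rewrite kms_generator (toeplitz_star_mul_deg L_finite tf (esym d)) eq_sym.
  by case: eqP => [->//|_]; rewrite (scalar0 Phi_lin) mulr0.
case: eqP => [e|_]; first by case: d; rewrite e.
have e : Phi (t mu ** star (t nu)) =
    (boltzmann mu / boltzmann nu)%:C * Phi (t mu ** star (t nu)).
  by rewrite {1}kms_generator kms_star_generator mulrA -rmorphM.
apply/eqP; move/eqP: e; rewrite -{1}[Phi _]mul1r -subr_eq0 -mulrBl mulf_eq0.
case/orP => //; rewrite subr_eq0 -[1]/((1 : R)%:C) (inj_eq (@complexI R)) eq_sym => /eqP e.
case: d; apply: weight_inj; apply: oppr_inj; apply: expR_inj.
by apply/eqP; rewrite -subr_eq0 -[expR (- kg_weight mu)]/(boltzmann mu)
  -(divfK (lt0r_neq0 (boltzmann_gt0 nu)) (boltzmann mu)) e mul1r subrr.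
Qed.

(** The [i]-th vertex matrix, acting on functions of the vertices. *)
Definition vertex_op (i : 'I_k) (u : V -> R) (v : V) : R :=
  \sum_(e <- kg_edges L i | kg_rng e == v) u (kg_src e).

(** The product over [i] in [l] of the operators [1 - expR (- r i) * vertex_op i], that is,
  the trace left by [gap_seq l] on vertex weights. *)
Definition gap_vector (l : seq 'I_k) (u : V -> R) : V -> R :=
  foldr (fun i w v => w v - expR (- r i) * vertex_op i w v) u l.

Definition vertex_weight (v : V) : R := complex.Re (Phi (q v)).

Lemma q_pos v : 0 <= Phi (q v).
Proof.
have := Phi_pos (q v); rewrite (toeplitz_qs tf).
by rewrite (toeplitz_qq tf) eqxx.
Qed.

Lemma vertex_weightE v : Phi (q v) = (vertex_weight v)%:C.
Proof. by rewrite /vertex_weight RRe_real // ger0_real // q_pos. Qed.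

Lemma vertex_weight_ge0 v : 0 <= vertex_weight v.
Proof. by rewrite -lecR -vertex_weightE q_pos. Qed.

Lemma vertex_weight_sum : \sum_v vertex_weight v = 1.
Proof.
apply: complexI; rewrite rmorph_sum /= rmorph1 -(state_one L_finite t_univ Phi_state).
rewrite (scalar_sum _ _ _ Phi_lin); apply: eq_bigr => v _.
by rewrite vertex_weightE.
Qed.

(** The KMS condition turns each summand of [edge_map] at [e] into [expR (- r i)] times the
  value at the source of [e]. *)
Lemma kms_gap l v : uniq l ->
  Phi (q v ** gap_seq t l) = (gap_vector l vertex_weight v)%:C.
Proof.
elim: l v => [|i l IH] v /=.
  by rewrite (toeplitz_mul_one L_finite t_univ) vertex_weightE.
move=> /andP[il ul]; rewrite cmulBr (scalarB _ _ Phi_lin) IH // rmorphB; congr (_ - _).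
rewrite cmul_sumr (scalar_sum _ _ _ Phi_lin) rmorphM rmorph_sum mulr_sumr /=.
rewrite [RHS]big_mkcond /=; apply: eq_big_seq => e; rewrite kg_edgesP // => /eqP de.
rewrite !cmulA (toeplitz_q_mul tf) eq_sym; case: eqP => [rv|_]; last first.
  by rewrite !cmul0l (scalar0 Phi_lin).
rewrite -cmulA kms_generator /boltzmann (kg_weight_edge de); congr (_ * _).
rewrite -cmulA (toeplitz_star_self tf) -(gap_q tf).
exact: IH.
Qed.

(** [gap_seq] cut down to a vertex is a projection. *)
Lemma kms_gap_ge0 l v : uniq l -> 0 <= gap_vector l vertex_weight v.
Proof.
move=> ul; rewrite -lecR -kms_gap // -(gap_q_idem L_finite tf v ul).
have {1}-> : q v ** gap_seq t l = star (q v ** gap_seq t l); last exact: Phi_pos.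
by rewrite starM (gap_star tf) (toeplitz_qs tf) (gap_q tf).
Qed.

End OfKMS.

(** Moving [t mu] and then [star (t nu)] past [b] costs the ratio of their Boltzmann factors,
  which is the value at [i] of the phase of [alpha] on the monomial. *)
Lemma kms_of_generator (phi : A -> R[i]) : is_state phi ->
  (forall mu b, phi (t mu ** b) = (boltzmann mu)%:C * phi (b ** t mu)) ->
  KMS_state alpha (toeplitz_span t) 1 phi.
Proof.
move=> st tw; split=> // a b [n [c [mu [nu ->]]]] _.
have [pl pp _ _] := st.
have tw' nu' d : phi (star (t nu') ** d) = ((boltzmann nu')^-1)%:C * phi (d ** star (t nu')).
  by apply: (twisted_star pl pp) => b'.
pose m j := t (mu j) ** star (t (nu j)).
pose kap j := kg_weight (mu j) - kg_weight (nu j).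
exists (fun z => \sum_(j < n) c j *: (phase (kap j) z *: m j)).
  split.
    exists (fun p => \sum_(j < n) c j *: (phase_coef (kap j) p *: m j)) => z.
    have -> : series (fun p => z ^+ p *: \sum_(j < n) c j *: (phase_coef (kap j) p *: m j)) =
        (fun N => \sum_(j < n) c j *: series (fun p => z ^+ p *: (phase_coef (kap j) p *: m j)) N).
      apply/funext => N; rewrite /series /=; under [RHS]eq_bigr do rewrite scaler_sumr.
      rewrite exchange_big /=; apply: eq_bigr => p _; rewrite scaler_sumr.
      by apply: eq_bigr => j _; rewrite scalerA mulrC -scalerA.
    elim: (index_enum _) => [|j s IH].
      by rewrite big_nil; under eq_fun do rewrite big_nil; apply: cvg_cst.
    rewrite big_cons; under eq_fun do rewrite big_cons.
    by apply: cvgD => //; apply: cvgZr; apply: phase_entire.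
  move=> x; have [[ah _ _ _] _] := alpha_dyn.
  rewrite (star_hom_sum _ _ _ (ah x)); apply: eq_bigr => j _.
  by rewrite (star_homZ _ _ (ah x)) alpha_monomial phase_real.
rewrite cmul_suml cmul_sumr !(scalar_sum _ _ _ pl); apply: eq_bigr => j _.
rewrite cmulZl !cmulZr !(scalarZ _ _ pl) phase_i; congr (_ * _).
rewrite /m -cmulA tw -cmulA tw' mulrA -rmorphM cmulA; congr (_%:C * _).
by rewrite /boltzmann /kap opprB expRD mulrC expRN invrK.
Qed.

End KMS.

(** * Nonnegative matrices *)

Section Matrices.
Variable R : realType.

Lemma left_eigenvalue n (A : 'M[R]_n) (w : 'cV[R]_n) (a : R) :
  w != 0 -> A *m w = a *: w -> eigenvalue A a.
Proof.
move=> w0 Aw; rewrite /eigenvalue /eigenspace kermx_eq0 row_free_unit.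
apply: contra w0 => U; rewrite -(mulKmx U w) mulmxBl Aw mul_scalar_mx subrr mulmx0.
exact: eqxx.
Qed.

Lemma eigenvalue_norm_le n (A : 'M[R[i]]_n) (a : R[i]) : eigenvalue A a ->
  `|a| <= \sum_i \sum_j `|A i j|.
Proof.
move=> /eigenvalueP[v vA v0].
have vn : 0 < \sum_j `|v 0 j|.
  rewrite lt_neqAle sumr_ge0 // andbT eq_sym; apply: contra v0 => /eqP s0.
  apply/eqP/rowP => j; rewrite mxE; apply/eqP; rewrite -normr_eq0; apply/eqP.
  by move/psumr_eq0P: s0; apply.
rewrite -(ler_pM2r vn) mulr_sumr.
under eq_bigr => j _.
  rewrite -normrM; have -> : a * v 0 j = (v *m A) 0 j by rewrite vA mxE.
  over.
apply: (@le_trans _ _ (\sum_j \sum_i `|v 0 i| * `|A i j|)).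
  apply: ler_sum => j _; rewrite mxE; apply: le_trans (ler_norm_sum _ _ _) _.
  by apply: ler_sum => i _; rewrite normrM.
rewrite exchange_big /= mulr_suml; apply: ler_sum => i _.
rewrite -mulr_sumr mulrC ler_wpM2l ?sumr_ge0 //.
by rewrite (bigD1 i) //= lerDl sumr_ge0.
Qed.

Lemma real_eigenvalue_le n (A : 'M[R]_n) (w : 'cV[R]_n) (a : R) :
  w != 0 -> A *m w = a *: w -> a <= spectral_radius A.
Proof.
move=> w0 Aw; apply: le_trans (ler_norm a) _; apply: ub_le_sup; last first.
  exists a%:C; last by rewrite normc_def /= expr0n addr0 sqrtr_sqr.
  rewrite eigenvalue_root_char -map_char_poly fmorph_root -eigenvalue_root_char.
  exact: left_eigenvalue Aw.
exists (complex.Re (\sum_i \sum_j `|map_mx (real_complex R) A i j|)) => x [b /eigenvalue_norm_le bA xb].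
by rewrite -lecR xb RRe_real //; apply: ger0_real; rewrite !sumr_ge0 // => i _; rewrite sumr_ge0.
Qed.

(** Minimum of 1 and of finitely many polynomial values: the quantity to which the
  intermediate value theorem is applied in [nonneg_resolvent]. *)
Definition min_poly_val (s : seq {poly R}) (t : R) : R :=
  foldr (fun p m => Num.min p.[t] m) 1 s.

Lemma min_poly_val_le s t p : p \in s -> min_poly_val s t <= p.[t].
Proof.
elim: s => //= a s IH; rewrite inE ge_min => /orP[/eqP ->|/IH ->]; first by rewrite lexx.
by rewrite orbT.
Qed.

Lemma min_poly_val_ex s t :
  min_poly_val s t = 1 \/ exists2 p, p \in s & min_poly_val s t = p.[t].
Proof.
elim: s => [|a s IH] /=; first by left.
rewrite /Num.min; case: ifP => _; first by right; exists a; rewrite ?mem_head.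
by case: IH => [->|[p ps e]]; [left|right; exists p; rewrite ?inE ?ps ?orbT].
Qed.

Lemma continuous_min_poly (s : seq {poly R}) :
  continuous (min_poly_val s : R -> R).
Proof.
elim: s => [|p s IH] t; first exact: cvg_cst.
have -> : min_poly_val (p :: s) =
   (fun t : R => (p.[t] + min_poly_val s t
      - `|p.[t] - min_poly_val s t|) * 2^-1).
  by apply/funext => x; rewrite /= -minr_absE.
apply: cvgMl; apply: cvgB.
  by apply: cvgD; [exact: continuous_horner|exact: IH].
by apply: cvg_norm; apply: cvgB; [exact: continuous_horner|exact: IH].
Qed.

(** If no [1 - t B] with [t] in the unit interval is singular, the solution of
  [u = 1 + t B u] cannot lose positivity as [t] grows from 0 to 1: where it first
  vanishes it would be nonnegative, hence at least 1. *)
Lemma nonneg_resolvent n (B : 'M[R]_n) : (forall i j, 0 <= B i j) ->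
  (forall t, 0 <= t <= 1 -> 1%:M - t *: B \in unitmx) ->
  exists u : 'cV[R]_n, (forall i, 0 <= u i 0) /\ u = const_mx 1 + B *m u.
Proof.
move=> B0 Bu.
(* By Cramer's rule, [p i] over [q] is the solution of [u = 1 + t B u] as a function of [t]. *)
pose P : 'M[{poly R}]_n := 1%:M - 'X *: map_mx polyC B.
have PE t : map_mx (horner_eval t) P = 1%:M - t *: B.
  apply/matrixP => i j; rewrite !mxE /horner_eval !hornerE /=.
  by case: (i == j); rewrite ?hornerE.
pose q := \det P; pose p (i : 'I_n) : {poly R} := (\adj P *m const_mx 1 : 'cV_n) i 0.
have qE t : q.[t] = \det (1%:M - t *: B) by rewrite -PE det_map_mx.
have sol t : (1%:M - t *: B) *m (\col_i (p i).[t]) = q.[t] *: const_mx 1.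
  have -> : \col_i (p i).[t] = \adj (1%:M - t *: B) *m const_mx 1.
    apply/colP => j; rewrite mxE /p -PE -map_mx_adj.
    have -> : const_mx 1 = map_mx (horner_eval t) (const_mx 1 : 'cV_n).
      by apply/colP => l; rewrite !mxE /horner_eval hornerC.
    by rewrite -map_mxM [in RHS]mxE.
  by rewrite mulmxA mul_mx_adj qE mul_scalar_mx.
have solE t i : (p i).[t] = q.[t] + t * \sum_j B i j * (p j).[t].
  have /colP/(_ i) := sol t; rewrite mulmxBl mul1mx !mxE mulr1 => /eqP.
  rewrite subr_eq => /eqP ->; congr (_ + _); rewrite mulr_sumr.
  by apply: eq_bigr => j _; rewrite !mxE mulrA.
have q0 t : 0 <= t <= 1 -> q.[t] != 0.
  by move=> /Bu; rewrite qE unitmxE unitfE.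
have q00 : q.[0] = 1 by rewrite qE scale0r subr0 det1.
have qpos t : 0 <= t <= 1 -> 0 < q.[t].
  move=> /andP[t0 t1]; rewrite ltNge; apply/negP => qt.
  have [||c] := @IVT R (horner q) 0 t 0 t0.
  - by apply: continuous_subspaceT => x; apply: continuous_horner.
  - by rewrite q00 ge_min qt orbT le_max ler01.
  rewrite in_itv /= => /andP[c0 ct] qc.
  by have := q0 c; rewrite c0 (le_trans ct t1) qc eqxx => /(_ isT).
pose s := [seq p i | i <- enum 'I_n].
have ps i : p i \in s by apply: map_f; rewrite mem_enum.
have p0 i : (p i).[0] = 1 by rewrite solE mul0r addr0.
have g0 : min_poly_val s 0 = 1.
  have [//|[_ /mapP[i _ ->] ->]] := min_poly_val_ex s 0; exact: p0.
have g1 : 0 <= min_poly_val s 1.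
  rewrite leNgt; apply/negP => g1.
  have [||c] := @IVT R (min_poly_val s) 0 1 0 ler01.
  - by apply: continuous_subspaceT => x; apply: continuous_min_poly.
  - by rewrite g0 ge_min (ltW g1) orbT le_max ler01.
  rewrite in_itv /= => c01 gc.
  have pc j : 0 <= (p j).[c] by rewrite -gc min_poly_val_le.
  have [e|[_ /mapP[i _ ->] e]] := min_poly_val_ex s c.
    by move/eqP: gc; rewrite e oner_eq0.
  have := qpos c c01; apply/negP; rewrite -leNgt -gc e solE lerDl.
  by rewrite mulr_ge0 ?sumr_ge0 //; [case/andP: c01|move=> j _; rewrite mulr_ge0].
have q1 : 0 < q.[1] by apply: qpos; rewrite ler01 lexx.
exists (\col_i ((p i).[1] / q.[1])); split => [i|].
  by rewrite mxE divr_ge0 ?(ltW q1) //; apply: le_trans g1 (min_poly_val_le _ _).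
apply/colP => i; rewrite !mxE {1}solE mul1r mulrDl divff ?gt_eqF //; congr (_ + _).
by rewrite mulr_suml; apply: eq_bigr => j _; rewrite !mxE mulrA.
Qed.

End Matrices.

(** * Vertex matrices of a k-graph *)

Section VertexOperators.
Variables (R : realType) (k : nat) (L : kgraph k).
Hypothesis L_finite : kg_finite L.
Local Notation V := (kg_vtx L).
Local Notation M := (kg_mor L).
Implicit Types (u : V -> R) (v w : V) (C D X Y : {set V}).

Lemma vertex_op_vmx i X Y u (a : 'I_#|X|) :
  (vmx R X Y i *m restrict_cv u Y) a 0 =
  \sum_(e <- kg_edges L i | (kg_rng e == enum_val a) && (kg_src e \in Y)) u (kg_src e).
Proof.
rewrite mxE (partition_big (@kg_src k L) (mem Y)) /=; last by move=> e /andP[].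
rewrite [RHS]big_enum_val; apply: eq_bigr => b _; rewrite !mxE.
rewrite (eq_bigr (fun=> u (enum_val b))); last by move=> e /andP[_ /eqP ->].
rewrite big_const_seq iter_addr_0 -[RHS]mulr_natl; congr (_ * _); apply: congr1.
rewrite -size_filter -[LHS]/(size (enum_fset _)); apply: perm_size; apply: uniq_perm.
- exact: fset_uniq.
- by rewrite filter_uniq // fset_uniq.
move=> e; rewrite mem_filter kg_edgesP // in_fset_set; last first.
  by apply: sub_finite_set (kg_edges_finite L_finite i) => l [].
apply/idP/idP; rewrite inE.
  by move=> [-> -> ->]; rewrite !eqxx enum_valP.
by move=> /andP[/andP[/andP[/eqP re _] /eqP se] /eqP de].
Qed.

Lemma vertex_opD i u u' v : vertex_op i (fun w => u w + u' w) v = vertex_op i u v + vertex_op i u' v.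
Proof. exact: big_split. Qed.

Lemma vertex_opZ i (c : R) u v : vertex_op i (fun w => c * u w) v = c * vertex_op i u v.
Proof. by rewrite /vertex_op mulr_sumr. Qed.

Lemma gap_vectorD r l u u' v : gap_vector r l (fun x => u x + u' x) v =
  gap_vector r l u v + gap_vector r l u' v.
Proof.
elim: l v => [//|i l IH] v /=; rewrite IH.
have -> : vertex_op i (gap_vector r l (fun x => u x + u' x)) v =
   vertex_op i (gap_vector r l u) v + vertex_op i (gap_vector r l u') v.
  by rewrite -vertex_opD; apply: eq_bigr => e _.
by ring.
Qed.

Lemma gap_vectorZ r l (c : R) u v : gap_vector r l (fun x => c * u x) v =
  c * gap_vector r l u v.
Proof.
elim: l v => [//|i l IH] v /=; rewrite IH.
have -> : vertex_op i (gap_vector r l (fun x => c * u x)) v =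
   c * vertex_op i (gap_vector r l u) v.
  by rewrite -vertex_opZ; apply: eq_bigr => e _.
by ring.
Qed.

Lemma vertex_op_eq i u u' v : (forall w, kg_le v w -> u w = u' w) ->
  vertex_op i u v = vertex_op i u' v.
Proof. by move=> uu'; apply: eq_bigr => e /eqP re; apply: uu'; exists e. Qed.

Lemma vmx_mul_restrict i X u (a : 'I_#|X|) : (forall w, w \notin X -> kg_le (enum_val a) w -> u w = 0) ->
  (vmx R X X i *m restrict_cv u X) a 0 = vertex_op i u (enum_val a).
Proof.
move=> u0; rewrite vertex_op_vmx [RHS](bigID (fun e => kg_src e \in X)) /=.
rewrite [X in _ = _ + X]big1 ?addr0 // => e /andP[/eqP re se].
by apply: u0 => //; exists e.
Qed.

End VertexOperators.

Lemma singular_right_kernel (K : fieldType) n (A : 'M[K]_n) :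
  A \notin unitmx -> exists2 w : 'cV[K]_n, w != 0 & A *m w = 0.
Proof.
rewrite -unitmx_tr -row_free_unit -kermx_eq0 => /rowV0Pn[v /sub_kermxP vA v0].
exists v^T; first by rewrite -(inj_eq (@trmx_inj _ _ _)) trmxK trmx0.
by apply: trmx_inj; rewrite trmx_mul trmxK vA trmx0.
Qed.

(** * Spectral gap off the dominant component *)

Section SpectralGap.
Variables (R : realType) (k : nat) (L : kgraph k).
Hypothesis L_finite : kg_finite L.
Local Notation V := (kg_vtx L).
Local Notation M := (kg_mor L).
Implicit Types (u : V -> R) (v w : V) (X C : {set V}).
Variable D : {set V}.
Hypotheses (rho_gt1 : forall i : 'I_k, 1 < rho R L i) (D_her : kg_hereditary D).
Hypothesis D_dom : forall (i : 'I_k) (C : {set V}),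
  kg_nontrivial_component C -> C <> D -> rho_on R C i < rho R L i.

(** An eigenfunction vanishing on [D] restricts to an eigenvector of some component
  other than [D]: take a vertex of the support that reaches as little of the support
  as possible. *)
Lemma eigenfunction_off_dominant i u (a : R) : (forall v, v \in D -> u v = 0) ->
  (forall v, vertex_op i u v = a * u v) -> rho R L i <= a -> forall v, u v = 0.
Proof.
move=> uD ua ra v0; apply/eqP/negP => /negP uv0.
pose reach v : {set V} := finset (fun w => `[< kg_le v w >] && (u w != 0)).
have [v uv vmin] := @arg_minnP V v0 (fun v => u v != 0) (fun v => #|reach v|) uv0.
have back w : kg_le v w -> u w != 0 -> kg_le w v.
  move=> vw uw.
  have sub : reach w \subset reach v.
    apply/fintype.subsetP => x; rewrite !inE => /andP[/asboolP wx ->]; rewrite andbT.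
    by apply/asboolP; apply: kg_le_trans vw wx.
  have e : reach w = reach v by apply/eqP; rewrite eqEcard sub vmin.
  have : v \in reach w by rewrite e inE uv andbT; apply/asboolP; apply: kg_lexx.
  by rewrite inE => /andP[/asboolP].
pose C : {set V} := finset (fun w => `[< kg_le v w /\ kg_le w v >]).
have CP w : (w \in C) <-> (kg_le v w /\ kg_le w v).
  by rewrite inE; split => /asboolP.
have vC : v \in C by apply/CP; split; apply: kg_lexx.
have CD : C <> D by move=> e; case/eqP: uv; apply: uD; rewrite -e.
have Ccomp : kg_component C by exists v.
have [[v' Cv' loops]|nt] := pselect (kg_trivial C).
  have vv' : v = v' by move: vC; rewrite Cv' inE => /eqP.
  have : a * u v = 0.
    rewrite -ua /vertex_op big_seq_cond big1 // => e /andP[eE /eqP re].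
    apply/eqP/negP => /negP ue.
    have ve : kg_le v (kg_src e) by exists e.
    have : kg_src e \in C by apply/CP; split => //; apply: back.
    rewrite Cv' inE -vv' => /eqP se.
    move: eE; rewrite kg_edgesP // (loops e) -?vv' // kg_deg_id => /eqP/ffunP/(_ i).
    by rewrite !ffunE eqxx.
  move/eqP; rewrite mulf_eq0 (negbTE uv) orbF => /eqP a0.
  by have := lt_le_trans (rho_gt1 i) ra; rewrite a0 ltr10.
have : a <= rho_on R C i.
  apply: (real_eigenvalue_le (w := restrict_cv u C)).
    apply: contraNneq uv => /colP/(_ (enum_rank_in vC v)).
    by rewrite !mxE enum_rankK_in // => ->.
  apply/colP => b; rewrite vmx_mul_restrict // => [|w wC bw].
    by rewrite ua !mxE.
  have /CP[vb _] := enum_valP b.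
  apply/eqP/negP => /negP uw; case/negP: wC; apply/CP.
  have vw := kg_le_trans vb bw.
  by split => //; apply: back.
by apply/negP; rewrite -ltNge; apply: lt_le_trans ra; apply: D_dom.
Qed.

Lemma extend_cv X (w : 'cV[R]_#|X|) :
  exists2 u, restrict_cv u X = w & forall v, v \notin X -> u v = 0.
Proof.
exists (fun v => \sum_(b < #|X|) (if enum_val b == v then w b 0 else 0)).
  apply/colP => a; rewrite mxE (bigD1 a) //= eqxx big1 ?addr0 // => b ba.
  by rewrite (inj_eq enum_val_inj) (negbTE ba).
move=> v vX; rewrite big1 // => b _; case: eqP => // e.
by move: vX; rewrite -e enum_valP.
Qed.

(** A kernel vector, extended by zero, would be an eigenfunction vanishing on [D]. *)
Lemma vmx_resolvent_unit X i (c : R) : (forall v, v \in X -> v \notin D) ->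
  (forall v w, v \notin X -> w \in X -> ~ kg_le v w) -> rho R L i <= c ->
  c%:M - vmx R X X i \in unitmx.
Proof.
move=> XD Xcl rc; apply/negPn/negP => /singular_right_kernel[w w0].
rewrite mulmxBl mul_scalar_mx => /eqP; rewrite subr_eq0 => /eqP cw.
have [u uw u0] := extend_cv w.
have uz : forall v, u v = 0.
  apply: (eigenfunction_off_dominant (i := i) (a := c)) => //.
    by move=> v vD; apply: u0; apply/negP => /XD; rewrite vD.
  move=> v; have [vX|vX] := boolP (v \in X).
    have := congr1 (fun x : 'cV_#|X| => x (enum_rank_in vX v) 0) cw.
    rewrite -uw vmx_mul_restrict // => [|x xX _]; last exact: u0.
    by rewrite !mxE enum_rankK_in.
  rewrite (u0 _ vX) mulr0.
  have -> : vertex_op i u v = vertex_op i (fun=> 0) v; last by rewrite /vertex_op big1.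
  apply: vertex_op_eq => x vx; by apply: u0; apply/negP => xX; apply: (Xcl v x).
case/eqP: w0; rewrite -uw; apply/colP => b; rewrite !mxE; exact: uz.
Qed.

Definition off : {set V} := ~: D.

Lemma off_her v w : v \notin off -> w \in off -> ~ kg_le v w.
Proof. by rewrite !inE negbK => vD wD vw; move/negP: wD; apply; apply: D_her vD vw. Qed.

Lemma rho_gt0 i : 0 < rho R L i. Proof. exact: lt_trans ltr01 (rho_gt1 i). Qed.

(** [nonneg_resolvent] applies off [D] because no multiple of the vertex matrix by a factor
  up to the inverse of [rho] has eigenvalue 1 there. *)
Lemma supersolution i : exists u : V -> R, [/\ (forall v, 0 <= u v),
  (forall v, v \in D -> u v = 0)
  & forall v, v \notin D -> u v = 1 + (rho R L i)^-1 * vertex_op i u v].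
Proof.
have r0 := rho_gt0 i.
have [||w [w0 wE]] := @nonneg_resolvent R _ ((rho R L i)^-1 *: vmx R off off i).
- by move=> a b; rewrite !mxE mulr_ge0 // invr_ge0 ltW.
- move=> t /andP[t0 t1]; have [->|tn] := eqVneq t 0.
    by rewrite scale0r subr0 unitmx1.
  have tp : 0 < t by rewrite lt_neqAle eq_sym tn.
  have -> : 1%:M - t *: ((rho R L i)^-1 *: vmx R off off i) =
      (t / rho R L i) *: ((rho R L i / t)%:M - vmx R off off i).
    rewrite scalerBr scale_scalar_mx scalerA mulrA divfK ?gt_eqF // divff //.
  rewrite unitmxZ ?unitfE ?gt_eqF ?divr_gt0 //.
  apply: vmx_resolvent_unit; [by move=> v; rewrite inE|exact: off_her|].
  by rewrite ler_pdivlMr // ler_piMr // ltW.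
have [u uw u0] := extend_cv w.
exists u; split.
- move=> v; have [vX|/u0 -> //] := boolP (v \in off).
  have := w0 (enum_rank_in vX v).
  by rewrite -uw mxE enum_rankK_in.
- by move=> v vD; apply: u0; rewrite inE vD.
move=> v vD; have vX : v \in off by rewrite inE.
have := congr1 (fun x : 'cV_#|off| => x (enum_rank_in vX v) 0) wE.
rewrite -uw -scalemxAl [LHS]mxE enum_rankK_in // => ->.
rewrite [LHS]mxE [X in X + _]mxE [X in _ + X]mxE vmx_mul_restrict ?enum_rankK_in //.
by move=> x xX _; apply: u0.
Qed.

End SpectralGap.

(** * Path sums and the Perron-Frobenius data *)

Section PathSums.
Variables (R : realType) (k : nat) (L : kgraph k).
Hypothesis L_finite : kg_finite L.
Local Notation V := (kg_vtx L).
Local Notation M := (kg_mor L).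
Implicit Types (u : V -> R) (v w : V) (X C : {set V}).
Variable D : {set V}.
Hypotheses (rho_gt1 : forall i : 'I_k, 1 < rho R L i) (D_her : kg_hereditary D).
Hypothesis D_dom : forall (i : 'I_k) (C : {set V}),
  kg_nontrivial_component C -> C <> D -> rho_on R C i < rho R L i.

(** With these rates, [boltzmann] of a path of degree [n] is the product of the [rho ^ - n]. *)
Definition preferred (i : 'I_k) : R := ln (rho R L i).

Lemma expR_preferred i : expR (- preferred i) = (rho R L i)^-1.
Proof. by rewrite expRN lnK // posrE rho_gt0. Qed.

Local Notation bz := (boltzmann preferred).

Lemma boltzmann_id v : bz (kg_id L v) = 1.
Proof.
rewrite /boltzmann /kg_weight big1 ?oppr0 ?expR0 // => i _.
by rewrite kg_deg_id ffunE mulr0.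
Qed.

(** Induction on the colours that may occur. A path with an edge of colour [i] can be written
  with such an edge in front, so the sum over all paths is dominated by a solution of
  [U = C + rho^-1 * vertex_op i U], where [C] bounds the sum over the paths without [i]. *)
Lemma path_sum_bound_colours (l : seq 'I_k) : exists U : V -> R, forall v, 0 <= U v /\
  forall F : {fset M}, (forall a, a \in F -> kg_src a \notin D /\
     forall i, (0 < kg_deg a i)%N -> i \in l) ->
  \sum_(a <- F | kg_rng a == v) bz a <= U v.
Proof.
elim: l => [|i l [Ul UlP]].
  exists (fun=> 1) => v; split=> // F FP.
  rewrite -big_filter; set s := [seq a <- F | _].
  have sP a : a \in s -> a = kg_id L v.
    rewrite mem_filter => /andP[/eqP <- aF]; apply: kg_deg0; apply/ffunP => i.
    rewrite ffunE; apply/eqP; rewrite -leqn0 leqNgt; apply/negP => ai.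
    by have [_ /(_ i ai)] := FP a aF.
  have : uniq s by rewrite filter_uniq // fset_uniq.
  case: s sP => [|a [|b s]] sP; first by rewrite big_nil.
    by rewrite big_seq1 (sP a) ?mem_head // boltzmann_id.
  by rewrite /= (sP a) ?mem_head // (sP b) ?inE ?eqxx ?orbT.
have [u [u0 uD uE]] := supersolution L_finite rho_gt1 D_her D_dom i.
pose C := \sum_v Ul v.
have C0 : 0 <= C by apply: sumr_ge0 => v _; case: (UlP v).
have UC v : Ul v <= C.
  by rewrite /C (bigD1 v) //= lerDl sumr_ge0 // => w _; case: (UlP w).
pose w := (rho R L i)^-1.
have w0 : 0 <= w by rewrite invr_ge0 ltW // rho_gt0.
have UE v : v \notin D -> C * u v = C + w * vertex_op i (fun x => C * u x) v.
  by move=> vD; rewrite uE // vertex_opZ mulrDr mulr1 mulrCA.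
have vop0 v : 0 <= vertex_op i (fun x => C * u x) v.
  by apply: sumr_ge0 => e _; rewrite mulr_ge0.
exists (fun v => C * u v) => v; split; first by rewrite mulr_ge0.
(* Induction on a bound for the degree in the colour [i]. *)
suff key n : forall v (F : {fset M}), (forall a, a \in F -> [/\ kg_src a \notin D,
     forall j, (0 < kg_deg a j)%N -> j \in i :: l & (kg_deg a i <= n)%N]) ->
   \sum_(a <- F | kg_rng a == v) bz a <= C * u v.
  move=> F FP; apply: (key (\sum_(a <- F) kg_deg a i)%N) => a aF.
  have [h1 h2] := FP a aF; split => //.
  by rewrite (bigD1_seq a) ?fset_uniq //= leq_addr.
elim: n => [|n IH] {}v F FP.
  have [vD|vD] := boolP (v \in D).
    rewrite uD // mulr0 big_seq_cond big1 // => a /andP[aF /eqP ra].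
    have [sD _ _] := FP a aF; case/negP: sD; apply: D_her vD _; by exists a.
  rewrite UE //; apply: le_trans (_ : C <= _); last by rewrite lerDl mulr_ge0.
  apply: le_trans (UC v); have [_] := UlP v; apply => a aF.
  have [h1 h2 h3] := FP a aF; split=> // j aj.
  have := h2 j aj; rewrite inE => /orP[/eqP ji|//].
  by move: aj h3; rewrite ji leqn0 => /[swap] /eqP ->.
have [vD|vD] := boolP (v \in D).
  rewrite uD // mulr0 big_seq_cond big1 // => a /andP[aF /eqP ra].
  have [sD _ _] := FP a aF; case/negP: sD; apply: D_her vD _; by exists a.
rewrite (bigID (fun a => kg_deg a i == 0%N)) /= UE //; apply: lerD.
  apply: le_trans (UC v); have [_ h] := UlP v.
  have -> : \sum_(a <- F | (kg_rng a == v) && (kg_deg a i == 0%N)) bz a =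
      \sum_(a <- [fset a in F | kg_deg a i == 0%N]%fset | kg_rng a == v) bz a.
    rewrite -big_filter -[RHS]big_filter; apply: perm_big; apply: uniq_perm.
    - by rewrite filter_uniq // fset_uniq.
    - by rewrite filter_uniq // fset_uniq.
    by move=> a; rewrite !mem_filter !inE /= andbCA andbA andbC andbA.
  apply: h => a; rewrite !inE /= => /andP[aF /eqP a0].
  have [h1 h2 _] := FP a aF; split=> // j aj.
  by have := h2 j aj; rewrite inE => /orP[/eqP ji|//]; move: aj; rewrite ji a0.
(* Split off a first edge of colour [i] from each of the remaining paths. *)
apply: (@le_trans _ _ (\sum_(a <- F) \sum_(e <- kg_edges L i | kg_rng e == v)
   w * oapp bz 0 (kg_div e a))).
  rewrite big_mkcond /=; rewrite big_seq [leRHS]big_seq; apply: ler_sum => a aF.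
  have nn e : 0 <= w * oapp bz 0 (kg_div e a).
    by rewrite mulr_ge0 //; case: kg_div => //= b; rewrite ltW // boltzmann_gt0.
  case: andP => [[/eqP ra ai]|_]; last by rewrite sumr_ge0.
  have [e [b [de eb ae]]] : exists e b, [/\ kg_deg e = kg_unit i, kg_src e = kg_rng b & a = kg_cmp e b].
    by apply: kg_split_unit; rewrite lt0n.
  have eE : e \in kg_edges L i by rewrite kg_edgesP // de.
  have re : kg_rng e == v by rewrite -ra ae kg_rng_cmp.
  rewrite (big_rem e eE) /= re.
  have -> : w * oapp bz 0 (kg_div e a) = bz a.
    by rewrite ae kg_div_cmp //= boltzmann_cmp // {2}/boltzmann (kg_weight_edge _ de) expR_preferred.
  by rewrite lerDl sumr_ge0.
rewrite exchange_big /= mulr_sumr big_seq_cond [leRHS]big_seq_cond.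
apply: ler_sum => e /andP[]; rewrite kg_edgesP // => /eqP de re.
rewrite -mulr_sumr ler_wpM2l //.
have e1 : \sum_(a <- F) oapp bz 0 (kg_div e a) = \sum_(b <- pmap (kg_div e) F) bz b.
  by rewrite big_pmap.
have up : uniq (pmap (kg_div e) F).
  by apply: pmap_pbij_uniq (fset_uniq F) => x y; apply: iff_sym (kg_extP e y x).
pose F' := [fset b in pmap (kg_div e) F]%fset.
have F'P b : b \in F' -> exists2 a, a \in F & kg_div e a = Some b.
  by rewrite !inE /= mem_pmap => /mapP[a aF ->]; exists a.
rewrite e1 (perm_big (enum_fset F')) /=; last first.
  by apply: uniq_perm; rewrite ?fset_uniq // => b; rewrite !inE.
have -> : \sum_(b <- F') bz b = \sum_(b <- F' | kg_rng b == kg_src e) bz b.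
  rewrite [RHS]big_mkcond /=; apply: eq_big_seq => b /F'P[a aF /kg_divP[eb _]].
  by rewrite eb eqxx.
apply: IH => b /F'P[a aF /kg_divP[eb ae]].
have [h1 h2 h3] := FP a aF; rewrite ae in h1 h2 h3.
split.
- by move: h1; rewrite kg_src_cmp.
- by move=> j bj; apply: h2; rewrite kg_deg_cmp // degD ltn_addl.
move: h3; rewrite kg_deg_cmp // degD de ffunE eqxx add1n //.
Qed.

Lemma path_sum_bound : exists C : R, forall F : {fset M},
  (forall a, a \in F -> kg_src a \notin D) -> \sum_(a <- F) bz a <= C.
Proof.
have [U UP] := path_sum_bound_colours (enum 'I_k).
exists (\sum_v U v) => F FD.
rewrite (partition_big (@kg_rng k L) xpredT) //=; apply: ler_sum => v _.
have [_ h] := UP v; apply: h => a aF; split; first exact: FD.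
by move=> i _; rewrite mem_enum.
Qed.

Lemma vertex_op_zero_on i u : (forall v, v \in D -> u v = 0) ->
  forall v, v \in D -> vertex_op i u v = 0.
Proof.
move=> uD v vD; rewrite /vertex_op big1 // => e /eqP re; apply: uD.
by apply: D_her vD _; exists e.
Qed.

Lemma gap_vector_zero_on l u : (forall v, v \in D -> u v = 0) ->
  forall v, v \in D -> gap_vector preferred l u v = 0.
Proof.
move=> uD; elim: l => [//|i l IH] v vD /=.
by rewrite IH // (vertex_op_zero_on _ IH) // mulr0 subrr.
Qed.

(** A vector killed by the factor of the colour [i] is an eigenfunction for [rho] that
  vanishes on [D]. *)
Lemma gap_vector_inj l u : (forall v, v \in D -> u v = 0) ->
  (forall v, gap_vector preferred l u v = 0) -> forall v, u v = 0.
Proof.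
move=> uD; elim: l => [//|i l IH] /= g0; apply: IH.
apply: (eigenfunction_off_dominant L_finite rho_gt1 D_dom (i := i) (a := rho R L i)) => //.
  exact: gap_vector_zero_on.
move=> v; have /eqP := g0 v; rewrite subr_eq0 expR_preferred => /eqP ->.
by rewrite mulrA divff ?mul1r // gt_eqF // rho_gt0.
Qed.

Lemma gap_vector_harmonic l u : l != [::] ->
  (forall i v, vertex_op i u v = rho R L i * u v) -> forall v, gap_vector preferred l u v = 0.
Proof.
move=> + uh; elim: l => [//|i l IH] _ v /=; rewrite expR_preferred.
have [->|l0] := eqVneq l [::].
  by rewrite /= uh mulrA mulVf ?mul1r ?subrr // gt_eqF // rho_gt0.
rewrite IH // /vertex_op big1 ?mulr0 ?subrr // => e _; exact: IH.
Qed.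

(** Uniqueness in Perron-Frobenius: subtract the largest multiple of the positive
  eigenvector; the remainder vanishes at some vertex, hence everywhere. *)
Lemma subinvariant_on_component i u (x : V -> R) : irreducible_mx (vmx R D D i) ->
  D != finset.set0 -> (forall v, v \in D -> 0 <= u v) ->
  (forall v, v \in D -> vertex_op i u v <= rho R L i * u v) ->
  (forall v, v \in D -> 0 < x v) ->
  (forall v, v \in D -> vertex_op i x v = rho R L i * x v) ->
  exists2 c : R, 0 <= c & forall v, v \in D -> u v = c * x v.
Proof.
move=> irr /set0Pn[v0 v0D] u0 ule x0 xE.
have [v vD vmin] := @arg_minP _ _ V v0 (mem D) (fun v => u v / x v) v0D.
exists (u v / x v); first by rewrite divr_ge0 ?u0 // ltW // x0.
set c := u v / x v => w wD; apply/eqP; rewrite -subr_eq0; apply/eqP.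
pose y w := u w - c * x w.
have y0 a : a \in D -> 0 <= y a.
  by move=> aD; rewrite subr_ge0 -ler_pdivlMr ?x0 //; apply: vmin.
have yv : y v = 0 by rewrite /y /c divfK ?subrr // gt_eqF // x0.
have yle a : a \in D -> vertex_op i y a <= rho R L i * y a.
  move=> aD; have -> : vertex_op i y a = vertex_op i u a - c * vertex_op i x a.
    by rewrite /vertex_op mulr_sumr -sumrB.
  by rewrite xE // mulrBr lerB ?ule // mulrCA.
set A := vmx R D D i in irr.
have A0 a b : 0 <= A a b by rewrite mxE.
have AX0 n a b : 0 <= (A ^+ n) a b.
  elim: n a b => [|n IH] a b; first by rewrite expr0 mxE; case: eqP.
  by rewrite exprS mxE sumr_ge0 // => j _; rewrite mulr_ge0.
have powle n (a : 'I_#|D|) : \sum_b (A ^+ n) a b * y (enum_val b) <= rho R L i ^+ n * y (enum_val a).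
  elim: n a => [|n IH] a.
    rewrite !expr0 mul1r (bigD1 a) //= mxE eqxx mul1r big1 ?addr0 // => b /negbTE ba.
    by rewrite mxE eq_sym ba mul0r.
  have -> : \sum_b (A ^+ n.+1) a b * y (enum_val b) =
      \sum_j A a j * \sum_b (A ^+ n) j b * y (enum_val b).
    under [RHS]eq_bigr do rewrite mulr_sumr.
    rewrite exchange_big /=; apply: eq_bigr => b _; rewrite exprS mxE mulr_suml.
    by apply: eq_bigr => j _; rewrite mulrA.
  apply: (@le_trans _ _ (rho R L i ^+ n * vertex_op i y (enum_val a))).
    have <- : (A *m restrict_cv y D) a 0 = vertex_op i y (enum_val a).
      apply: vmx_mul_restrict => // b bD ab.
      by case/negP: bD; apply: D_her (enum_valP a) ab.
    rewrite mxE mulr_sumr; apply: ler_sum => j _.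
    by rewrite mulrCA ler_wpM2l // [X in _ <= _ * X]mxE.
  rewrite exprSr -mulrA; apply: ler_wpM2l; last exact/yle/enum_valP.
  by rewrite exprn_ge0 // ltW // rho_gt0.
have [n An] := irr (enum_rank_in vD v) (enum_rank_in wD w).
have := powle n (enum_rank_in vD v); rewrite enum_rankK_in // yv mulr0.
rewrite (bigD1 (enum_rank_in wD w)) //= enum_rankK_in // => h.
have s0 : 0 <= \sum_(b < #|D| | b != enum_rank_in wD w)
    (A ^+ n) (enum_rank_in vD v) b * y (enum_val b).
  by apply: sumr_ge0 => b _; rewrite mulr_ge0 // y0 // enum_valP.
have An0 : 0 < (A ^+ n) (enum_rank_in vD v) (enum_rank_in wD w).
  by rewrite lt_neqAle eq_sym An AX0.
apply/le_anti; rewrite [X in _ && X]y0 // andbT.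
rewrite -(pmulr_rle0 _ An0); apply: le_trans h; by rewrite lerDl.
Qed.

(** On [D] this is the Perron-Frobenius equation, on [H] both sides vanish, and on [F] it is
  the defining equation of [y], the resolvent being invertible by [vmx_resolvent_unit]. *)
Lemma perron_extension_harmonic (z : V -> R) : (forall i, rho_on R D i = rho R L i) ->
  perron_extension D z -> forall i v, vertex_op i z v = rho R L i * z v.
Proof.
move=> D_rho [[zpos _] zD zF zH] i v.
set H := not_to D in zH zF; set F := ~: (D :|: H) in zF.
have HP w : (w \in H) <-> (forall d, d \in D -> ~ kg_le w d).
  by rewrite inE; split => /asboolP.
have H_her a b : a \in H -> kg_le a b -> b \in H.
  move=> /HP aH ab; apply/HP => d dD bd; exact: (aH d dD (kg_le_trans ab bd)).
have [vD|vD] := boolP (v \in D).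
  have := congr1 (fun m : 'cV_#|D| => m (enum_rank_in vD v) 0) (zD i).
  rewrite vmx_mul_restrict // => [|w wD]; rewrite ?enum_rankK_in //; last first.
    by move=> vw; case/negP: wD; apply: D_her vD vw.
  by rewrite !mxE enum_rankK_in // D_rho.
have [vH|vH] := boolP (v \in H).
  rewrite zH // mulr0 /vertex_op big1 // => e /eqP re; apply: zH.
  by apply: H_her vH _; exists e.
have vF : v \in F by rewrite finset.in_setC finset.in_setU negb_or vD vH.
have U : (rho_on R D i)%:M - vmx R F F i \in unitmx.
  rewrite D_rho; apply: (vmx_resolvent_unit L_finite rho_gt1 D_dom) => //.
    by move=> w; rewrite finset.in_setC finset.in_setU negb_or => /andP[].
  move=> a b; rewrite finset.in_setC negbK finset.in_setU => /orP[aD|aH] bF ab.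
    by move: bF; rewrite finset.in_setC finset.in_setU (D_her aD ab).
  by move: bF; rewrite finset.in_setC finset.in_setU (H_her _ _ aH ab) orbT.
have e : ((rho_on R D i)%:M - vmx R F F i) *m restrict_cv z F = vmx R F D i *m restrict_cv z D.
  by rewrite (zF i) mulKVmx.
have := congr1 (fun m : 'cV_#|F| => m (enum_rank_in vF v) 0) e.
rewrite mulmxBl mul_scalar_mx D_rho [LHS]mxE [X in X + _]mxE [X in _ * X]mxE enum_rankK_in //.
rewrite [X in _ + X]mxE !vertex_op_vmx // enum_rankK_in // => /eqP.
rewrite subr_eq => /eqP ->; rewrite addrC /vertex_op.
rewrite (bigID (fun e => kg_src e \in F)) /=; congr (_ + _).
rewrite (bigID (fun e => kg_src e \in D)) /= [X in _ + X]big1 ?addr0.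
  apply: eq_bigl => a; rewrite andbAC -andbA; congr (_ && _).
  by rewrite andb_idr // => sD; rewrite finset.in_setC finset.in_setU negbK sD.
move=> a /andP[/andP[_ aF] aD]; apply: zH; move: aF.
by rewrite finset.in_setC negbK finset.in_setU (negbTE aD).
Qed.

End PathSums.

(** * Gibbs states *)

Section Gibbs.
Variables (R : realType) (k : nat) (L : kgraph k).
Hypothesis L_finite : kg_finite L.
Local Notation V := (kg_vtx L).
Local Notation M := (kg_mor L).
Variables (A : cStarAlgType R) (t : M -> A).
Hypothesis t_univ : toeplitz_algebra t.
Local Notation q v := (t (kg_id L v)).
Local Notation one := (toeplitz_one t).
Local Notation h := (gap_coef L_finite t_univ).
Variable r : 'I_k -> R.
Local Notation bz := (boltzmann r).
Hypothesis summable : exists C : R, forall F : {fset M}, \sum_(a <- F) bz a <= C.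
Variable eps : V -> R.
Hypothesis eps_ge0 : forall v, 0 <= eps v.

Let tf : toeplitz_family t. Proof. by case: t_univ. Qed.

Definition gibbs_weight (a : M) : R := bz a * eps (kg_src a).

Lemma gibbs_weight_ge0 a : 0 <= gibbs_weight a.
Proof. by rewrite mulr_ge0 // ltW // boltzmann_gt0. Qed.

Lemma gibbs_weight_id v : gibbs_weight (kg_id L v) = eps v.
Proof.
rewrite /gibbs_weight kg_src_id /boltzmann /kg_weight big1 ?oppr0 ?expR0 ?mul1r // => i _.
by rewrite kg_deg_id ffunE mulr0.
Qed.

Lemma gibbs_mass_ex : exists S, has_sum gibbs_weight S.
Proof.
have [C bC] := summable; pose E := \sum_v eps v.
have eE v : eps v <= E by rewrite /E (bigD1 v) //= lerDl sumr_ge0.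
apply: (nonneg_has_sum (C := C * E)); first exact: gibbs_weight_ge0.
move=> F; apply: (@le_trans _ _ (\sum_(a <- F) bz a * E)).
  by apply: ler_sum => a _; rewrite ler_wpM2l // ltW // boltzmann_gt0.
by rewrite -mulr_suml ler_wpM2r // sumr_ge0.
Qed.

Definition gibbs_mass : R := projT1 (cid gibbs_mass_ex).

Lemma gibbs_massP : has_sum gibbs_weight gibbs_mass.
Proof. by rewrite /gibbs_mass; case: cid. Qed.

Lemma gibbs_mass_ge v : eps v <= gibbs_mass.
Proof.
rewrite -gibbs_weight_id -(big_seq_fset1 +%R (kg_id L v) gibbs_weight).
exact: has_sum_ge gibbs_weight_ge0 gibbs_massP.
Qed.

(** The contribution of the path [a] to the Gibbs functional: in path space, the matrix
  coefficient of [b] at the basis vector of [a], with weight [gibbs_weight a]. *)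
Definition gibbs_term (b : A) (a : M) : R[i] :=
  (gibbs_weight a)%:C * h (kg_src a) (star (t a) ** b ** t a).

Lemma gibbs_term_norm b (x : R) a :
  `|h (kg_src a) (star (t a) ** b ** t a)| <= x%:C ->
  `|gibbs_term b a| <= (gibbs_weight a * x)%:C.
Proof.
have w0 : 0 <= (gibbs_weight a)%:C :> R[i] by rewrite ler0c gibbs_weight_ge0.
by move=> hx; rewrite normrM (ger0_norm w0) [leRHS]rmorphM ler_wpM2l.
Qed.

Lemma gibbs_conj_norm (b : A) a : `|star (t a) ** b ** t a| <= `|b|.
Proof.
apply: le_trans (norm_cmul _ _) _; apply: le_trans (ler_wpM2r (normr_ge0 _) (norm_cmul _ _)) _.
rewrite norm_star mulrAC ler_piMl // -[1]mul1r.
by apply: ler_pM => //; apply: (norm_toeplitz tf).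
Qed.

Lemma gibbs_sum_bound b (x : R) : 0 <= x ->
  (forall a, `|h (kg_src a) (star (t a) ** b ** t a)| <= x%:C) ->
  forall F : {fset M}, \sum_(a <- F) `|gibbs_term b a| <= (gibbs_mass * x)%:C.
Proof.
move=> x0 hx F.
apply: (@le_trans _ _ (\sum_(a <- F) (gibbs_weight a * x)%:C)).
  by apply: ler_sum => a _; apply: gibbs_term_norm.
rewrite -rmorph_sum lecR -mulr_suml ler_wpM2r //.
exact: has_sum_ge gibbs_weight_ge0 gibbs_massP.
Qed.

Lemma norm_real (b : A) : exists2 x : R, 0 <= x & `|b| = x%:C.
Proof.
exists (complex.Re `|b|); last by rewrite RRe_real // normr_real.
by rewrite -lecR (RRe_real (normr_real b)) normr_ge0.
Qed.

Lemma gibbs_ex b : exists l, has_sum (gibbs_term b) l.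
Proof.
have [x x0 bx] := norm_real b.
apply: (bounded_has_sumC (C := gibbs_mass * x)); apply: gibbs_sum_bound => // a.
by apply: le_trans (gap_coef_norm _ _ _ _) _; rewrite -bx gibbs_conj_norm.
Qed.

Definition gibbs b : R[i] := projT1 (cid (gibbs_ex b)).

Lemma gibbsP b : has_sum (gibbs_term b) (gibbs b).
Proof. by rewrite /gibbs; case: cid. Qed.

Lemma gibbs_unique b l : has_sum (gibbs_term b) l -> gibbs b = l.
Proof. exact: has_sum_unique (gibbsP b). Qed.

Lemma gibbs_norm_le b (x : R) : 0 <= x ->
  (forall a, `|h (kg_src a) (star (t a) ** b ** t a)| <= x%:C) ->
  `|gibbs b| <= (gibbs_mass * x)%:C.
Proof.
move=> x0 hx; apply: has_sum_norm_le (gibbsP b); last exact: gibbs_sum_bound.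
by apply/complex_realP; eexists.
Qed.

Lemma gibbs_norm b : `|gibbs b| <= gibbs_mass%:C * `|b|.
Proof.
have [x x0 bx] := norm_real b; rewrite bx -rmorphM.
apply: gibbs_norm_le => // a.
by apply: le_trans (gap_coef_norm _ _ _ _) _; rewrite -bx gibbs_conj_norm.
Qed.

Lemma gibbs_scalar : scalar gibbs.
Proof.
move=> x a b; apply: gibbs_unique.
have -> : gibbs_term (x *: a + b) = (fun m => x * gibbs_term a m + gibbs_term b m).
  apply/funext => m; rewrite /gibbs_term cmulDr cmulZr cmulDl cmulZl.
  by rewrite (gap_coef_scalar L_finite t_univ _ x) mulrDr mulrCA.
exact: has_sumD (has_sumZ x (gibbsP a)) (gibbsP b).
Qed.

Lemma gibbs_pos b : 0 <= gibbs (star b ** b).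
Proof.
apply: has_sum_geC0 (gibbsP _) => a; apply: mulr_ge0.
  by rewrite ler0c gibbs_weight_ge0.
have -> : star (t a) ** (star b ** b) ** t a = star (b ** t a) ** (b ** t a).
  by rewrite starM !cmulA.
exact: gap_coef_ge0.
Qed.

Lemma gap_coef_q v : h v (q v) = 1.
Proof.
have -> : q v = q v ** star (q v) by rewrite (toeplitz_qs tf) (toeplitz_qq tf) eqxx.
by rewrite gap_coef_monomial eqxx.
Qed.

Lemma gibbs_one : gibbs one = gibbs_mass%:C.
Proof.
apply: gibbs_unique; have := has_sum_real_complex gibbs_massP.
congr (has_sum _ _); apply/funext => a; rewrite /gibbs_term -cmulA (toeplitz_one_t tf).
by rewrite (toeplitz_star_self tf) gap_coef_q mulr1.
Qed.

(** If [mu] is not an initial segment of [a], every summand of [star (t a) ** t mu] starts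
  with a path of positive degree, which the gap projection kills. *)
Lemma vgap_star_mul a mu : vgap t (kg_src a) ** (star (t a) ** t mu) =
  vgap t (kg_src a) ** oapp (fun b => star (t b)) 0 (kg_div mu a).
Proof.
case E: (kg_div mu a) => [b|] /=.
  have /kg_divP[mub ->] := E; have -> : t (kg_cmp mu b) = t mu ** t b.
    by rewrite (toeplitz_mul tf) mub eqxx.
  by rewrite starM -cmulA (toeplitz_star_self tf) mub -{1}(toeplitz_q_t tf b) starM (toeplitz_qs tf)
    -cmulA (toeplitz_qq tf) eqxx -(toeplitz_qs tf (kg_rng b)) -starM (toeplitz_q_t tf).
rewrite cmul0r (toeplitz_star_mul L_finite tf) cmul_sumr big_seq big1 // => ez.
rewrite in_fset_set ?inE; last exact: kg_min_finite.
move=> hez; rewrite cmulA (vgap_t L_finite tf); case: eqP => [e1|_]; last by rewrite cmul0l.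
have [_ _ me e _] := hez; move: e; rewrite e1 kg_cmp_idr => ae.
by move: E; rewrite ae kg_div_cmp.
Qed.

(** On the left only the paths [a = mu a'] contribute, by [vgap_star_mul], and the weight of
  [a] is [bz mu] times that of [a']. *)
Lemma gibbs_generator mu b : gibbs (t mu ** b) = (bz mu)%:C * gibbs (b ** t mu).
Proof.
apply: gibbs_unique.
pose f a' a := (bz mu)%:C * (gibbs_weight a')%:C * h (kg_src a') (star (t a') ** b ** t a).
have pp x y : kg_ext mu x = Some y <-> kg_div mu y = Some x by apply: kg_extP.
have s1 : has_sum (fun a' => oapp (f a') 0 (kg_ext mu a')) ((bz mu)%:C * gibbs (b ** t mu)).
  have := has_sumZ (bz mu)%:C (gibbsP (b ** t mu)).
  congr (has_sum _ _); apply/funext => a'.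
  rewrite /gibbs_term -!cmulA (toeplitz_mul tf) /kg_ext; case: eqP => _ /=.
    by rewrite /f -cmulA mulrA.
  by rewrite !cmul0r (scalar0 (gap_coef_scalar L_finite t_univ _)) !mulr0.
have := has_sum_reindex pp s1; congr (has_sum _ _); apply/funext => a.
rewrite /gibbs_term -(gap_coef_vgap L_finite t_univ) !cmulA -(cmulA (vgap _ _)) vgap_star_mul.
case E: (kg_div mu a) => [a'|] /=; last first.
  by rewrite cmul0r !cmul0l (scalar0 (gap_coef_scalar L_finite t_univ _)) mulr0.
have /kg_divP[ma' aE] := E.
rewrite -2!(cmulA (vgap t (kg_src a))) (gap_coef_vgap L_finite t_univ) /f; congr (_ * _).
  by rewrite -rmorphM; congr (_ %:C); rewrite /gibbs_weight aE boltzmann_cmp // kg_src_cmp // mulrA.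
by rewrite aE kg_src_cmp.
Qed.

(** Only the vertex path at [v] contributes. *)
Lemma gibbs_vgap v : gibbs (vgap t v) = (eps v)%:C.
Proof.
apply: gibbs_unique.
have -> : (eps v)%:C = \sum_(a <- [fset kg_id L v]%fset) gibbs_term (vgap t v) a.
  rewrite big_seq_fset1 /gibbs_term gibbs_weight_id -cmulA (vgap_t L_finite tf) eqxx kg_src_id.
  rewrite (toeplitz_qs tf) (@gap_coef_unique _ _ _ L_finite _ _ t_univ _ _ 1) ?mulr1 // scale1r.
  have e : q v ** vgap t v = vgap t v by rewrite /vgap cmulA (toeplitz_qq tf) eqxx.
  by rewrite e !(vgap_idem L_finite tf).
apply: has_sum_finite => a; rewrite inE => /negbTE av.
rewrite /gibbs_term -cmulA (vgap_t L_finite tf) av cmul0r.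
by rewrite (scalar0 (gap_coef_scalar L_finite t_univ _)) mulr0.
Qed.

Hypothesis mass_gt0 : 0 < gibbs_mass.

Definition gibbs_state (b : A) : R[i] := (gibbs_mass^-1)%:C * gibbs b.

Lemma gibbs_state_is_state : is_state gibbs_state.
Proof.
have m0 : 0 <= (gibbs_mass^-1)%:C :> R[i] by rewrite ler0c invr_ge0 ltW.
have nb b : `|gibbs_state b| <= `|b|.
  rewrite normrM ger0_norm //; apply: le_trans (ler_wpM2l m0 (gibbs_norm b)) _.
  by rewrite mulrA -rmorphM /= mulVf ?gt_eqF // rmorph1 mul1r.
split=> //.
- by move=> x a b; rewrite /gibbs_state gibbs_scalar; ring.
- by move=> a; rewrite mulr_ge0 // gibbs_pos.
move=> e e0; exists one; first exact: norm_toeplitz_one.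
rewrite /gibbs_state gibbs_one -rmorphM mulVf ?gt_eqF // rmorph1 normr1.
by rewrite -[X in _ < X](rmorph1 (real_complex R)) ltcR ltrBlDr ltrDl.
Qed.

Lemma gibbs_state_KMS (alpha : R -> A -> A) : toeplitz_dynamics t r alpha ->
  KMS_state alpha (toeplitz_span t) 1 gibbs_state.
Proof.
move=> dyn; apply: (kms_of_generator L_finite t_univ dyn); first exact: gibbs_state_is_state.
by move=> mu b; rewrite /gibbs_state gibbs_generator mulrCA.
Qed.

Lemma gibbs_state_vgap v : gibbs_state (vgap t v) = (gibbs_mass^-1 * eps v)%:C.
Proof. by rewrite /gibbs_state gibbs_vgap -rmorphM. Qed.

End Gibbs.

(** * The quotient by a hereditary component *)

Section MinusSums.
Variables (k : nat) (L : kgraph k).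
Hypothesis L_finite : kg_finite L.
Variable D : {set kg_vtx L}.
Hypothesis D_her : kg_hereditary D.
Local Notation N := (kg_minus D_her).

Lemma kg_minus_finite : kg_finite N.
Proof.
move=> n; apply: (finite_preimage (f := fun l : kg_mor N => val l)
  (B := [set l : kg_mor L | kg_deg l = n])); last exact: L_finite.
by move=> x y _ _; apply: val_inj.
Qed.

Lemma sum_vtx_minus (X : nmodType) (F : kg_vtx L -> X) : (forall v, v \in D -> F v = 0) ->
  \sum_v F v = \sum_(v : kg_vtx N) F (val v).
Proof.
move=> F0; rewrite (bigID (mem D)) /= big1 // add0r.
rewrite -[RHS](big_map val xpredT F) -big_filter; apply: perm_big; apply: uniq_perm.
- by rewrite filter_uniq // index_enum_uniq.
- by rewrite map_inj_uniq ?index_enum_uniq //; apply: val_inj.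
move=> v; rewrite mem_filter mem_index_enum andbT; apply/idP/mapP => [vD|[w _ ->]].
  by exists (exist _ v vD : kg_vtx N); rewrite ?mem_index_enum.
exact: (valP w).
Qed.

(** As [D] is hereditary, an edge whose source is outside [D] has its range outside [D]. *)
Lemma sum_edges_minus (X : nmodType) i (F : kg_mor L -> X) :
  (forall e, kg_src e \in D -> F e = 0) ->
  \sum_(e <- kg_edges L i) F e = \sum_(e <- kg_edges N i) F (val e).
Proof.
have edgeE (e : kg_mor N) : (e \in kg_edges N i) = (kg_deg (val e) == kg_unit i).
  by rewrite kg_edgesP //; apply: kg_minus_finite.
move=> F0; rewrite (bigID (fun e => kg_src e \in D)) /= big1 // add0r.
rewrite -[RHS](big_map val xpredT F) -big_filter; apply: perm_big; apply: uniq_perm.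
- by rewrite filter_uniq // fset_uniq.
- by rewrite map_inj_uniq ?fset_uniq //; apply: val_inj.
move=> e; rewrite mem_filter kg_edgesP //; apply/idP/mapP => [/andP[sD de]|[e' + ->]].
  have eP : (kg_rng e \notin D) && (kg_src e \notin D).
    by rewrite sD andbT; apply: contra sD => rD; apply: D_her rD _; exists e.
  pose e' : kg_mor N := exist _ e eP.
  have e'P : e' \in kg_edges N i by rewrite edgeE.
  by exists e'; first exact: e'P.
move=> e'P; have /andP[_ ->] := valP e'; rewrite -edgeE; exact: e'P.
Qed.

Variable R : realType.

Lemma vertex_op_minus i (u : kg_vtx L -> R) (v : kg_vtx N) : (forall w, w \in D -> u w = 0) ->
  vertex_op i (fun w : kg_vtx N => u (val w)) v = vertex_op i u (val v).
Proof.
move=> u0; rewrite /vertex_op [RHS]big_mkcond sum_edges_minus /=; last first.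
  by move=> e eD; rewrite u0 // if_same.
by rewrite [LHS]big_mkcond; apply: eq_bigr => e _; rewrite -val_eqE.
Qed.

Lemma gap_vector_minus l (u : kg_vtx L -> R) (v : kg_vtx N) : (forall w, w \in D -> u w = 0) ->
  gap_vector (preferred R L) l (fun w : kg_vtx N => u (val w)) v =
  gap_vector (preferred R L) l u (val v).
Proof.
move=> u0; elim: l v => [//|i l IH] v /=; rewrite IH -vertex_op_minus; last first.
  exact: gap_vector_zero_on.
by congr (_ - _ * _); apply: eq_bigr => e _; apply: IH.
Qed.

End MinusSums.

Section Quotient.
Variables (R : realType) (k : nat) (L : kgraph k).
Hypothesis L_finite : kg_finite L.
Variable D : {set kg_vtx L}.
Hypothesis D_her : kg_hereditary D.
Local Notation N := (kg_minus D_her).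
Variables (T : cStarAlgType R) (t : kg_mor L -> T).
Hypothesis T_univ : toeplitz_algebra t.
Variables (TD : cStarAlgType R) (s : kg_mor N -> TD).
Hypothesis TD_univ : toeplitz_algebra s.
Variable qD : T -> TD.
Hypothesis qD_quot : toeplitz_quotient t s qD.

Let tf : toeplitz_family t. Proof. by case: T_univ. Qed.
Let qh : star_hom qD. Proof. by case: qD_quot. Qed.
Local Notation N_finite := (kg_minus_finite L_finite D_her).

Lemma quotient_t (l : kg_mor N) : qD (t (val l)) = s l. Proof. by case: qD_quot. Qed.

Lemma quotient_kills l : kg_src l \in D -> qD (t l) = 0.
Proof.
have [_ qM _] := qh => lD; rewrite -(toeplitz_t_q tf l) qM.
suff -> : qD (t (kg_id L (kg_src l))) = 0 by rewrite cmul0r.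
by have [_ _ _ ->] := qD_quot => I _; apply; exists (kg_src l).
Qed.

Lemma quotient_id (v : kg_vtx N) : qD (t (kg_id L (val v))) = s (kg_id N v).
Proof. by rewrite -quotient_t. Qed.

(** The edges and vertices that are lost in the quotient graph have their source in [D]. *)
Lemma quotient_gap_seq l : qD (gap_seq t l) = gap_seq s l.
Proof.
have [_ qM qS] := qh; elim: l => [|i l IH] /=.
  rewrite (star_hom_sum _ _ _ qh) (sum_vtx_minus D_her) => [|v vD].
    by apply: eq_bigr => v _; rewrite quotient_id.
  by apply: quotient_kills; rewrite kg_src_id.
rewrite (star_homB _ _ qh) IH (star_hom_sum _ _ _ qh) (sum_edges_minus L_finite D_her).
  by congr (_ - _); apply: eq_bigr => e _; rewrite !qM qS IH quotient_t.
by move=> e eD; rewrite !qM quotient_kills // !cmul0l.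
Qed.

Lemma quotient_vgap (v : kg_vtx N) : qD (vgap t (val v)) = vgap s v.
Proof. by have [_ qM _] := qh; rewrite qM quotient_id quotient_gap_seq. Qed.

(** Apply [qD] to the equation that defines the coefficient. This bounds the coefficients of
  [qD x] by the norm of [x] itself. *)
Lemma quotient_gap_coef (v : kg_vtx N) x :
  gap_coef N_finite TD_univ v (qD x) = gap_coef L_finite T_univ (val v) x.
Proof.
have [_ qM _] := qh; apply: gap_coef_unique.
by rewrite -quotient_vgap -!qM gap_coefP (star_homZ _ _ qh).
Qed.

Variable eps : kg_vtx N -> R.
Hypothesis eps_ge0 : forall v, 0 <= eps v.
Hypothesis summable : exists C : R, forall F : {fset kg_mor N},
  \sum_(a <- F) boltzmann (preferred R L) a <= C.

Lemma quotient_gibbs_norm x :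
  `|gibbs N_finite TD_univ summable eps_ge0 (qD x)| <=
  (gibbs_mass summable eps_ge0)%:C * `|x|.
Proof.
have [y y0 xy] := norm_real x; rewrite xy -rmorphM; apply: gibbs_norm_le => // a.
have [_ qM qS] := qh; rewrite -quotient_t -qS -!qM quotient_gap_coef.
by apply: le_trans (gap_coef_norm _ _ _ _) _; rewrite -xy gibbs_conj_norm.
Qed.

End Quotient.

(** * Decomposition of KMS states *)

Section KMSDecomposition.
Variables (R : realType) (k : nat) (L : kgraph k).
Hypotheses (L_finite : kg_finite L) (rho_gt1 : forall i : 'I_k, 1 < rho R L i).
Hypothesis rho_indep : rationally_independent (fun i : 'I_k => ln (rho R L i)).
Variable D : {set kg_vtx L}.
Hypothesis D_her : kg_hereditary D.
Hypothesis D_dom : forall (i : 'I_k) (C : {set kg_vtx L}),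
  kg_nontrivial_component C -> C <> D -> rho_on R C i < rho R L i.
Local Notation N := (kg_minus D_her).
Local Notation pr := (preferred R L).

(** Equality of the weights is an integral relation between the numbers [ln (rho R L i)]. *)
Lemma preferred_weight_inj (K : kgraph k) (mu nu : kg_mor K) :
  kg_weight pr mu = kg_weight pr nu -> kg_deg mu = kg_deg nu.
Proof.
move=> /eqP; rewrite -subr_eq0 -sumrB => /eqP e; apply/ffunP => i.
suff /eqP : (kg_deg mu i)%:Z - (kg_deg nu i)%:Z = 0 by rewrite subr_eq0 => /eqP [].
apply: (rho_indep (c := fun i => (kg_deg mu i)%:Z - (kg_deg nu i)%:Z)).
rewrite -[RHS]e; apply: eq_bigr => j _.
by rewrite rmorphB /= mulrBl mulrC [X in _ - X]mulrC.
Qed.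

Lemma minus_path_sum : exists C : R, forall F : {fset kg_mor N},
  \sum_(a <- F) boltzmann pr a <= C.
Proof.
have [C bC] := path_sum_bound L_finite rho_gt1 D_her D_dom.
exists C => F.
have uv : uniq [seq val a | a <- F] by rewrite map_inj_uniq ?fset_uniq //; apply: val_inj.
have := bC [fset a in [seq val a | a <- F]]%fset.
rewrite (perm_big [seq val a | a <- F]) ?big_map /=; last first.
  by apply: uniq_perm; rewrite ?fset_uniq // => a; rewrite !inE.
apply => a; rewrite !inE /= => /mapP[b _ ->].
by have /andP[] := valP b.
Qed.

Lemma minus_lift l : kg_src l \notin D -> exists l' : kg_mor N, l = val l'.
Proof.
move=> lD; have lP : (kg_rng l \notin D) && (kg_src l \notin D).
  by rewrite lD andbT; apply: contra lD => rD; apply: D_her rD _; exists l.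
by exists (exist _ l lP).
Qed.

(** Without colours all morphisms would be identities and [D] would be trivial. *)
Lemma nontrivial_colour : kg_nontrivial_component D -> exists i : 'I_k, True.
Proof.
move=> [[v vD] nt]; apply: contrapT => nok; apply: nt.
have triv l : l = kg_id L (kg_rng l).
  by apply: kg_deg0; apply/ffunP => i; case: nok; exists i.
exists v => [|l <- _]; last exact: triv.
apply/setP => w; rewrite inE; apply/idP/eqP => [/vD[[l [<- <-]] _]|->].
  by rewrite {1}(triv l) kg_src_id.
by apply/vD; split; exists (kg_id L v); rewrite kg_rng_id kg_src_id.
Qed.

Variables (T : cStarAlgType R) (t : kg_mor L -> T).
Hypothesis T_univ : toeplitz_algebra t.
Variable alpha : R -> T -> T.
Hypothesis alpha_dyn : toeplitz_dynamics t pr alpha.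
Variables (TD : cStarAlgType R) (s : kg_mor N -> TD).
Hypothesis TD_univ : toeplitz_algebra s.
Variable alphaD : R -> TD -> TD.
Hypothesis alphaD_dyn : toeplitz_dynamics s pr alphaD.
Variable qD : T -> TD.
Hypothesis qD_quot : toeplitz_quotient t s qD.
Variables Phi psi : T -> R[i].
Hypotheses (Phi_KMS : KMS_state alpha (toeplitz_span t) 1 Phi)
  (psi_KMS : KMS_state alpha (toeplitz_span t) 1 psi).
Local Notation m := (vertex_weight t Phi).
Local Notation zt := (vertex_weight t psi).

Let tf : toeplitz_family t. Proof. by case: T_univ. Qed.
Local Notation N_finite := (kg_minus_finite L_finite D_her).

(** Positivity of the gap projection of the single colour [i]. *)
Lemma kms_subinvariant i v : vertex_op i m v <= rho R L i * m v.
Proof.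
have := kms_gap_ge0 L_finite T_univ alpha_dyn Phi_KMS v (isT : uniq [:: i]).
rewrite /= (expR_preferred rho_gt1) subr_ge0.
by rewrite ler_pdivrMl // rho_gt0.
Qed.

(** Both sides are bounded functionals, and [kms_monomial] gives their values on monomials;
  a monomial with a source in [D] is killed by [qD]. *)
Lemma kms_convex_combination (c : R) (phi : TD -> R[i]) (K : R[i]) :
  KMS_state alphaD (toeplitz_span s) 1 phi ->
  (forall x, `|phi (qD x)| <= K * `|x|) ->
  (forall v, v \in D -> m v = c * zt v) ->
  (forall v : kg_vtx N, m (val v) = c * zt (val v) + (1 - c) * vertex_weight s phi v) ->
  forall x, Phi x = c%:C * psi x + (1 - c)%:C * phi (qD x).
Proof.
move=> phi_KMS phiK mD mN x; apply/eqP; rewrite -subr_eq0; apply/eqP.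
have [[Phil _ Phin _] _] := Phi_KMS.
have [[psil _ psin _] _] := psi_KMS.
have [[phil _ _ _] _] := phi_KMS.
have [[ql qM qS] _ _ _] := qD_quot.
apply: (functional_zero L_finite T_univ
  (f := fun x => Phi x - (c%:C * psi x + (1 - c)%:C * phi (qD x)))
  (C := 1 + (`|c%:C| + `|(1 - c)%:C| * K))).
- by move=> y a b; rewrite Phil psil ql phil; ring.
- move=> a; apply: le_trans (ler_normB _ _) _; rewrite mulrDl mul1r lerD //.
  apply: le_trans (ler_normD _ _) _; rewrite !normrM mulrDl lerD //.
    by rewrite ler_wpM2l.
  by rewrite -mulrA ler_wpM2l.
move=> mu nu.
rewrite !(kms_monomial L_finite T_univ alpha_dyn) //; try exact: preferred_weight_inj.
rewrite !(vertex_weightE T_univ Phi_KMS) !(vertex_weightE T_univ psi_KMS).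
rewrite qM qS.
have [muD|muD] := boolP (kg_src mu \in D).
  rewrite (quotient_kills T_univ qD_quot muD) cmul0l (scalar0 phil) mulr0 addr0 (mD _ muD).
  by case: eqP => _; rewrite ?mulr0 ?subrr // rmorphM mulrCA subrr.
have [nuD|nuD] := boolP (kg_src nu \in D).
  rewrite (quotient_kills T_univ qD_quot nuD) star0 cmul0r (scalar0 phil) mulr0 addr0.
  case: eqP => [e|_]; first by move: nuD; rewrite -e (negbTE muD).
  by rewrite mulr0 subrr.
have [mu' mu'E] := minus_lift muD; have [nu' nu'E] := minus_lift nuD.
rewrite mu'E nu'E !(quotient_t qD_quot) (kms_monomial N_finite TD_univ alphaD_dyn) //; last first.
  exact: preferred_weight_inj.
rewrite (vertex_weightE TD_univ phi_KMS) (inj_eq val_inj).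
case: eqP => _; last by rewrite !mulr0 addr0 subrr.
rewrite (mN (kg_src mu')).
rewrite -[boltzmann pr (val mu')]/(boltzmann pr mu') rmorphD !rmorphM.
by ring.
Qed.

(** The normalised Gibbs state with data [eps]: its value at [vgap s v] is [eps v / S] by
  [gibbs_vgap], and it is [gap_vector] of its vertex weights by [kms_gap]. *)
Lemma minus_kms_of_gap (eps : kg_vtx N -> R) w0 : (forall v, 0 <= eps v) -> 0 < eps w0 ->
  exists (phi : TD -> R[i]) (S : R),
    [/\ KMS_state alphaD (toeplitz_span s) 1 phi, 0 < S,
      (forall x, `|phi (qD x)| <= `|x|)
    & forall v, S * gap_vector pr (enum 'I_k) (vertex_weight s phi) v = eps v].
Proof.
move=> e0 ew; pose S := gibbs_mass minus_path_sum e0.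
have S0 : 0 < S by apply: lt_le_trans ew (gibbs_mass_ge _ _ _).
have phiK := gibbs_state_KMS N_finite TD_univ S0 alphaD_dyn.
set phi := gibbs_state N_finite TD_univ minus_path_sum e0 in phiK.
exists phi, S; split=> // [x|v].
  rewrite normrM ger0_norm ?ler0c ?invr_ge0 ?(ltW S0) //.
  have := quotient_gibbs_norm L_finite T_univ TD_univ qD_quot e0 minus_path_sum x.
  have Si : 0 <= (S^-1)%:C :> R[i] by rewrite ler0c invr_ge0 ltW.
  move=> /(ler_wpM2l Si) /le_trans; apply.
  by rewrite mulrA -rmorphM /= mulVf ?gt_eqF // rmorph1 mul1r.
apply: (mulfI (lt0r_neq0 (_ : 0 < S^-1))); first by rewrite invr_gt0.
rewrite mulKf ?gt_eqF //; apply: complexI.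
rewrite -(gibbs_state_vgap N_finite TD_univ minus_path_sum e0 v).
by rewrite -(kms_gap N_finite TD_univ alphaD_dyn phiK) ?enum_uniq.
Qed.

(** The vector [m - c zt] vanishes on [D], hence it is determined by its image under the gap
  operator. As [zt] is harmonic this image is that of [m], so it is nonnegative and is, up
  to a scalar, the image of the vertex weights of a Gibbs state. *)
Lemma kms_remainder (c : R) : (exists v, v \notin D) -> (exists i : 'I_k, True) ->
  (forall v, v \in D -> m v = c * zt v) ->
  (forall i v, vertex_op i zt v = rho R L i * zt v) ->
  c <= 1 /\ exists (phi : TD -> R[i]),
    [/\ KMS_state alphaD (toeplitz_span s) 1 phi, (forall x, `|phi (qD x)| <= `|x|)
    & forall v : kg_vtx N, m (val v) = c * zt (val v) + (1 - c) * vertex_weight s phi v].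
Proof.
move=> [v0 v0D] [i0 _] mD zh; pose m' v := m v + (- c) * zt v.
have m'D v : v \in D -> m' v = 0 by move=> vD; rewrite /m' mD // mulNr subrr.
have m'E v : m v = c * zt v + m' v by rewrite /m' mulNr addrC subrK.
have m's : \sum_v m' v = 1 - c.
  rewrite big_split -mulr_sumr /= (vertex_weight_sum L_finite T_univ Phi_KMS).
  by rewrite (vertex_weight_sum L_finite T_univ psi_KMS) mulr1.
pose w0 : kg_vtx N := exist _ v0 v0D.
pose l := enum 'I_k; pose eps v := gap_vector pr l m' v.
have l0 : l != [::] by apply/eqP => l0; have := mem_enum 'I_k i0; rewrite -/l l0.
have eps_ge0 v : 0 <= eps v.
  rewrite /eps gap_vectorD gap_vectorZ (gap_vector_harmonic rho_gt1 l0 zh) mulr0 addr0.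
  by apply: (kms_gap_ge0 L_finite T_univ alpha_dyn Phi_KMS); apply: enum_uniq.
(* If the defect vanishes then [m = zt], [c = 1], and any KMS state of the quotient serves. *)
have [[w ew]|ne] := pselect (exists w : kg_vtx N, 0 < eps (val w)).
  have [phi [S [phiK S0 phin gE]]] := minus_kms_of_gap (fun v => eps_ge0 (val v)) ew.
  pose u v := oapp (vertex_weight s phi) 0 (insub v : option (kg_vtx N)).
  have uD v : v \in D -> u v = 0 by move=> vD; rewrite /u insubN //= vD.
  have uN : (fun v : kg_vtx N => u (val v)) = vertex_weight s phi.
    by apply/funext => v; rewrite /u valK.
  have m'u v : m' v = S * u v.
    apply/eqP; rewrite -subr_eq0 -mulNr; apply/eqP.
    apply: (gap_vector_inj L_finite rho_gt1 D_her D_dom (l := l)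
      (u := fun v => m' v + (- S) * u v)) => [w' wD|w'].
      by rewrite m'D // uD // mulr0 addr0.
    rewrite gap_vectorD gap_vectorZ.
    have [wD|wD] := boolP (w' \in D).
      by rewrite !(gap_vector_zero_on D_her) // mulr0 addr0.
    pose x : kg_vtx N := exist _ w' wD.
    have -> : gap_vector pr l u w' = gap_vector pr l (vertex_weight s phi) x.
      by rewrite -uN (gap_vector_minus L_finite).
    by rewrite mulNr gE subrr.
  have cS : 1 - c = S.
    rewrite -m's (eq_bigr _ (fun v _ => m'u v)) -mulr_sumr (sum_vtx_minus D_her) //.
    rewrite (eq_bigr (vertex_weight s phi)) => [|v _]; last by rewrite -uN.
    by rewrite (vertex_weight_sum N_finite TD_univ phiK) mulr1.
  split; first by rewrite -subr_ge0 cS ltW.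
  by exists phi; split=> // v; rewrite m'E m'u cS -uN.
have m'0 : forall v, m' v = 0.
  apply: (gap_vector_inj L_finite rho_gt1 D_her D_dom (l := l)) => // v.
  have [vD|vD] := boolP (v \in D); first exact: (gap_vector_zero_on D_her).
  apply/le_anti; rewrite [X in _ && X]eps_ge0 andbT leNgt; apply/negP => ev.
  by apply: ne; exists (exist _ v vD : kg_vtx N).
have c1 : 1 - c = 0 by rewrite -m's big1.
split; first by rewrite -subr_ge0 c1.
have [phi [_ [phiK _ phin _]]] :=
  minus_kms_of_gap (eps := fun=> 1) (w0 := w0) (fun=> ler01) ltr01.
by exists phi; split=> // v; rewrite m'E m'0 c1 mul0r.
Qed.

End KMSDecomposition.

Theorem theorem6p5 (R : realType) (k : nat) (L : kgraph k)
  (L_finite : kg_finite L) (L_nss : kg_no_sources_sinks L)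
  (rho_gt1 : forall i : 'I_k, 1 < rho R L i)
  (rho_indep : rationally_independent (fun i : 'I_k => ln (rho R L i)))
  (D : {set kg_vtx L})
  (D_comp : kg_nontrivial_component D)
  (D_her : kg_hereditary D)
  (D_nfh : ~ kg_forwards_hereditary D)
  (D_irr : coordinatewise_irreducible R D)
  (D_rho : forall i : 'I_k, rho_on R D i = rho R L i)
  (D_dom : forall (i : 'I_k) (C : {set kg_vtx L}),
     kg_nontrivial_component C -> C <> D -> rho_on R C i < rho R L i)
  (* T = TC*(L), with the preferred dynamics *)
  (T : cStarAlgType R) (t : kg_mor L -> T) (T_univ : toeplitz_algebra t)
  (alpha : R -> T -> T)
  (alpha_dyn : toeplitz_dynamics t (fun i => ln (rho R L i)) alpha)
  (* TD = TC*(L \ D), with the induced dynamics *)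
  (TD : cStarAlgType R) (s : kg_mor (kg_minus D_her) -> TD)
  (TD_univ : toeplitz_algebra s)
  (alphaD : R -> TD -> TD)
  (alphaD_dyn : toeplitz_dynamics s (fun i => ln (rho R L i)) alphaD)
  (qD : T -> TD) (qD_quot : toeplitz_quotient t s qD)
  (z : kg_vtx L -> R) (z_def : perron_extension D z)
  (psi : T -> R[i]) (psi_KMS : KMS_state alpha (toeplitz_span t) 1 psi)
  (psi_def : forall mu nu : kg_mor L,
     psi (t mu ** star (t nu)) =
       if mu == nu then
         ((\prod_(i < k) (rho R L i) ^- (kg_deg mu i)) *
          (\sum_v `|z v|)^-1 * z (kg_src mu))%:C
       else 0)
  (Phi : T -> R[i]) (Phi_KMS : KMS_state alpha (toeplitz_span t) 1 Phi) :
  exists (a : R) (phi : TD -> R[i]),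
    [/\ 0 <= a <= 1, KMS_state alphaD (toeplitz_span s) 1 phi
      & forall x : T, Phi x = a%:C * psi x + (1 - a)%:C * phi (qD x)].
Proof.
have i0 := nontrivial_colour D_comp.
have [[v1 v1P] _] := D_comp.
have v1D : v1 \in D by apply/v1P; split; exists (kg_id L v1); rewrite kg_rng_id kg_src_id.
have D_ex : exists v, v \notin D.
  apply: contrapT => nD; apply: D_nfh => v w _ _.
  by apply/negPn/negP => vD; apply: nD; exists v.
have zh := perron_extension_harmonic L_finite rho_gt1 D_her D_dom D_rho z_def.
have [[zpos _] _ _ _] := z_def.
have b0 : 0 < \sum_v `|z v|.
  by rewrite (bigD1 v1) //= ltr_wpDr ?sumr_ge0 // normr_gt0 gt_eqF // zpos.
have tf : toeplitz_family t by case: T_univ.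
have ztE : vertex_weight t psi = fun v => (\sum_v `|z v|)^-1 * z v.
  apply/funext => v; apply: complexI; rewrite -(vertex_weightE T_univ psi_KMS).
  have -> : t (kg_id L v) = t (kg_id L v) ** star (t (kg_id L v)).
    by rewrite (toeplitz_qs tf) (toeplitz_qq tf) eqxx.
  rewrite psi_def eqxx kg_src_id big1 ?mul1r // => i _.
  by rewrite kg_deg_id ffunE expr0 invr1.
have zth i v : vertex_op i (vertex_weight t psi) v = rho R L i * vertex_weight t psi v.
  by rewrite ztE vertex_opZ zh mulrCA.
have [i _] := i0.
(* On [D] the weights of [Phi] are a multiple of those of [psi], by Perron-Frobenius. *)
have [c c0 mc] : exists2 c : R, 0 <= c &
    forall v, v \in D -> vertex_weight t Phi v = c * vertex_weight t psi v.
  apply: (subinvariant_on_component L_finite rho_gt1 D_her (D_irr i)) => [|v _|v _|v vD|v _].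
  - by apply/set0Pn; exists v1.
  - exact: (vertex_weight_ge0 T_univ Phi_KMS).
  - exact: (kms_subinvariant L_finite rho_gt1 T_univ alpha_dyn Phi_KMS).
  - by rewrite ztE mulr_gt0 ?invr_gt0 ?zpos.
  exact: zth.
have [c1 [phi [phiK phin mN]]] := kms_remainder L_finite rho_gt1 D_dom T_univ alpha_dyn
  TD_univ alphaD_dyn qD_quot Phi_KMS psi_KMS D_ex i0 mc zth.
exists c, phi; split=> //; first by rewrite c0.
apply: (kms_convex_combination L_finite rho_indep T_univ alpha_dyn TD_univ alphaD_dyn qD_quot
  Phi_KMS psi_KMS (K := 1) phiK) => // x.
by rewrite mul1r.
Qed.
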